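(* Let $\Omega\subset\mathbb{C}^n$ be a bounded domain with a $C^2$-boundary defining function $\rho$. Set $$K:=\frac{\sup_{z\in\Omega}|\nabla\rho(z)|+\sup_{z\in\Omega}|\Delta\rho(z)|}{\inf_{z\in\partial\Omega}|\nabla\rho(z)|}.$$ Let $\varphi\in C^0(\overline\Omega)$ be real valued, and set $$m_1:=\inf_{z\in\Omega}e^{-\varphi(z)},\qquad m_2:=\sup_{z\in\Omega}e^{-\varphi(z)}.$$ Then there is a constant $\delta=\delta(|\Omega|,|\partial\Omega|,K,m_1,m_2,n)>0$ (depending only on the listed quantities) such that $$\delta\int_{\Omega}|f|^2e^{-\varphi}\,d\lambda\leq\int_{\Omega}|\bar\partial f|^2e^{-\varphi}\,d\lambda+\int_{\partial\Omega}|f|^2e^{-\varphi}\,dS,\qquad\forall f\in C^1(\overline\Omega).$$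
   Context: A domain is a connected open set. A $C^2$-boundary defining function $\rho$ of $\Omega$ is a real valued $C^2$ function on a neighborhood of $\overline\Omega$ with $\rho<0$ in $\Omega$, $\rho=0$ exactly on $\partial\Omega$ (and $\rho>0$ outside $\overline\Omega$), and $\nabla\rho\neq0$ on $\partial\Omega$. $\nabla\rho$ and $\Delta\rho$ are the (real) gradient and Laplacian on $\mathbb{C}^n\cong\mathbb{R}^{2n}$. $C^1(\overline\Omega)$ is the space of complex valued functions of class $C^1$ in an open neighborhood of $\overline\Omega$. $d\lambda$ is Lebesgue measure, $dS$ is the $(2n-1)$-dimensional Hausdorff (surface) measure on $\partial\Omega$, $|\Omega|$ is the Lebesgue measure of $\Omega$ and $|\partial\Omega|$ the Hausdorff measure of $\partial\Omega$. $|\bar\partial f|^2=\sum_{j=1}^n\left|\frac{\partial f}{\partial\bar z_j}\right|^2$. *)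

(* Defs.v *)
From HB Require Import structures.
From mathcomp Require Import all_boot all_order all_algebra.
From mathcomp Require Import all_classical all_reals all_analysis.
From mathcomp Require Import complex.

Set Implicit Arguments.
Unset Strict Implicit.
Unset Printing Implicit Defensive.

Import Order.TTheory GRing.Theory Num.Theory.
Import numFieldNormedType.Exports.

Local Open Scope classical_set_scope.
Local Open Scope ring_scope.

(* The norm that the library puts on ['rV[R]_m] is the max norm. *)
Definition enorm (R : realType) (m : nat) (x : 'rV[R]_m) : R :=
  Num.sqrt (\sum_(i < m) x ord0 i ^+ 2).

Notation cnorm := ComplexField.Normc.normc.

Definition boundary (T : topologicalType) (A : set T) : set T :=
  closure A `\` interior A.

Section differential_operators.
Context (R : realType) (m : nat).
Implicit Types (U : set 'rV[R]_m) (g : 'rV[R]_m -> R) (z : 'rV[R]_m).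

Definition partial (i : 'I_m) g z : R := 'D_(delta_mx ord0 i) g z.

(* [{for z, continuous g}] and [derivable g z] ignore [U], so this is C^k
   regularity on [U] only when [U] is open. *)
Fixpoint Ck (k : nat) U g : Prop :=
  match k with
  | 0 => forall z, U z -> {for z, continuous g}
  | k'.+1 => (forall z, U z -> {for z, continuous g}) /\
      forall i, (forall z, U z -> derivable g z (delta_mx ord0 i)) /\
                Ck k' U (partial i g)
  end.

Definition gradient g z : 'rV[R]_m := \row_i partial i g z.

Definition laplacian g z : R := \sum_(i < m) partial i (partial i g) z.

Definition defining_function (k : nat) (Omega : set 'rV[R]_m) g : Prop :=
  exists U, [/\ open U, closure Omega `<=` U, Ck k U g &
    [/\ forall z, Omega z -> g z < 0,
        forall z, U z -> (g z = 0 <-> boundary Omega z),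
        forall z, U z -> ~ closure Omega z -> 0 < g z &
        forall z, boundary Omega z -> gradient g z != 0]].

End differential_operators.

(* C^n is identified with R^(n + n): the point [z] has complex coordinates
   z_j = x_j + i y_j with x_j = z ord0 (lshift n j), y_j = z ord0 (rshift n j). *)
Section complex_functions.
Context (R : realType) (n : nat).
Implicit Types (f : 'rV[R]_(n + n) -> R[i]) (z : 'rV[R]_(n + n)).

(* Regularity and partial derivatives of complex valued functions are those of
   their real and imaginary parts. *)
Definition C1_closure (Omega : set 'rV[R]_(n + n)) f : Prop :=
  exists U, [/\ open U, closure Omega `<=` U,
    Ck 1 U (fun z => complex.Re (f z)) & Ck 1 U (fun z => complex.Im (f z))].

Definition cpartial (i : 'I_(n + n)) f z : R[i] :=
  Complex (partial i (fun w => complex.Re (f w)) z)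
          (partial i (fun w => complex.Im (f w)) z).

Definition dbar (j : 'I_n) f z : R[i] :=
  (2%:R)^-1 * (cpartial (lshift n j) f z +
               Complex 0 1 * cpartial (rshift n j) f z).

Definition dbar_norm2 f z : R := \sum_(j < n) cnorm (dbar j f z) ^+ 2.

End complex_functions.

Section lebesgue_step.
Context (R : realType) (m : nat).
Context (mu : {sigma_finite_measure set (m.-tuple (measurableTypeR R)) -> \bar R}).
Local Open Scope ereal_scope.

Definition cons_tuple (p : measurableTypeR R * m.-tuple (measurableTypeR R)) :
  m.+1.-tuple (measurableTypeR R) := [the m.+1.-tuple _ of p.1 :: p.2].

Let measurable_cons_tuple : measurable_fun setT cons_tuple.
Proof. exact: measurable_cons. Qed.

Definition lebesgue_step : set (m.+1.-tuple (measurableTypeR R)) -> \bar R :=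
  pushforward (lebesgue_measure \x mu) cons_tuple.

Let step0 : lebesgue_step set0 = 0.
Proof. by rewrite /lebesgue_step /pushforward preimage_set0 measure0. Qed.

Let step_ge0 A : 0 <= lebesgue_step A.
Proof. exact: measure_ge0. Qed.

Let step_sigma_additive : semi_sigma_additive lebesgue_step.
Proof.
exact: (@measure_semi_sigma_additive _ _ _
  (measure_function_pushforward__canonical__measure_function_Measure
     (lebesgue_measure \x mu) measurable_cons_tuple)).
Qed.

HB.instance Definition _ := isMeasure.Build _ _ _ lebesgue_step
  step0 step_ge0 step_sigma_additive.

Let step_sigma_finite : sigma_finite setT lebesgue_step.
Proof.
have /sigma_finiteP[F [TF ndF Foo]] := sigma_finiteT (@lebesgue_measure R).
have /sigma_finiteP[G [TG ndG Goo]] := sigma_finiteT mu.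
pose uncons (t : m.+1.-tuple (measurableTypeR R)) :=
  (thead t, [tuple of behead t]).
have unconsK p : uncons (cons_tuple p) = p.
  case: p => x t; rewrite /uncons /cons_tuple /=; congr pair.
  exact: val_inj.
exists (fun i => uncons @^-1` (F i `*` G i)).
  apply/esym/seteqP; split=> // t _ /=.
  have [i _ Fi] : (\bigcup_i F i) (uncons t).1 by rewrite -TF.
  have [j _ Gj] : (\bigcup_i G i) (uncons t).2 by rewrite -TG.
  exists (maxn i j) => //=; split.
  - by move: Fi; apply/subsetPset/ndF/leq_maxl.
  - by move: Gj; apply/subsetPset/ndG/leq_maxr.
move=> i; have [mF Fi] := Foo i; have [mG Gi] := Goo i; split.
  rewrite -[X in measurable X]setTI.
  suff : measurable_fun setT uncons by apply => //; exact: measurableX.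
  apply/measurable_fun_pairP; split; first exact: measurable_tnth.
  exact: measurable_behead.
rewrite /lebesgue_step /pushforward -comp_preimage.
rewrite (_ : uncons \o _ = id); last by rewrite funeqE.
by rewrite preimage_id product_measure1E// lte_mul_pinfty// ge0_fin_numE.
Qed.

HB.instance Definition _ := @Measure_isSigmaFinite.Build _ _ _ lebesgue_step
  step_sigma_finite.

End lebesgue_step.

(* [lebesgue_step mu] is the product of [lebesgue_measure] and [mu], hence
   [lebesgue_tuple R m] is the m-fold product of [lebesgue_measure]. *)
Fixpoint lebesgue_tuple (R : realType) (m : nat) :
    {sigma_finite_measure set (m.-tuple (measurableTypeR R)) -> \bar R} :=
  match m with
  | 0 => \d_[tuple]
  | m'.+1 => lebesgue_step (lebesgue_tuple R m')
  end.

Section lebesgue_rV.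
Context (R : realType) (m : nat).

Definition tuple_of_rV (v : 'rV[R]_m) : m.-tuple (measurableTypeR R) :=
  [tuple v ord0 i | i < m].

Definition rV_of_tuple (t : m.-tuple (measurableTypeR R)) : 'rV[R]_m :=
  \row_i tnth t i.

(* The product (that is, Borel) sigma-algebra on ['rV[R]_m]. *)
Definition measurable_rV := g_sigma_algebra_preimageType tuple_of_rV.
HB.instance Definition _ := Measurable.on measurable_rV.

Let measurable_rV_of_tuple :
  measurable_fun setT (rV_of_tuple : _ -> measurable_rV).
Proof.
move=> _ _ [B mB <-]; rewrite !setTI -comp_preimage.
suff -> : tuple_of_rV \o rV_of_tuple = id by [].
by apply/funext => t; apply: eq_from_tnth => i; rewrite /= tnth_mktuple mxE.
Qed.

Definition lebesgue_rV : set measurable_rV -> \bar R :=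
  pushforward (lebesgue_tuple R m) (rV_of_tuple : _ -> measurable_rV).

Let lebesgue_rV0 : lebesgue_rV set0 = 0%E.
Proof. by rewrite /lebesgue_rV /pushforward preimage_set0 measure0. Qed.

Let lebesgue_rV_ge0 A : (0 <= lebesgue_rV A)%E.
Proof. exact: measure_ge0. Qed.

Let lebesgue_rV_sigma_additive : semi_sigma_additive lebesgue_rV.
Proof.
exact: (@measure_semi_sigma_additive _ _ _
  (measure_function_pushforward__canonical__measure_function_Measure
     (lebesgue_tuple R m) measurable_rV_of_tuple)).
Qed.

HB.instance Definition _ := isMeasure.Build _ _ _ lebesgue_rV
  lebesgue_rV0 lebesgue_rV_ge0 lebesgue_rV_sigma_additive.

End lebesgue_rV.

(* Volume of the unit ball of R^s, by V_(s+2) = 2 pi / (s+2) V_s; it normalizes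
   the s-dimensional Hausdorff measure so that it is the s-dimensional area on
   s-dimensional surfaces. *)
Fixpoint unit_ball_volume (R : realType) (s : nat) : R :=
  match s with
  | 0 => 1
  | 1 => 2
  | s'.+2 => 2 * pi / s'.+2%:R * unit_ball_volume R s'
  end.

Section hausdorff.
Context (R : realType) (m s : nat).
Local Open Scope ereal_scope.
Local Notation V := 'rV[R]_m.
Implicit Types (A B : set V) (d : R).

Definition diam A : \bar R :=
  ereal_sup [set (enorm (x - y))%:E | x in A & y in A].

(* [diam set0] is [-oo], and [diam A ^+ 0] is 1: the empty set is set apart so
   that it never contributes to a cover. *)
Definition hausdorff_gauge A : \bar R :=
  if A == set0 then 0
  else (unit_ball_volume R s / 2 ^+ s)%:E * diam A ^+ s.

Definition hausdorff_cover d A : set (set V)^nat :=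
  [set C : (set V)^nat | A `<=` \bigcup_k C k /\ forall k, diam (C k) <= d%:E].

Definition hausdorff_pre d A : \bar R :=
  ereal_inf [set \sum_(k <oo) hausdorff_gauge (C k) | C in hausdorff_cover d A].

Definition hausdorff A : \bar R :=
  ereal_sup [set hausdorff_pre d A | d in [set d : R | (0 < d)%R]].

Let unit_ball_volume_ge0 k : (0 <= unit_ball_volume R k)%R.
Proof.
elim: k {-2}k (leqnn k) => [|n ih] [|[|k]]//= kn.
by rewrite mulr_ge0 ?divr_ge0 ?mulr_ge0 ?pi_ge0// ih// -ltnS ltnW.
Qed.

Let gauge0 : hausdorff_gauge set0 = 0.
Proof. by rewrite /hausdorff_gauge eqxx. Qed.

Let gauge_ge0 A : 0 <= hausdorff_gauge A.
Proof.
rewrite /hausdorff_gauge; case: ifPn => // /set0P[x Ax].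
rewrite mule_ge0 ?lee_fin ?divr_ge0 ?exprn_ge0// expe_ge0//.
apply: (@le_trans _ _ (enorm (x - x))%:E); first by rewrite lee_fin sqrtr_ge0.
by apply: ereal_sup_ubound; exists x => //; exists x.
Qed.
Hint Resolve gauge_ge0 : core.

Let pre_ge0 d A : 0 <= hausdorff_pre d A.
Proof. by apply: le_ereal_inf_tmp => _ [C _ <-]; exact: nneseries_ge0. Qed.

Let le_pre d A B : A `<=` B -> hausdorff_pre d A <= hausdorff_pre d B.
Proof.
move=> AB; apply: ereal_inf_le_tmp => _ [C [BC dC] <-].
by exists C => //; split => //; exact: subset_trans BC.
Qed.

Let pre0 d : hausdorff_pre d set0 = 0.
Proof.
apply/eqP; rewrite eq_le pre_ge0 andbT; apply: ereal_inf_lbound.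
exists (fun=> set0); last by rewrite eseries0.
split => // k; rewrite /diam (_ : [set _ | _ in _ & _ in _] = set0).
  by rewrite ereal_sup0 leNye.
by apply/seteqP; split=> // x [].
Qed.

Let pre_sigma_subadditive d : sigma_subadditive (hausdorff_pre d).
Proof.
move=> A; have [[i ioo]|] := pselect (exists i, hausdorff_pre d (A i) = +oo).
  rewrite (eseries_pinfty _ _ ioo) ?leey// => n _.
  by rewrite -ltNye (lt_le_trans _ (pre_ge0 _ _)).
rewrite -forallNE => Aoo.
suff add2e (e : {posnum R}) : hausdorff_pre d (\bigcup_n A n) <=
    \sum_(i <oo) hausdorff_pre d (A i) + e%:num%:E.
  by apply/lee_addgt0Pr => _/posnumP[].
rewrite (le_trans _ (epsilon_trick _ _ _))//.
pose P n (B : (set V)^nat) := hausdorff_cover d (A n) B /\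
  \sum_(k <oo) hausdorff_gauge (B k) <=
    hausdorff_pre d (A n) + (e%:num / (2 ^ n.+1)%:R)%:E.
have [G PG] : {G : ((set V)^nat)^nat & forall n, P n (G n)}.
  apply: (@choice _ _ P) => n.
  have fpre : hausdorff_pre d (A n) \is a fin_num.
    by rewrite ge0_fin_numE// ltey; apply/eqP/Aoo.
  have en1 : (0 < e%:num / (2 ^ n.+1)%:R)%R by [].
  have [_ [B AB <-] /ltW] := lb_ereal_inf_adherent en1 fpre.
  by exists B.
pose H := hausdorff_gauge \o uncurry G.
have H0 x : 0 <= H x by exact: gauge_ge0.
apply: (@le_trans _ _ (\esum_(i in setT) H i)).
  apply: ereal_inf_lbound => /=.
  have /card_esym/ppcard_eqP[f] := card_nat2.
  exists (uncurry G \o f).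
    split => [|k]; last first.
      by rewrite /=; case: (f k) => i j; have [[_ dG] _] := PG i; exact: dG.
    move=> t [i _ /(PG i).1.1[j _ Gijt]].
    by exists (f^-1%FUN (i, j)) => //=; rewrite invK ?inE.
  rewrite -(esum_pred_image H _ xpredT) ?[fun=> _]set_true//.
  by rewrite image_eq.
rewrite (_ : esum _ _ = \sum_(i <oo) \sum_(j <oo) hausdorff_gauge (G i j)).
  apply: lee_nneseries => n *; first exact: nneseries_ge0.
  exact: (PG n).2.
pose J : nat -> set (nat * nat) := fun i => [set (i, j) | j in setT].
rewrite (_ : setT = \bigcup_k J k); last first.
  by rewrite predeqE => -[a b]; split => // _; exists a => //; exists b.
rewrite esum_bigcupT//; last first.
  apply/trivIsetP => i j _ _ ij.
  rewrite predeqE => -[n k] /=; split => //= -[] [_] _ [<-{n} _].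
  by move=> [k' _] [] /esym/eqP; rewrite (negbTE ij).
rewrite -(image_id [set: nat]) -fun_true esum_pred_image//; last first.
  by move=> n _; exact: esum_ge0.
apply: eq_eseriesr => /= j _.
rewrite -(esum_pred_image H (pair j) predT)//=; last first.
  by move=> ? ? _ _; exact: (@can_inj _ _ _ snd).
by congr esum; rewrite predeqE => -[a b]; split; move=> [i _ <-]; exists i.
Qed.

Let hausdorff0 : hausdorff set0 = 0.
Proof.
rewrite /hausdorff (_ : [set _ | _ in _] = [set 0]) ?ereal_sup1//.
apply/seteqP; split => [_ [d _ <-] /=|_ ->]; first exact: pre0.
by exists 1%R => /=; [exact: ltr01|exact: pre0].
Qed.

Let pre_le d A : (0 < d)%R -> hausdorff_pre d A <= hausdorff A.
Proof. by move=> d0; apply: ereal_sup_ubound; exists d. Qed.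

Let hausdorff_ge0 A : 0 <= hausdorff A.
Proof. exact: le_trans (pre_ge0 1%R A) (pre_le _ ltr01). Qed.

Let le_hausdorff : {homo hausdorff : A B / A `<=` B >-> A <= B}.
Proof.
move=> A B AB; apply: ge_ereal_sup => _ [d d0 <-].
exact: le_trans (le_pre _ AB) (pre_le _ d0).
Qed.

Let hausdorff_sigma_subadditive : sigma_subadditive hausdorff.
Proof.
move=> A; apply: ge_ereal_sup => _ [d d0 <-].
apply: le_trans (pre_sigma_subadditive _ _) _.
by apply: lee_nneseries => // n _; exact: pre_le.
Qed.

HB.instance Definition _ := isOuterMeasure.Build R V hausdorff
  hausdorff0 hausdorff_ge0 le_hausdorff hausdorff_sigma_subadditive.

Definition hausdorff_outer : {outer_measure set V -> \bar R} := hausdorff.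

(* Its sigma-algebra is that of the Caratheodory measurable sets. *)
Definition hausdorff_measure :
    {measure set (caratheodory_type hausdorff_outer) -> \bar R} :=
  (hausdorff_outer : set (caratheodory_type hausdorff_outer) -> \bar R).

End hausdorff.
Arguments hausdorff {R m} s A.
Arguments hausdorff_outer {R m} s.
Arguments hausdorff_measure {R m} s.

(* Main.v *)
(* Let Q = |f|^2, and let P_eps be the Poisson type kernel obtained as the
   divergence of the regularised Newton field x / (|x|^2 + eps^2)^n on R^(2n).
   Where f does not vanish, f^2 times the convolution of conj(f^2)/|f|^2 with
   P_eps over Omega has, in the limit, real part at least c Q. Since P_eps is a
   dbar-divergence, this product is the sum of the dconj(z_j) derivatives of
   f^2 W_j, for bounded W_j, minus the sum of 2 f (df/dconj(z_j)) W_j. The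
   integral of the latter is absorbed by c Q and |dbar f|^2 with Young's
   inequality. The former is a divergence of fields bounded by a multiple of Q,
   so its integral is at most a constant times the boundary integral of Q.

   This last step needs no regularity of the boundary. By translation
   invariance of the volume, the integral of a difference quotient with step t
   only sees the points at which a segment of length t leaves Omega. Their
   Q-mass is O(t) times the boundary integral of Q, because a set of finite
   (m-1)-dimensional Hausdorff measure H has a t-neighbourhood in a fixed
   direction of volume O(t H). Hence the constant depends only on |Omega|, m1,
   m2 and n. *)
Require Import Defs.
From mathcomp Require Import all_boot all_order all_algebra.
From mathcomp Require Import all_classical all_reals all_analysis.
From mathcomp Require Import complex.
From mathcomp Require Import measurable_realfun ring lra zify.
Set Implicit Arguments.
Unset Strict Implicit.
Unset Printing Implicit Defensive.
Import Order.TTheory GRing.Theory Num.Theory.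
Import numFieldNormedType.Exports.
Local Open Scope classical_set_scope.
Local Open Scope ring_scope.

(** * Lebesgue measure on row vectors *)

(** Only the derivatives of f in conj(z_j) may appear, so the divergence has to act on a holomorphic
    expression in f. This excludes |f|^2, whereas f^2 contributes just 2 f (df/dconj(z_j)) and still
    has the size |f|^2 that the boundary term can pay for. Its argument is undone by
    conj(f^2)/|f|^2, whose modulus is at most 1; hence the bound on W_j does not depend on f.

    That phase is merely measurable, so every derivative must be carried by the kernel. The first
    derivatives of the Newton field are not locally integrable, which forces the regularisation,
    with eps = 2^-K. The bounds on W_j are uniform in K. Those on its derivatives blow up with K and
    serve only integrability and domination at fixed K.

    For the Poisson kernel a lower bound of the mass near the origin is enough. It controls a lower
    limit only, so dominated convergence is applied to a minimum with the expected value. A boundary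
    integral of |f|^2 that is infinite is treated apart: the right-hand side is then infinite
    too. *)

Section lebesgue_tuple.
Context (R : realType).
Local Open Scope ereal_scope.

Lemma lebesgue_tuple_box m (a b : 'I_m -> R) :
  (forall i, a i <= b i)%R ->
  lebesgue_tuple R m [set t | forall i, tnth t i \in `[a i, b i]] =
  (\prod_i (b i - a i))%:E.
Proof.
elim: m a b => [|m ih] a b ab.
  by rewrite big_ord0 /= diracE mem_set//= => -[].
rewrite /= /lebesgue_step /pushforward.
pose B := [set t : m.-tuple (measurableTypeR R) |
  forall i, tnth t i \in `[a (lift ord0 i), b (lift ord0 i)]].
rewrite (_ : _ @^-1` _ = `[a ord0, b ord0] `*` B); last first.
  apply/seteqP; split => -[x t]/= => [xt|[x0 tB] i].
    split; first by have := xt ord0.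
    by move=> i; have := xt (lift ord0 i); rewrite tnthS.
  case: (unliftP ord0 i) => [j ->|->]; last by rewrite tnth0.
  by rewrite tnthS; exact: tB.
have mB : measurable B.
  rewrite (_ : B = \bigcap_(i in [set: 'I_m])
    ((@tnth _ (measurableTypeR R))^~ i @^-1`
       `[a (lift ord0 i), b (lift ord0 i)])); last first.
    by apply/seteqP; split => t/= h i; [move=> _; exact: h|exact: h].
  apply: fin_bigcap_measurable => [|i _]; first exact: finite_finset.
  rewrite -[X in measurable X]setTI; apply: measurable_tnth => //.
rewrite product_measure1E// ih//.
rewrite big_ord_recl EFinM; congr (_ * _).
rewrite [LHS](@lebesgue_measure_itv R `[a ord0, b ord0])/= lte_fin.
case: ltP => // ba; have -> : a ord0 = b ord0 by apply/eqP; rewrite eq_le ba ab.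
by rewrite subrr.
Qed.

Definition tuple_shift m (v : 'I_m -> R)
    (t : m.-tuple (measurableTypeR R)) : m.-tuple (measurableTypeR R) :=
  [tuple (tnth t i + v i)%R | i < m].

Lemma measurable_tuple_shift m (v : 'I_m -> R) :
  measurable_fun setT (tuple_shift v).
Proof.
apply/measurable_fun_tnthP => i.
rewrite (_ : _ \o _ = (fun t => tnth t i + v i)%R); last first.
  by apply/funext => t /=; rewrite tnth_mktuple.
apply: measurable_funD => //; exact: measurable_tnth.
Qed.

Lemma lebesgue_measure_shift (r : R) (A : set (measurableTypeR R)) :
  measurable A ->
  lebesgue_measure ((fun x => x + r)%R @^-1` A) = lebesgue_measure A.
Proof.
move=> mA.
have mf : measurable_fun setT (fun x : measurableTypeR R => x + r : measurableTypeR R)%R.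
  exact: measurable_funD.
apply/esym; apply: (@lebesgue_measure_unique R
   (measure_function_pushforward__canonical__measure_function_Measure
     (@lebesgue_measure R) mf) _ A mA).
move=> _ [[a b] _ <-] /=; rewrite /pushforward.
rewrite (_ : _ @^-1` _ = `](a - r)%R, (b - r)%R]%classic); last first.
  apply/seteqP; split => x /=; rewrite !in_itv/=; lra.
rewrite !lebesgue_measure_itv/= !lte_fin ltrD2r; case: ifP => // _.
by rewrite -!EFinB; congr EFin; ring.
Qed.

(** Induction on the dimension: the shift acts on each factor separately, so the pushforward of the
    product measure agrees with that measure on rectangles, which determine it. *)
Lemma lebesgue_tuple_shift m (v : 'I_m -> R)
    (A : set (m.-tuple (measurableTypeR R))) :
  measurable A ->
  lebesgue_tuple R m (tuple_shift v @^-1` A) = lebesgue_tuple R m A.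
Proof.
elim: m v A => [|m ih] v A mA.
  congr (_ _); apply/seteqP; split => t /=; by rewrite (tuple0 (tuple_shift _ _)) (tuple0 t).
rewrite /= /lebesgue_step /pushforward -comp_preimage.
pose w (i : 'I_m) := v (lift ord0 i).
pose s (p : measurableTypeR R * m.-tuple (measurableTypeR R)) :
    measurableTypeR R * m.-tuple (measurableTypeR R) :=
  ((p.1 + v ord0)%R, tuple_shift w p.2).
have ms : measurable_fun setT s.
  apply/measurable_fun_pairP; split; first exact: measurable_funD.
  exact: (measurableT_comp (measurable_tuple_shift w) measurable_snd).
rewrite (_ : tuple_shift _ \o _ = @Defs.cons_tuple R m \o s); last first.
  apply/funext => -[x t]; apply: eq_from_tnth => i /=.
  rewrite tnth_mktuple; case: (unliftP ord0 i) => [j ->|->].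
    by rewrite !tnthS/= tnth_mktuple.
  by rewrite !tnth0.
rewrite comp_preimage.
have mcA : measurable (@Defs.cons_tuple R m @^-1` A).
  by rewrite -[X in measurable X]setTI; apply: (@measurable_cons _ _ _ _ fst m snd).
apply/esym; apply: (@product_measure_unique _ _ _ _ _ (@lebesgue_measure R)
  (lebesgue_tuple R m)
  (measure_function_pushforward__canonical__measure_function_Measure
     (lebesgue_measure \x lebesgue_tuple R m) ms) _ _ mcA).
move=> B C mB mC.
transitivity ((lebesgue_measure \x lebesgue_tuple R m)
  (((fun x => x + v ord0)%R @^-1` B) `*` (tuple_shift w @^-1` C))); first by [].
rewrite product_measure1E; last 2 first.
- rewrite -[X in measurable X]setTI; exact: measurable_funD.
- rewrite -[X in measurable X]setTI; exact: measurable_tuple_shift.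
by rewrite ih//; congr (_ * _)%E; exact: lebesgue_measure_shift.
Qed.

End lebesgue_tuple.

Section lebesgue_rV_theory.
Context (R : realType) (m : nat).
Local Notation V := (measurable_rV R m).
Local Notation vol := (@lebesgue_rV R m).

Lemma rV_of_tupleK : cancel (@rV_of_tuple R m) (@tuple_of_rV R m).
Proof. by move=> t; apply: eq_from_tnth => i; rewrite tnth_mktuple mxE. Qed.

Lemma measurable_coord (i : 'I_m) :
  measurable_fun [set: V] (fun v : V => v ord0 i).
Proof.
move=> _ B mB.
rewrite [X in measurable X](_ : _ = @tuple_of_rV R m @^-1`
  ((@tnth _ (measurableTypeR R))^~ i @^-1` B)); last first.
  by rewrite setTI; apply/seteqP; split => v /=; rewrite tnth_mktuple.
exists ((@tnth _ (measurableTypeR R))^~ i @^-1` B); last by rewrite setTI.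
by rewrite -[X in measurable X]setTI; exact: (measurable_tnth i measurableT mB).
Qed.

Definition box (a b : 'I_m -> R) : set V :=
  [set v | forall i, v ord0 i \in `[a i, b i]].

Lemma measurable_box (a b : 'I_m -> R) : measurable (box a b).
Proof.
rewrite (_ : box a b = \bigcap_(i in [set: 'I_m])
  ((fun v : V => v ord0 i) @^-1` `[a i, b i])); last first.
  by apply/seteqP; split => t/= h i; [move=> _; exact: h|exact: h].
apply: fin_bigcap_measurable => [|i _]; first exact: finite_finset.
by rewrite -[X in measurable X]setTI; apply: measurable_coord.
Qed.

Lemma lebesgue_rV_box (a b : 'I_m -> R) : (forall i, a i <= b i) ->
  vol (box a b) = (\prod_i (b i - a i))%:E.
Proof.
move=> ab; rewrite /lebesgue_rV /pushforward -lebesgue_tuple_box//.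
congr (_ _); apply/seteqP; split => t /= h i; by have := h i; rewrite mxE.
Qed.

Lemma open_box_subset (U : set 'rV[R]_m) (x : 'rV[R]_m) : open U -> U x ->
  exists e : R, 0 < e /\ forall y : 'rV[R]_m,
    (forall i, `|y ord0 i - x ord0 i| < e) -> U y.
Proof.
rewrite openE => oU /oU /nbhs_ballP[e /= e0 xeU]; exists e; split => // y yx.
apply: xeU; split => // i j; rewrite ord1.
by rewrite /ball/= distrC; exact: yx.
Qed.

(** The sigma-algebra is generated by the coordinates and the topology by the max norm. Boxes with
    rational corners link the two: there are countably many, and those inside [U] cover it. *)
Lemma open_measurable_rV (U : set 'rV[R]_m) : open U -> measurable (U : set V).
Proof.
move=> oU.
pose bx (p : {ffun 'I_m -> rat} * {ffun 'I_m -> rat}) : set V :=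
  box (fun i => ratr (p.1 i)) (fun i => ratr (p.2 i)).
rewrite (_ : U = \bigcup_(p in [set p | bx p `<=` U]) bx p); last first.
  apply/seteqP; split => [x Ux|x [p]]; last exact.
  have [e [e0 xeU]] := open_box_subset oU Ux.
  have /choice[p hp] : forall i, exists q : rat, ratr q \in `]x ord0 i - e, x ord0 i[.
    move=> i; apply: rat_in_itvoo; lra.
  have /choice[q hq] : forall i, exists q : rat, ratr q \in `]x ord0 i, x ord0 i + e[.
    move=> i; apply: rat_in_itvoo; lra.
  exists ([ffun i => p i], [ffun i => q i]) => /= [y yb|i].
    apply: xeU => i; have := yb i; have := hp i; have := hq i.
    by rewrite !in_itv/= !ffunE => *; rewrite ltr_norml; lra.
  by have := hp i; have := hq i; rewrite !in_itv/= !ffunE; lra.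
rewrite bigcup_mkcond; apply: countable_bigcupT_measurable => [|p].
  exact: countableP.
by case: ifP => // _; exact: measurable_box.
Qed.

Lemma within_continuous_measurable_rV (D : set 'rV[R]_m) (f : 'rV[R]_m -> R) :
  measurable (D : set V) -> {within D, continuous f} ->
  measurable_fun (D : set V) f.
Proof.
move=> mD /continuousP cf; apply: (measurability _ (RGenOpens.measurableE R)).
move=> _ [_ [a [b ->] <-]].
have /open_subspaceP[W oW WD] : open ((f : subspace D -> R) @^-1` `]a, b[).
  exact/cf/interval_open.
rewrite setIC -WD; apply: measurableI => //; exact: open_measurable_rV.
Qed.

Definition rV_shift (v : 'rV[R]_m) (x : V) : V := (x + v : 'rV[R]_m).

Lemma measurable_rV_shift v : measurable_fun setT (rV_shift v).
Proof.
move=> _ _ [B mB <-]; rewrite !setTI.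
exists (tuple_shift (fun i => v ord0 i) @^-1` B).
  by rewrite -[X in measurable X]setTI; apply: measurable_tuple_shift.
have E x : tuple_of_rV (rV_shift v x) = tuple_shift (fun i => v ord0 i) (tuple_of_rV x).
  by apply: eq_from_tnth => i; rewrite !tnth_mktuple mxE.
by rewrite setTI; apply/seteqP; split => x /=; rewrite E.
Qed.

Lemma lebesgue_rV_shift v (A : set V) : measurable A ->
  vol (rV_shift v @^-1` A) = vol A.
Proof.
move=> [B mB <-]; rewrite setTI.
have E t : tuple_of_rV (rV_shift v (rV_of_tuple t)) = tuple_shift (fun i => v ord0 i) t.
  by apply: eq_from_tnth => i; rewrite !tnth_mktuple !mxE.
transitivity (lebesgue_tuple R m (tuple_shift (fun i => v ord0 i) @^-1` B)).
  by congr (lebesgue_tuple R m _); apply/seteqP; split => t /=; rewrite E.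
rewrite lebesgue_tuple_shift//; congr (lebesgue_tuple R m _).
by apply/seteqP; split => t /=; rewrite rV_of_tupleK.
Qed.

Local Open Scope ereal_scope.

Lemma ge0_integral_rV_shift v (f : V -> \bar R) (D : set V) : measurable D ->
  measurable_fun D f -> {in D, forall y, 0 <= f y} ->
  \int[vol]_(x in rV_shift v @^-1` D) f (rV_shift v x) = \int[vol]_(x in D) f x.
Proof.
move=> mD mf f0; rewrite -(ge0_integral_pushforward (measurable_rV_shift v))//.
apply: eq_measure_integral => [|? A mA AD]; first exact: measurable_rV_shift.
exact: lebesgue_rV_shift.
Qed.

Lemma integral_rV_shift v (f : V -> \bar R) (D : set V) : measurable D ->
  measurable_fun D f ->
  \int[vol]_(x in rV_shift v @^-1` D) f (rV_shift v x) = \int[vol]_(x in D) f x.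
Proof.
move=> mD mf; rewrite integralE [RHS]integralE.
congr (_ - _).
- rewrite -(ge0_integral_rV_shift v mD (measurable_funepos mf)) => [|y _]; last exact: funepos_ge0.
  by apply: eq_integral => x _; rewrite !funeposE.
- rewrite -(ge0_integral_rV_shift v mD (measurable_funeneg mf)) => [|y _]; last exact: funeneg_ge0.
  by apply: eq_integral => x _; rewrite !funenegE.
Qed.

End lebesgue_rV_theory.

Section norms.
Context (R : realType) (m : nat).
Implicit Types x y : 'rV[R]_m.

Lemma ler_coord_norm x i : `|x ord0 i| <= `|x|.
Proof.
by rewrite [leRHS]mx_normrE; exact: (le_bigmax _ (fun ij => `|x ij.1 ij.2|) (ord0, i)).
Qed.

Lemma norm_rV_le x r : 0 <= r -> (forall i, `|x ord0 i| <= r) -> `|x| <= r.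
Proof.
move=> r0 xr; rewrite [leLHS]mx_normrE; apply/bigmax_leP; split => // -[i j] _ /=.
by rewrite ord1.
Qed.

Lemma coord_le_enorm x i : `|x ord0 i| <= enorm x.
Proof.
rewrite /enorm -sqrtr_sqr ler_sqrt ?sumr_ge0// => [|? _]; last exact: sqr_ge0.
by rewrite (bigD1 i)//= lerDl sumr_ge0// => j _; exact: sqr_ge0.
Qed.

Lemma norm_le_enorm x : `|x| <= enorm x.
Proof. by apply: norm_rV_le; [exact: sqrtr_ge0|exact: coord_le_enorm]. Qed.

End norms.

(** * Hausdorff measure and tubes *)

(** The distance is that of the max norm. It is at most the Euclidean one used by [diam], so a set
    of diameter less than [r] still cannot meet both [A] and [B]. *)
Definition separated (R : realType) (m : nat) (A B : set 'rV[R]_m) :=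
  exists2 r : R, 0 < r & forall x y, A x -> B y -> r <= `|x - y|.

Section metric_outer_measure.
Context (R : realType) (m : nat) (mu : {outer_measure set 'rV[R]_m -> \bar R}).
Hypothesis muS : forall A B, separated A B -> (mu A + mu B <= mu (A `|` B))%E.
Local Open Scope ereal_scope.

(* Caratheodory's argument: [B k] collects the points of [X] at distance about
   [1/k] from [F]. Layers of the same parity are separated, so the series of
   their measures converges, and [X `&` ~` F] is [A k] up to its tail. *)
Section layers.
Variables F X : set 'rV[R]_m.
Let A k := [set x | X x /\ forall y, F y -> (k.+1%:R^-1 <= `|x - y|)%R].
Let B k := A k.+1 `\` A k.

Let leA k l : (k <= l)%N -> A k `<=` A l.
Proof.
move=> kl x [Xx xF]; split => // y /xF; apply: le_trans.
by rewrite lef_pV2 ?posrE// ler_nat ltnS.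
Qed.

Let sepAF k : separated (A k) F.
Proof. by exists k.+1%:R^-1%R => // x y [_ xF] /xF. Qed.

Let sepAB k l : (k < l)%N -> separated (A k) (B l).
Proof.
move=> kl; exists (k.+1%:R^-1 - l.+1%:R^-1)%R.
  by rewrite subr_gt0 ltf_pV2 ?posrE// ltr_nat ltnS.
move=> x y [Xx xF] [[Xy _]] /not_andP[//|/existsNP[z /not_implyP[Fz /negP]]].
rewrite -ltNge => yz; have := xF _ Fz.
have := ler_distD y x z; move: yz.
by move: (_^-1)%R (_^-1)%R (`|x - y|)%R (`|y - z|)%R (`|x - z|)%R => *; lra.
Qed.

Let sumB c n : (c <= 1)%N ->
  \sum_(0 <= i < n) mu (B (i.*2 + c)) <= mu X.
Proof.
move=> c1.
suff h : \sum_(0 <= i < n) mu (B (i.*2 + c)) <= mu (\bigcup_(i < n) B (i.*2 + c)).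
  apply: (le_trans h); apply: le_outer_measure => x [i _] [[]] //.
elim: n => [|n ih]; first by rewrite big_nil outer_measure_ge0.
rewrite big_nat_recr//=; apply: le_trans.
  by apply: leeD2r; exact: ih.
case: n ih => [|n] _.
  rewrite II0 bigcup_set0 outer_measure0 add0e; apply: le_outer_measure.
  by move=> x Bx; exists 0%N.
apply: (@le_trans _ _ (mu (\bigcup_(i < n.+1) B (i.*2 + c) `|` B (n.+1.*2 + c)))).
  apply: muS.
  have [r r0 h] : separated (A (n.*2 + c).+1) (B (n.+1.*2 + c)) by apply: sepAB; lia.
  exists r => // x y [i /= ni [Ax _]] By; apply: h => //.
  by apply: leA Ax; lia.
apply: le_outer_measure => x [[i /= ni Bx]|Bx]; first by exists i => //=; lia.
by exists n.+1 => //=.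
Qed.

Lemma closed_split : closed F -> mu X < +oo ->
  mu (X `&` F) + mu (X `&` ~` F) <= mu X.
Proof.
move=> cF Xoo.
have sumBoo : \sum_(0 <= i <oo) mu (B i) < +oo.
  apply: (@le_lt_trans _ _ (mu X + mu X)); last by rewrite lte_add_pinfty.
  apply: lime_le => [|].
    by apply: is_cvg_nneseries => *; exact: outer_measure_ge0.
  apply: nearW => n; apply: (@le_trans _ _ (\sum_(0 <= i < n.*2) mu (B i))).
    apply: lee_sum_nneg_natr => [? *|]; [exact: outer_measure_ge0|lia].
  apply: (@le_trans _ _ (\sum_(0 <= i < n) mu (B (i.*2 + 0)) +
                         \sum_(0 <= i < n) mu (B (i.*2 + 1)))); last first.
    by apply: leeD; exact: sumB.
  rewrite -big_split/=; elim: n => [|n ih]; first by rewrite !big_nil.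
  rewrite doubleS !big_nat_recr//= -addeA; apply: leeD => //.
  by rewrite addn0 addn1.
(* Closedness of [F] enters here: a point off [F] has positive distance from it, hence lies in some
   [A N]. If it is not in [A k], the least such index names its layer. *)
have XF k : X `&` ~` F `<=` A k `|` \bigcup_(i in [set i | (k <= i)%N]) B i.
  move=> x [Xx nFx].
  have [e [e0 eF]] := open_box_subset (closed_openC cF) nFx.
  have [N Ne] : exists N, A N x.
    have [N _ /(_ _ (leqnn N)) /= Ne] := near_infty_natSinv_lt (PosNum e0).
    exists N; split => // y Fy; rewrite leNgt; apply/negP => xy.
    apply: (eF y) => // i; rewrite distrC.
    have := ler_coord_norm (x - y)%R i; rewrite !mxE => h; apply: (le_lt_trans h).
    exact: lt_trans xy Ne.
  have [Akx|nAkx] := pselect (A k x); first by left.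
  have PN : exists n, `[< A n x >] by exists N; exact/asboolP.
  right; case: (ex_minnP PN) => -[|j] /asboolP Aj jmin.
    by exfalso; apply: nAkx; apply: leA Aj.
  have kj : (k <= j)%N.
    rewrite leqNgt; apply/negP => jk; apply: nAkx; exact: leA Aj.
  exists j => //; split => // /asboolP /jmin; by rewrite ltnn.
have tail0 := nneseries_tail_cvg sumBoo (fun k _ => outer_measure_ge0 mu (B k)).
have fX : mu X \is a fin_num by rewrite ge0_fin_numE// outer_measure_ge0.
apply/lee_addgt0Pr => e e0.
have [k ke] : exists k, \sum_(k <= i <oo) mu (B i) <= e%:E.
  move/fine_cvgP : tail0 => [[N1 _ fin] /cvgrPdist_lt/(_ _ e0)[N2 _ N2e]].
  exists (maxn N1 N2); rewrite -[leLHS]fineK ?fin//= ?leq_maxl// lee_fin.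
  have := N2e _ (leq_maxr N1 N2); rewrite sub0r normrN => /ltW.
  exact/le_trans/ler_norm.
apply: (@le_trans _ _ (mu (X `&` F) + (mu (A k) + \sum_(k <= i <oo) mu (B i)))).
  apply: leeD => //; apply: (le_trans (le_outer_measure mu _ _ (XF k))).
  apply: (le_trans (outer_measureU2 mu _ _)); apply: leeD => //.
  rewrite -nneseries_addn; last by move=> i; exact: outer_measure_ge0.
  apply: le_trans (outer_measure_sigma_subadditive mu (fun i => B (i + k)%N)).
  apply: le_outer_measure => x [i /= ki Bx]; exists (i - k)%N => //.
  by rewrite subnK.
rewrite addeA; apply: leeD => //.
apply: (@le_trans _ _ (mu (A k `|` (X `&` F)))); last first.
  by apply: le_outer_measure => x [[]|[]].
rewrite addeC; apply: muS; have [r r0 h] := sepAF k; exists r => // x y Ax [_ Fy].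
exact: h.
Qed.

End layers.

Lemma closed_caratheodory (F : set 'rV[R]_m) : closed F ->
  mu.-caratheodory F.
Proof.
move=> cF; apply: le_caratheodory_measurable => X.
have [Xoo|] := ltP (mu X) +oo; first exact: closed_split.
by rewrite leye_eq => /eqP ->; rewrite leey.
Qed.

End metric_outer_measure.

(** * Hausdorff measure is additive on separated sets *)

Section hausdorff_theory.
Context (R : realType) (m s : nat).
Local Open Scope ereal_scope.
Local Notation V := 'rV[R]_m.
Implicit Types A B C : set V.
Local Notation H := (@hausdorff_outer R m s).

Lemma unit_ball_volume_gt0 k : (0 < unit_ball_volume R k)%R.
Proof.
elim: k {-2}k (leqnn k) => [|n ih] [|[|k]]//= kn.
by rewrite mulr_gt0 ?divr_gt0 ?mulr_gt0 ?pi_gt0// ih// -ltnS ltnW.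
Qed.

Lemma diam_ge0 C x : C x -> 0 <= diam C.
Proof.
move=> Cx; apply: (@le_trans _ _ (enorm (x - x))%:E).
  by rewrite lee_fin sqrtr_ge0.
by apply: ereal_sup_ubound; exists x => //; exists x.
Qed.

Lemma le_diam C x y : C x -> C y -> (enorm (x - y))%:E <= diam C.
Proof. by move=> Cx Cy; apply: ereal_sup_ubound; exists x => //; exists y. Qed.

Lemma diam_set0 : diam (@set0 V) = -oo.
Proof.
rewrite /diam (_ : [set _ | _ in _ & _ in _] = set0) ?ereal_sup0//.
by apply/seteqP; split=> // x [].
Qed.

Lemma hausdorff_gauge0 : hausdorff_gauge s (@set0 V) = 0.
Proof. by rewrite /hausdorff_gauge eqxx. Qed.

Lemma hausdorff_gauge_ge0 C : 0 <= hausdorff_gauge s C.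
Proof.
rewrite /hausdorff_gauge; case: ifPn => // /set0P[x Cx].
rewrite mule_ge0 ?expe_ge0 ?(diam_ge0 Cx)// lee_fin divr_ge0 ?exprn_ge0//.
exact/ltW/unit_ball_volume_gt0.
Qed.

Lemma hausdorff_pre_le d A : (0 < d)%R -> hausdorff_pre s d A <= H A.
Proof. by move=> d0; apply: ereal_sup_ubound; exists d. Qed.

Lemma hausdorff_pre_anti d d' A : (d <= d')%R ->
  hausdorff_pre s d' A <= hausdorff_pre s d A.
Proof.
move=> dd'; apply: ereal_inf_le_tmp => _ [C [AC dC] <-].
by exists C => //; split => // k; apply: (le_trans (dC k)); rewrite lee_fin.
Qed.

Lemma hausdorff_pre_ge0 d A : 0 <= hausdorff_pre s d A.
Proof.
by apply: le_ereal_inf_tmp => _ [C _ <-]; apply: nneseries_ge0 => *; exact: hausdorff_gauge_ge0.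
Qed.

(** No set of the cover, having diameter at most [d < r], meets both [A] and [B]. Keeping the sets
    that meet [A], respectively [B], and emptying the others gives two covers whose gauges add up to
    at most the original sum. *)
Lemma hausdorff_pre_separated d r A B : (d < r)%R ->
  (forall x y, A x -> B y -> (r <= `|x - y|)%R) ->
  hausdorff_pre s d A + hausdorff_pre s d B <= hausdorff_pre s d (A `|` B).
Proof.
move=> dr sepAB; apply: le_ereal_inf_tmp => _ [C [ABC dC] <-].
pose CA (D : set V) k : set V := if `[< C k `&` D !=set0 >] then C k else set0.
have CAle D k : diam (CA D k) <= d%:E.
  by rewrite /CA; case: ifP => // _; rewrite diam_set0 leNye.
have CAcov D : D `<=` A `|` B -> D `<=` \bigcup_k CA D k.
  move=> DAB x Dx; have [k _ Ckx] := ABC _ (DAB _ Dx); exists k => //.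
  by rewrite /CA; case: asboolP => // -[]; exists x.
have CApre D : D `<=` A `|` B ->
    hausdorff_pre s d D <= \sum_(k <oo) hausdorff_gauge s (CA D k).
  by move=> DAB; apply: ereal_inf_lbound; exists (CA D) => //; split => //; exact: CAcov.
apply: (@le_trans _ _ (\sum_(k <oo) hausdorff_gauge s (CA A k) +
                       \sum_(k <oo) hausdorff_gauge s (CA B k))).
  by apply: leeD; apply: CApre => x; [left|right].
rewrite -nneseriesD => [|*|*]; try exact: hausdorff_gauge_ge0.
apply: lee_nneseries => [*|k _].
  by rewrite adde_ge0// hausdorff_gauge_ge0.
rewrite /CA; case: asboolP => [[x [Cx Ax]]|_]; last first.
  rewrite hausdorff_gauge0 add0e; case: ifP => // _.
  by rewrite hausdorff_gauge0 hausdorff_gauge_ge0.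
case: asboolP => [[y [Cy By]]|_]; last by rewrite hausdorff_gauge0 adde0.
exfalso; have := le_trans (le_diam Cx Cy) (dC k); rewrite lee_fin => xyd.
have := sepAB _ _ Ax By; have := norm_le_enorm (x - y)%R; lra.
Qed.

(** The two suprema on the left run over independent scales [d] and [d']. Both are lowered to a
    common scale below [r], which only increases [hausdorff_pre]. *)
Lemma hausdorff_separated A B : separated A B -> H A + H B <= H (A `|` B).
Proof.
move=> [r r0 sepAB].
have h d d' : (0 < d)%R -> (0 < d')%R ->
    hausdorff_pre s d A + hausdorff_pre s d' B <= H (A `|` B).
  move=> d0 d'0; pose e : R := Num.min (Num.min d d') (r / 2)%R.
  have e0 : (0 < e)%R by rewrite !lt_min d0 d'0/= divr_gt0.
  have er : (e < r)%R by rewrite /e !gt_min; apply/orP; right; lra.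
  apply: le_trans (hausdorff_pre_le _ e0).
  apply: le_trans (hausdorff_pre_separated er sepAB).
  by apply: leeD; apply: hausdorff_pre_anti; rewrite /e !ge_min lexx ?orbT.
have [->|Hfin] := eqVneq (H (A `|` B)) +oo; first by rewrite leey.
have fin D : D `<=` A `|` B -> H D \is a fin_num.
  move=> DAB; rewrite ge0_fin_numE ?outer_measure_ge0//.
  by apply: (le_lt_trans (le_outer_measure H _ _ DAB)); rewrite ltey.
have fin_pre d D : (0 < d)%R -> D `<=` A `|` B -> hausdorff_pre s d D \is a fin_num.
  move=> d0 DAB; rewrite ge0_fin_numE ?hausdorff_pre_ge0//.
  apply: (le_lt_trans (hausdorff_pre_le _ d0)).
  by rewrite -ge0_fin_numE ?outer_measure_ge0 ?fin.
have finB : H B \is a fin_num by apply: fin; exact: subsetUr.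
rewrite -leeBrDr//; apply: ge_ereal_sup => _ [d d0 <-].
have finA : hausdorff_pre s d A \is a fin_num by apply: fin_pre => //; exact: subsetUl.
rewrite leeBrDr// addeC -leeBrDr//; apply: ge_ereal_sup => _ [d' d'0 <-].
by rewrite leeBrDr// addeC h.
Qed.

Lemma closed_hausdorff_measurable (F : set V) : closed F ->
  measurable (F : set (caratheodory_type H)).
Proof. by move=> cF; apply: closed_caratheodory => //; exact: hausdorff_separated. Qed.

End hausdorff_theory.

(** * Volume of tubes in a coordinate direction *)

Section tube.
Context (R : realType) (m : nat).
Local Notation V := 'rV[R]_m.
Local Notation vol := (@lebesgue_rV R m).
Local Notation H := (@hausdorff_outer R m m.-1).

(** A set of diameter d <= t, moved by at most t along one axis, fits in a box of volume 2 (d + t)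
    (2 d)^(m-1) <= 4 t (2 d)^(m-1). Dividing by t and by the gauge of the set, the unit ball volume
    times (d / 2)^(m-1), leaves this constant. *)
Definition tube_const : R := 4 * 4 ^+ m.-1 / unit_ball_volume R m.-1.

Lemma tube_const_gt0 : 0 < tube_const.
Proof. by rewrite divr_gt0 ?mulr_gt0 ?exprn_gt0// unit_ball_volume_gt0. Qed.

Lemma tube_box (i : 'I_m) (t : R) (C : set V) : 0 < t -> (diam C <= t%:E)%E ->
  exists T : set (measurable_rV R m), [/\ measurable T,
    forall p r, C p -> `|r| <= t -> T (p + r *: delta_mx ord0 i) &
    (vol T <= (tube_const * t)%:E * hausdorff_gauge m.-1 C)%E].
Proof.
move=> t0 dC; have [->|/set0P[x Cx]] := eqVneq C set0.
  by exists set0; split => //; rewrite hausdorff_gauge0 measure0 mule0.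
have d0 := diam_ge0 Cx.
have dfin : diam C \is a fin_num.
  by rewrite ge0_fin_numE// (le_lt_trans dC)// ltry.
set d := fine (diam C).
have dE : diam C = d%:E by rewrite fineK.
have {}d0 : 0 <= d by rewrite -lee_fin -dE.
have dt : d <= t by rewrite -lee_fin -dE.
pose w (j : 'I_m) := if j == i then d + t else d.
have wd j : d <= w j by rewrite /w; case: ifP => // _; lra.
exists (box (fun j => x ord0 j - w j) (fun j => x ord0 j + w j)); split.
- exact: measurable_box.
- move=> p r Cp rt j; rewrite !mxE eqxx/= in_itv/=.
  have := le_diam Cp Cx; rewrite dE lee_fin.
  have := coord_le_enorm (p - x) j; rewrite !mxE ler_norml => /andP[h1 h2] h3.
  move: rt; rewrite ler_norml /w eq_sym => /andP[h4 h5].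
  by case: ifP => _; rewrite ?mulr1 ?mulr0 ?addr0; lra.
rewrite lebesgue_rV_box; last by move=> j; have := wd j; lra.
rewrite /hausdorff_gauge ifF; last by apply/negbTE/set0P; exists x.
rewrite dE -EFin_expe -!EFinM lee_fin.
rewrite (bigD1 i)//= {1 2}/w eqxx (eq_bigr (fun=> 2 * d)); last first.
  by move=> j ji; rewrite /w (negbTE ji); ring.
rewrite prodr_const/= (eq_card (B := predC1 i)) ?cardC1 ?card_ord//.
rewrite (_ : tube_const * t * _ = 4 * t * (2 * d) ^+ m.-1); last first.
  rewrite /tube_const exprMn (_ : 4 ^+ m.-1 = 2 ^+ m.-1 * 2 ^+ m.-1 :> R); last first.
    by rewrite -exprMn; congr (_ ^+ _); ring.
  have := unit_ball_volume_gt0 R m.-1; have : 0 < 2 ^+ m.-1 :> R by rewrite exprn_gt0.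
  move: (unit_ball_volume _ _) (2 ^+ _) (d ^+ _) => u v y v0 u0.
  by field; rewrite !gt_eqF.
rewrite ler_wpM2r ?exprn_ge0 ?mulr_ge0//; lra.
Qed.

(* The sum over a cover of [A] by sets [C k] of diameter at most [t] of the
   volume of a box around [C k] lengthened by [t] in direction [i]: each such
   box has volume O(t * diam (C k) ^ (m - 1)). *)
Lemma tube (i : 'I_m) (t e : R) (A : set V) : 0 < t -> 0 < e ->
  (H A < +oo)%E ->
  exists T : set (measurable_rV R m), [/\ measurable T,
    forall p r, A p -> `|r| <= t -> T (p + r *: delta_mx ord0 i) &
    (vol T <= (tube_const * t)%:E * (H A + e%:E))%E].
Proof.
move=> t0 e0 Aoo.
have fpre : hausdorff_pre m.-1 t A \is a fin_num.
  rewrite ge0_fin_numE ?hausdorff_pre_ge0//.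
  exact: le_lt_trans (hausdorff_pre_le _ _ t0) Aoo.
have [_ [C [AC dC] <-] Ce] := lb_ereal_inf_adherent e0 fpre.
have /choice[T hT] := fun k => tube_box i t0 (dC k).
exists (\bigcup_k T k); split.
- by apply: bigcupT_measurable => k; have [] := hT k.
- move=> p r /AC[k _ Ckp] rt; exists k => //.
  by have [_ h _] := hT k; exact: h.
apply: (@le_trans _ _ (\sum_(k <oo) vol (T k))%E).
  apply: measure_sigma_subadditive => //; last by apply: bigcupT_measurable => k; have [] := hT k.
  by move=> k; have [] := hT k.
apply: (@le_trans _ _ (\sum_(k <oo) ((tube_const * t)%:E * hausdorff_gauge m.-1 (C k)))%E).
  by apply: lee_nneseries => // k _; have [] := hT k.
rewrite nneseriesZl => [|*]; last exact: hausdorff_gauge_ge0.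
apply: lee_wpmul2l; first by rewrite lee_fin mulr_ge0// ltW// tube_const_gt0.
apply: (le_trans (ltW Ce)); apply: leeD => //; exact: hausdorff_pre_le.
Qed.

End tube.

(** * A Gauss inequality without regularity of the boundary *)

Section directional.
Context (R : realType) (V : normedModType R).
Implicit Types (g : V -> R) (x v : V) (t : R).

Lemma is_derive_line g x v t : derivable g (x + t *: v) v ->
  is_derive t 1 (fun s : R => g (x + s *: v)) ('D_v g (x + t *: v)).
Proof.
have E : (fun h : R => h^-1 *: (((fun s : R => g (x + s *: v)) \o shift t) (h *: 1) - g (x + t *: v)))
    = (fun h : R => h^-1 *: ((g \o shift (x + t *: v)) (h *: v) - g (x + t *: v))).
  apply/funext => h /=; congr (_ *: (g _ - _)).
  by rewrite [h *: 1]mulr1 scalerDl addrCA.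
by move=> dg; apply: DeriveDef; rewrite /derivable /derive E.
Qed.

Lemma line_continuous x v : continuous (fun s : R => x + s *: v).
Proof. by move=> s; apply: cvgD; [exact: cvg_cst|apply: cvgZr_tmp; exact: cvg_id]. Qed.

Lemma mvt_line g x v t (L : R) : 0 <= t ->
  (forall s, 0 <= s <= t -> derivable g (x + s *: v) v) ->
  (forall s, 0 <= s <= t -> `|'D_v g (x + s *: v)| <= L) ->
  `|g (x + t *: v) - g x| <= L * t.
Proof.
move=> t0 dg gL; pose h s := g (x + s *: v).
have [s||c ct E] := @MVT_segment _ h (fun s => 'D_v g (x + s *: v)) 0 t t0.
- by rewrite in_itv/= => /andP[s0 st]; apply: is_derive_line; apply: dg; rewrite !ltW.
- apply: derivable_within_continuous => s; rewrite in_itv/= => st.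
  by have [] := is_derive_line (dg _ st).
move: E; rewrite /h scale0r addr0 subr0 => ->.
rewrite normrM (ger0_norm t0) ler_wpM2r// gL//.
Qed.

Definition segment_in (Omega : set V) v : set V :=
  [set x | forall s : R, 0 <= s <= 1 -> Omega (x + s *: v)].

Lemma segment_in_sub Omega v : segment_in Omega v `<=` Omega.
Proof. by move=> x /(_ 0); rewrite scale0r addr0 lexx ler01; apply. Qed.

(** The same segment, run backwards by s -> 1 - s. *)
Lemma segment_in_shift Omega v x :
  segment_in Omega (- v) (x + v) <-> segment_in Omega v x.
Proof.
split=> h s /andP[s0 s1].
  have := h (1 - s); rewrite scalerBl scale1r scalerN opprK.
  have -> : x + v + (- v + s *: v) = x + s *: v by rewrite addrA addrK.
  by apply; lra.
have := h (1 - s); rewrite scalerBl scale1r scalerN.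
by rewrite -addrA; apply; lra.
Qed.

(** Tube lemma: [0, 1] is compact, so the neighbourhoods of [x] that work for each [s] can be
    replaced by a single one. *)
Lemma open_segment_in Omega v : open Omega -> open (segment_in Omega v).
Proof.
move=> oO; rewrite openE => x xO.
have /compact_near_coveringP/(_ _ (nbhs x) (fun (y : V) (s : R) => Omega (y + s *: v))) :=
  @segment_compact R 0 1.
have P : forall s : R, `[0%R, 1%R]%classic s -> \forall s' \near s & y \near x, Omega (y + s' *: v).
  move=> s; rewrite /= in_itv/= => s01.
  have : (fun p : R * V => p.2 + p.1 *: v) @ (s, x) --> x + s *: v.
    apply: cvgD; [exact: cvg_snd|apply: cvgZr_tmp; exact: cvg_fst].
  move/(_ Omega); apply; move: oO; rewrite openE; apply; exact: xO.
move=> /(_ _ P); apply: filterS => y h s s01; apply: h; by rewrite /= in_itv.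
Qed.

(** The exit time is the infimum of the times spent outside. Openness of [Omega] makes the point at
    that time lie outside, so the time is positive; the times just before it put the point in the
    closure. *)
Lemma first_exit Omega x v : open Omega -> Omega x -> ~ segment_in Omega v x ->
  exists r : R, [/\ 0 < r, r <= 1, boundary Omega (x + r *: v) &
    forall s, 0 <= s < r -> Omega (x + s *: v)].
Proof.
move=> oO Ox nseg.
pose B := [set s : R | 0 <= s <= 1 /\ ~ Omega (x + s *: v)].
have [b Bb] : B !=set0.
  by move: nseg => /existsNP[s /not_implyP[s01 ns]]; exists s.
have lbB : lbound B 0 by move=> s [/andP[]].
have hB : has_inf B by split; [exists b|exists 0].
set r := inf B.
have r0 : 0 <= r by apply: lb_le_inf => //; exists b.
have rb : r <= b by apply: ge_inf => //; exists 0.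
have b1 : b <= 1 by case: Bb => /andP[].
have sr s : 0 <= s < r -> Omega (x + s *: v).
  move=> /andP[s0 sr]; apply: contrapT => ns.
  have : r <= s by apply: ge_inf; [exists 0|split => //; lra].
  lra.
have lcont : (fun s : R => x + s *: v) @ r --> x + r *: v by exact: line_continuous.
have nr : ~ Omega (x + r *: v).
  move=> Or; have : nbhs (x + r *: v) Omega by move: oO; rewrite openE; exact.
  move/lcont => /nbhs_ballP[e /= e0 he].
  have [s Bs sre] := inf_adherent e0 hB.
  case: (Bs) => _; apply; apply: he; rewrite /ball/= ler0_norm; first by rewrite -/r in sre; lra.
  by rewrite subr_le0; apply: ge_inf => //; exists 0.
have {}r0 : 0 < r.
  rewrite lt_neqAle r0 andbT; apply/eqP => r0'; apply: nr.
  by rewrite -r0' scale0r addr0.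
exists r; split => //; first exact: le_trans b1.
split; last by move=> /interior_subset.
move=> U /lcont /nbhs_ballP[e /= e0 he].
exists (x + (r - Num.min r (e / 2)) *: v); split.
  apply: sr; have := ge_min r r (e / 2); have : 0 < Num.min r (e / 2) by rewrite lt_min r0 divr_gt0.
  rewrite lexx/=; lra.
apply: he; rewrite /ball/= opprB addrCA subrr addr0 ger0_norm.
  by rewrite gt_min; apply/orP; right; lra.
by rewrite le_min ltW//= divr_ge0// ltW.
Qed.

End directional.

Section euclidean_sets.
Context (R : realType) (m : nat).
Implicit Types (Omega : set 'rV[R]_m).
Local Notation V := (measurable_rV R m).
Local Notation vol := (@lebesgue_rV R m).

Lemma bounded_set_closure Omega : bounded_set Omega -> bounded_set (closure Omega).
Proof.
move=> [M [Mr OM]]; exists M; split => // N MN x.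
have cF : closed [set y : 'rV[R]_m | `|y| <= N].
  have /continuous_closedP := @norm_continuous R 'rV[R]_m.
  by move/(_ [set r | r <= N] (@closed_le R N)).
by move/(closureS (B := [set y : 'rV[R]_m | `|y| <= N])); rewrite -(closure_id _).1//; apply => y; exact: OM.
Qed.

Lemma compact_closure Omega : bounded_set Omega -> compact (closure Omega).
Proof.
move=> bO; apply: bounded_closed_compact; first exact: bounded_set_closure.
exact: closed_closure.
Qed.

Lemma lebesgue_rV_bounded_set Omega : measurable (Omega : set V) ->
  bounded_set Omega -> (vol Omega < +oo)%E.
Proof.
move=> mO [M [Mr OM]]; pose N := Num.max M 0 + 1.
have N0 : 0 <= N by rewrite /N addr_ge0// le_max lexx orbT.
have MN : M < N by rewrite /N ltr_pwDr// le_max lexx.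
apply: (@le_lt_trans _ _ (vol (box (fun=> - N) (fun=> N)))).
  apply: le_measure; rewrite ?inE//; first exact: measurable_box.
  move=> x /(OM _ MN) xN i; rewrite in_itv/= -ler_norml.
  exact: le_trans (ler_coord_norm x i) xN.
by rewrite lebesgue_rV_box ?ltry// => i; lra.
Qed.

Lemma closed_boundary Omega : closed (boundary Omega).
Proof.
rewrite /boundary setDE; apply: closedI; first exact: closed_closure.
by apply: open_closedC; exact: open_interior.
Qed.

Lemma within_continuous_bounded (K : set 'rV[R]_m) (Q : 'rV[R]_m -> R) :
  compact K -> {within K, continuous Q} ->
  exists2 B, 0 < B & forall x, K x -> `|Q x| <= B.
Proof.
move=> cK cQ; have [M [_ hM]] := compact_bounded (continuous_compact cQ cK).
exists (Num.max M 0 + 1); first by rewrite ltr_wpDl// le_max lexx orbT.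
move=> x Kx; apply: hM; last by exists x.
by rewrite ltr_pwDr// le_max lexx.
Qed.

End euclidean_sets.

(** * Level sets on the boundary and points close to an exit *)

Section boundary_levels.
Context (R : realType) (m : nat) (Omega : set 'rV[R]_m) (Q : 'rV[R]_m -> R).
Local Notation H := (@hausdorff_outer R m m.-1).
Local Notation dS := (hausdorff_measure (m := m) m.-1).
Local Notation S := (caratheodory_type H).
Hypothesis cQ : {within closure Omega, continuous Q}.
Hypothesis Q0 : forall x, closure Omega x -> 0 <= Q x.

Let bcl : boundary Omega `<=` closure Omega. Proof. by move=> x []. Qed.

Lemma boundary_measurable : measurable (boundary Omega : set S).
Proof.
exact: (@closed_hausdorff_measurable R m m.-1 _ (@closed_boundary R m Omega)).
Qed.

(** Closed rays generate the Borel sets of the line. Their preimages are traces of closed sets, and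
    closed sets are Caratheodory measurable for [H]. *)
Lemma within_continuous_boundary_measurable :
  measurable_fun (boundary Omega : set S) (Q : S -> R).
Proof.
apply: (measurability _ (RGenCInfty.measurableE R)).
move=> _ [_ [a ->] <-].
have /closed_subspaceP[W cW WD] : closed ((Q : subspace (closure Omega) -> R) @^-1` `[a, +oo[).
  by move/continuous_closedP : cQ; apply; exact: interval_closed.
rewrite (_ : _ `&` _ = boundary Omega `&` W).
  by apply: measurableI; [exact: boundary_measurable|exact: closed_hausdorff_measurable].
apply/seteqP; split => x [bx Qx]; split => //.
  suff [] : (W `&` closure Omega) x by [].
  by rewrite WD; split => //; exact: bcl.
suff [] : ((Q : subspace (closure Omega) -> R) @^-1` `[a, +oo[%classic `&` closure Omega) x by [].
by rewrite -WD; split => //; exact: bcl.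
Qed.

Variable eta : R.
Hypothesis eta0 : 0 < eta.

Definition level (j : nat) : set 'rV[R]_m :=
  [set p | boundary Omega p /\ j%:R * eta <= Q p < j.+1%:R * eta].

Lemma measurable_level j : measurable (level j : set S).
Proof.
rewrite (_ : level j = boundary Omega `&` Q @^-1` `[j%:R * eta, j.+1%:R * eta[).
  by apply: within_continuous_boundary_measurable => //; exact: boundary_measurable.
by apply/seteqP; split => x [] /=; rewrite in_itv.
Qed.

Local Open Scope ereal_scope.

(** A lower sum for the integral of [Q], since [Q] is at least [j * eta] on [level j]. It turns the
    Hausdorff measures that [tube] charges for into the boundary integral. *)
Lemma level_sum (J : nat) :
  \sum_(j < J) (j%:R * eta)%:E * H (level j) <= \int[dS]_(x in boundary Omega) (Q x)%:E.
Proof.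
have mQ := within_continuous_boundary_measurable.
have sub j : level j `<=` boundary Omega by move=> x [].
have mb := boundary_measurable.
rewrite -(big_mkord xpredT (fun j => (j%:R * eta)%:E * H (level j))).
pose D : set S := \big[setU/set0]_(j <- index_iota 0 J) level j.
have mD : measurable D by apply: bigsetU_measurable => j _; exact: measurable_level.
have Db : D `<=` boundary Omega.
  by rewrite /D -bigcup_seq => x [j _ []].
apply: (@le_trans _ _ (\int[dS]_(x in D) (Q x)%:E)); last first.
  have mQE : measurable_fun (boundary Omega : set S) (EFin \o Q).
    exact/measurable_EFinP.
  have QE0 x : boundary Omega x -> 0 <= (EFin \o Q) x.
    by move=> bx; rewrite lee_fin; apply: Q0; exact: bcl.
  exact: (ge0_subset_integral dS mD mb mQE QE0 Db).
rewrite ge0_integral_bigsetU; last 5 first.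
- by move=> j; exact: measurable_level.
- exact: iota_uniq.
- move=> j k _ _ [x [[_ /andP[jx xj]] [_ /andP[kx xk]]]].
  have : (j%:R * eta < k.+1%:R * eta)%R by lra.
  have : (k%:R * eta < j.+1%:R * eta)%R by lra.
  by rewrite !ltr_pM2r// !ltr_nat; lia.
- apply/measurable_EFinP; exact: (measurable_funS mb Db mQ).
- by move=> x /Db bx; rewrite lee_fin; apply: Q0; exact: bcl.
apply: lee_sum => j _.
rewrite -(integral_cst dS (measurable_level j)).
apply: ge0_le_integral.
- exact: measurable_level.
- by move=> x _; rewrite lee_fin mulr_ge0// ltW.
- exact: measurable_cst.
- by apply/measurable_EFinP; exact: (measurable_funS mb (sub j) mQ).
- by move=> x [_ /andP[jx _]]; rewrite lee_fin.
Qed.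

End boundary_levels.

Section exit_sets.
Context (R : realType) (m : nat).
Variable i : 'I_m.
Local Notation V := (measurable_rV R m).
Local Notation vol := (@lebesgue_rV R m).
Local Notation H := (@hausdorff_outer R m m.-1).
Local Notation dS := (hausdorff_measure (m := m) m.-1).
Local Notation e := (delta_mx ord0 i : 'rV[R]_m).
Variables (Omega : set 'rV[R]_m) (Q : 'rV[R]_m -> R) (Lam : R).
Hypothesis oO : open Omega.
Hypothesis bO : bounded_set Omega.
Hypothesis cQ : {within closure Omega, continuous Q}.
Hypothesis Q0 : forall x, closure Omega x -> 0 <= Q x.
Hypothesis Lam0 : 0 <= Lam.
(* For Q = |f|^2 with f Lipschitz on segments, by |f x|^2 <= 2 |f p|^2 + 2 |f x - f p|^2. *)
Hypothesis hQ : forall x t, Omega x -> (forall s, 0 <= s < 1 -> Omega (x + s *: (t *: e))) ->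
  boundary Omega (x + t *: e) -> Q x <= 2 * Q (x + t *: e) + Lam * t ^+ 2.

Local Notation Ib := (\int[dS]_(x in boundary Omega) (Q x)%:E)%E.
Hypothesis Ioo : (Ib < +oo)%E.

Let mO : measurable (Omega : set V). Proof. exact: open_measurable_rV. Qed.
Let Ooo : (vol Omega < +oo)%E. Proof. exact: lebesgue_rV_bounded_set. Qed.
Let OclO : Omega `<=` closure Omega. Proof. exact: subset_closure. Qed.
Let Ib0 : (0 <= Ib)%E.
Proof. by apply: integral_ge0 => x [/Q0 Qx _]; rewrite lee_fin. Qed.
Let K := tube_const R m.
Let volO := fine (vol Omega).
Let I := fine Ib.
Let K0 : 0 < K. Proof. exact: tube_const_gt0. Qed.

(* Sorting the exit points on the boundary into the level sets
   [j t^2 <= Q < (j+1) t^2] and applying [tube] to each of them shows that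
   [Q] has integral at most [O(t)] times [Ib] over this set, up to o(t). *)
Definition exit_set (t : R) : set V := Omega `\` segment_in Omega (t *: e).

Lemma measurable_exit_set t : measurable (exit_set t).
Proof.
apply: measurableD => //; apply: open_measurable_rV; exact: open_segment_in.
Qed.

Lemma measurable_Q : measurable_fun (Omega : set V) Q.
Proof.
apply: within_continuous_measurable_rV => //.
exact: continuous_subspaceW cQ.
Qed.

Lemma exit_set_cover (t : R) : t != 0 -> exists (J : nat) (T : nat -> set V),
  [/\ forall j, measurable (T j),
   forall x, exit_set t x -> Q x <= (2 + Lam) * t ^+ 2 + \sum_(1 <= j < J) (4 * (j%:R * t ^+ 2)) * \1_(T j) x &
   (\sum_(1 <= j < J) (4 * (j%:R * t ^+ 2))%:E * vol (T j) <= (4 * K * `|t| * (I + t ^+ 2))%:E)%E].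
Proof.
move=> t0; have eta0 : 0 < t ^+ 2 by rewrite exprn_even_gt0.
have nt0 : 0 < `|t| by rewrite normr_gt0.
set eta := t ^+ 2 in eta0 *; have etaE : eta = t ^+ 2 by [].
clearbody eta.
have [B B0 QB] := within_continuous_bounded (compact_closure bO) cQ.
(* [B] bounds [Q] on the closure, so every exit point lies in a level of index below [J]. *)
pose J := (Num.truncn (B / eta)).+1.
have levI := level_sum cQ Q0 eta0 J.
have IE : Ib = I%:E by rewrite fineK// ge0_fin_numE.
(* Level 0 is left out: its weight in [level_sum] is 0, so its measure may be infinite. Any other
   level of infinite measure would make the boundary integral infinite. *)
have finH j : (0 < j < J)%N -> H (level Omega Q eta j) \is a fin_num.
  move=> /andP[j0 jJ]; rewrite ge0_fin_numE ?outer_measure_ge0//.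
  move: levI; rewrite (bigD1 (Ordinal jJ))//= IE => /le_lt_trans /(_ (ltry _)).
  apply: contraTT; rewrite -!leNgt !leye_eq => /eqP ->.
  have je0 : 0 < j%:R * eta by apply: mulr_gt0 => //; rewrite ltr0n.
  rewrite gt0_muley ?lte_fin//.
  rewrite addye// -ltNye.
  apply: (@lt_le_trans _ _ 0%E); first exact: ltNyr.
  by apply: sume_ge0 => k _; rewrite mule_ge0 ?outer_measure_ge0// lee_fin mulr_ge0// ltW.
(* Each tube is allowed the error 1 / (S + 1). Weighted by j * eta, these errors add up to at most
   eta = t^2, the summand next to [I] in the final bound. *)
pose S : R := \sum_(1 <= j < J) j%:R.
have S0 : 0 <= S by apply: sumr_ge0.
have e0 : 0 < (S + 1)^-1 by rewrite invr_gt0; lra.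
have /choice[T hT] : forall j, exists T : set V, measurable T /\
    ((0 < j < J)%N -> (forall p r, level Omega Q eta j p -> `|r| <= `|t| -> T (p + r *: e)) /\
    (vol T <= (K * `|t|)%:E * (H (level Omega Q eta j) + (S + 1)^-1%:E))%E).
  move=> l; have [lJ|nlJ] := boolP (0 < l < J)%N; last by exists set0.
  have Hoo : (H (level Omega Q eta l) < +oo)%E.
    by have := finH _ lJ; rewrite ge0_fin_numE ?outer_measure_ge0.
  by have [T [mT ? ?]] := tube i nt0 e0 Hoo; exists T.
exists J, T; split.
- by move=> j; have [] := hT j.
- move=> x [Ox nseg].
  have [r [r0 r1 br hr]] := first_exit oO Ox nseg.
  have Qx : Q x <= 2 * Q (x + (r * t) *: e) + Lam * (r * t) ^+ 2.
    apply: (hQ Ox); last by rewrite -scalerA.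
    move=> s /andP[s0 s1].
    rewrite (_ : s *: _ = (s * r) *: (t *: e)); last by rewrite !scalerA mulrA.
    apply: hr.
    by rewrite mulr_ge0 ?(ltW r0)//= gtr_pMl.
  set p := x + (r * t) *: e in Qx.
  have bp : boundary Omega p by rewrite /p -scalerA.
  have clp : closure Omega p by case: bp.
  have rt : (r * t) ^+ 2 <= eta by rewrite etaE exprMn ler_piMl ?sqr_ge0// exprn_ile1// ltW.
  have Lrt : Lam * (r * t) ^+ 2 <= Lam * eta by apply: ler_wpM2l.
  have Qp0 := Q0 clp.
  pose j := Num.truncn (Q p / eta).
  have : j%:R <= Q p / eta < j.+1%:R by apply: truncn_itv; rewrite divr_ge0// ltW.
  rewrite ler_pdivlMr// ltr_pdivrMr// => /andP[jQ Qj].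
  have sum0 : 0 <= \sum_(1 <= j < J) (4 * (j%:R * eta)) * \1_(T j) x.
    by apply: sumr_ge0 => k _; rewrite !mulr_ge0// ltW.
  (* At level 0, Q p < t^2 and the term (2 + Lam) t^2 is enough. For j >= 1, Q p < (j + 1) t^2 <= 2
     j t^2, whence the factor 4 in front of j t^2. *)
  have [jz|j_gt0] := posnP j; first by move: Qj; rewrite jz mul1r; lra.
  have jJ : (j < J)%N.
    rewrite -(ltr_nat R) /J; have : Q p / eta <= B / eta.
      by rewrite ler_pM2r ?invr_gt0// (le_trans (ler_norm _))// QB.
    have /truncn_itv/andP[_] : 0 <= B / eta by rewrite divr_ge0// ltW.
    have : j%:R <= Q p / eta by rewrite ler_pdivlMr.
    lra.
  have Tx : T j x.
    have [_ /(_ _)[|h _]] := hT j; first by rewrite j_gt0.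
    have -> : x = p + (- (r * t)) *: e by rewrite /p scaleNr addrK.
    apply: h; first by split => //; rewrite jQ Qj.
    by rewrite normrN normrM ler_piMl// ger0_norm// ltW.
  have jin : j \in index_iota 1 J by rewrite mem_index_iota j_gt0.
  rewrite (bigD1_seq j)//= ?iota_uniq// indicE mem_set// mulr1.
  have : 0 <= \sum_(1 <= k < J | k != j) (4 * (k%:R * eta)) * \1_(T k) x.
    by apply: sumr_ge0 => k _; rewrite !mulr_ge0// ltW.
  have : 1 * eta <= j%:R * eta by rewrite ler_pM2r// ler1n.
  move: Qj; rewrite -natr1 mulrDl.
  by move: (\sum_(_ <= _ < _ | _) _) => y; lra.
- apply: (@le_trans _ _ (\sum_(1 <= j < J) (4 * K * `|t|)%:E *
     ((j%:R * eta)%:E * H (level Omega Q eta j) + (j%:R * eta * (S + 1)^-1)%:E))%E).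
    rewrite [leLHS]big_nat [leRHS]big_nat; apply: lee_sum => j jJ.
    have [_ /(_ jJ)[_ volT]] := hT j.
    apply: (le_trans (lee_wpmul2l _ volT)).
      by rewrite lee_fin !mulr_ge0// ltW.
    move: (finH _ jJ); case: (H (level Omega Q eta j)) => // h _.
    rewrite -[(h%:E + _)%E]EFinD -[((j%:R * eta)%:E * h%:E)%E]EFinM -EFinD -!EFinM lee_fin.
    by rewrite le_eqVlt; apply/orP; left; apply/eqP; ring.
  rewrite -ge0_sume_distrr; last first.
    move=> j _; rewrite adde_ge0 ?mule_ge0 ?outer_measure_ge0// lee_fin ?mulr_ge0// ltW//.
  rewrite [(_ * (I + _))%:E]EFinM; apply: lee_wpmul2l.
    by rewrite lee_fin; apply: mulr_ge0 => //; apply: mulr_ge0 => //; exact: (ltW K0).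
  rewrite big_split/= EFinD; apply: leeD.
    move: levI; rewrite IE -(big_mkord xpredT (fun j => (j%:R * eta)%:E * H (level Omega Q eta j))%E) big_ltn//.
    by rewrite mul0r mul0e add0e.
  rewrite sumEFin lee_fin -big_distrl/= -big_distrl/= -/S.
  have S1 : S / (S + 1) <= 1 by rewrite ler_pdivrMr; lra.
  by rewrite mulrAC; apply: ler_piMl => //; exact: ltW.
Qed.

Lemma integral_exit_set (t : R) : t != 0 ->
  (\int[vol]_(x in exit_set t) (Q x)%:E <=
   ((2 + Lam) * t ^+ 2 * volO + 4 * K * `|t| * (I + t ^+ 2))%:E)%E.
Proof.
move=> t0; have [J [T [mT QT volT]]] := exit_set_cover t0.
have mE := measurable_exit_set t.
have EO : exit_set t `<=` Omega by move=> x [].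
have mQ : measurable_fun (exit_set t) Q by apply: measurable_funS measurable_Q.
pose c j := 4 * (j%:R * t ^+ 2).
have c0 j : 0 <= c j by apply: mulr_ge0 => //; apply: mulr_ge0 => //; exact: sqr_ge0.
have a0 : 0 <= (2 + Lam) * t ^+ 2.
  by apply: mulr_ge0; [rewrite addr_ge0|exact: sqr_ge0].
apply: (@le_trans _ _ (\int[vol]_(x in exit_set t)
   (((2 + Lam) * t ^+ 2)%:E + \sum_(1 <= j < J) ((c j)%:E * (\1_(T j) x)%:E)))%E).
  apply: ge0_le_integral => //.
  - by move=> x /EO/OclO/Q0; rewrite lee_fin.
  - exact/measurable_EFinP.
  - apply: emeasurable_funD => //; apply: emeasurable_sum => j.
    by apply: measurable_funeM; apply/measurable_EFinP; exact: measurable_indic.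
  - move=> x Ex; apply: le_trans (_ : (((2 + Lam) * t ^+ 2 + \sum_(1 <= j < J) c j * \1_(T j) x)%:E <= _)%E).
      by rewrite lee_fin QT.
    by rewrite EFinD -sumEFin.
rewrite ge0_integralD//; last 2 first.
- by move=> x _; apply: sume_ge0 => j _; rewrite mule_ge0// lee_fin.
- apply: emeasurable_sum => j.
  by apply: measurable_funeM; apply/measurable_EFinP; exact: measurable_indic.
rewrite EFinD; apply: leeD.
  rewrite integral_cst//.
  rewrite [leRHS]EFinM /volO fineK ?ge0_fin_numE//.
  by apply: lee_wpmul2l; rewrite ?lee_fin//; apply: le_measure; rewrite ?inE.
apply: le_trans volT; rewrite ge0_integral_sum//; last 2 first.
- move=> j; apply: measurable_funeM; apply/measurable_EFinP; exact: measurable_indic.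
- by move=> j x _; rewrite mule_ge0// lee_fin.
apply: lee_sum => j _; rewrite ge0_integralZl_EFin//; last first.
  by apply/measurable_EFinP; exact: measurable_indic.
apply: lee_wpmul2l; first by rewrite lee_fin.
rewrite integral_indic//; apply: le_measure; rewrite ?inE//; exact: measurableI.
Qed.

End exit_sets.

Section bounded_integrable.
Context d (T : measurableType d) (R : realType) (mu : {measure set T -> \bar R}).

Lemma bounded_integrable (D : set T) (f : T -> R) (B : R) :
  measurable D -> (mu D < +oo)%E -> measurable_fun D f ->
  (forall x, D x -> `|f x| <= B) -> mu.-integrable D (EFin \o f).
Proof.
move=> mD Doo mf fB; apply: measurable_bounded_integrable => //.
by exists B; split; [exact: num_real|move=> N /ltW BN x /fB /le_trans; apply].
Qed.

Lemma Rintegral_cst_le (D : set T) (f : T -> R) (B : R) :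
  measurable D -> (mu D < +oo)%E -> measurable_fun D f ->
  (forall x, D x -> `|f x| <= B) ->
  `|\int[mu]_(x in D) f x| <= B * fine (mu D).
Proof.
move=> mD Doo mf fB; have intf := bounded_integrable mD Doo mf fB.
apply: (le_trans (le_normr_Rintegral mD intf)).
rewrite -Rintegral_cst//; apply: le_Rintegral => //.
- apply: (@bounded_integrable _ _ B) => //; first exact: measurableT_comp.
  by move=> x Dx; rewrite normr_id fB.
- exact: (@bounded_integrable _ _ `|B|).
Qed.

End bounded_integrable.

(** * Difference quotients and the Gauss inequality *)

Section difference_quotient.
Context (R : realType) (m : nat).
Variable i : 'I_m.
Local Notation V := (measurable_rV R m).
Local Notation e := (delta_mx ord0 i : 'rV[R]_m).
Variables (Omega : set 'rV[R]_m) (g : 'rV[R]_m -> R).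
Hypothesis oO : open Omega.
Hypothesis mg : measurable_fun (Omega : set V) g.
Hypothesis dg : forall x, Omega x -> derivable g x e.

Let A (t : R) : set V := segment_in Omega (t *: e).
Let mO : measurable (Omega : set V). Proof. exact: open_measurable_rV. Qed.
Let mA t : measurable (A t). Proof. exact/open_measurable_rV/open_segment_in. Qed.
Let AO t : A t `<=` Omega. Proof. exact: segment_in_sub. Qed.

Definition diff_quot (t : R) (x : V) : R := (g (x + t *: e : 'rV[R]_m) - g x) / t.

(** By translation invariance, the integral of g (x + t e) over [A t] is therefore that of [g] over
    [A (- t)]. *)
Lemma rV_shift_segment_in t : rV_shift (t *: e) @^-1` A (- t) = A t.
Proof.
apply/seteqP; split => x; rewrite /A /= scaleNr.
  by move/segment_in_shift.
by move=> h; apply/segment_in_shift.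
Qed.

Lemma measurable_shift_segment_in t :
  measurable_fun (A t) (fun x => g (rV_shift (t *: e) x)).
Proof.
apply: (@measurable_comp _ _ _ _ _ _ (A (- t)) g (A t) (rV_shift (t *: e))) => //.
- by move=> _ [x Ax <-]; rewrite -rV_shift_segment_in in Ax.
- exact: measurable_funS mg.
- apply: measurable_funS (@measurable_rV_shift R m (t *: e)) => //.
Qed.

Lemma measurable_diff_quot t : measurable_fun (Omega : set V) (diff_quot t \_ (A t)).
Proof.
apply/measurable_restrict => //; rewrite setIidr; last exact: AO.
apply: measurable_funM => //; apply: measurable_funB.
  exact: measurable_shift_segment_in.
exact: measurable_funS mg.
Qed.

Lemma segment_in_line (x : V) t s : 0 < t -> A t x -> 0 <= s <= t ->
  Omega (x + s *: e : 'rV[R]_m).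
Proof.
move=> t0 Ax /andP[s0 st]; have -> : s = s / t * t by rewrite divfK// gt_eqF.
rewrite -scalerA; apply: Ax; rewrite divr_ge0//=; last exact: ltW.
by rewrite ler_pdivrMr// mul1r.
Qed.

(** Since [Omega] is open, each of its points eventually belongs to [A (t k)], so the restriction
    does not affect the limit. *)
Lemma diff_quot_cvg (t : R^nat) (x : V) : (forall k, 0 < t k) ->
  t @ \oo --> 0 -> Omega x ->
  (diff_quot (t k) \_ (A (t k))) x @[k --> \oo] --> 'D_e g x.
Proof.
move=> t0 tcvg Ox.
have : (fun s : R => (x : 'rV[R]_m) + s *: e) @ 0 --> (x : 'rV[R]_m).
  have := @line_continuous R _ (x : 'rV[R]_m) e 0; by rewrite /continuous_at scale0r addr0.
move=> /(_ Omega); have : nbhs (x : 'rV[R]_m) Omega by move: oO; rewrite openE; exact.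
move=> nO /(_ nO) /nbhs_ballP[d /= d0 hd].
have td : \forall k \near \oo, t k < d by exact: (cvgr_lt 0).
have quotcvg : diff_quot (t k) x @[k --> \oo] --> 'D_e g x.
  have /cvg_ex[l gl] := dg Ox.
  have -> : 'D_e g x = l by exact/cvg_lim.
  have tp : (forall k, t k != 0) /\ t @ \oo --> 0.
    by split => // k; rewrite gt_eqF.
  move/cvgr_dnbhsP : gl => /(_ _ tp); apply: cvg_trans.
  apply: near_eq_cvg; apply: nearW => k /=.
  by rewrite /diff_quot [RHS]mulrC; congr (_ * (g _ - _)); rewrite addrC.
apply: cvg_trans quotcvg; apply: near_eq_cvg; near=> k.
rewrite /= patchE ifT// inE => s /andP[s0 s1].
rewrite scalerA; apply: hd; rewrite /ball/= sub0r normrN ger0_norm; last first.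
  by rewrite mulr_ge0// ltW.
apply: (@le_lt_trans _ _ (t k)); first by rewrite ler_piMl// ltW.
by near: k.
Unshelve. all: by end_near. Qed.

(** Pointwise limit of the measurable quotients with steps 1 / (k + 1). The measurability of
    [newton_dconv] will also be obtained in this way. *)
Lemma measurable_derive : measurable_fun (Omega : set V) ('D_e g : V -> R).
Proof.
pose t (k : nat) : R := k.+1%:R^-1.
apply: (@measurable_fun_cvg _ _ _ _ (fun k => diff_quot (t k) \_ (A (t k)))) => [k|x Ox].
  exact: measurable_diff_quot.
apply: diff_quot_cvg => //; last exact: cvg_harmonic.
by move=> k; rewrite invr_gt0.
Qed.

End difference_quotient.

Section gauss_inequality.
Context (R : realType) (m : nat).
Variable i : 'I_m.
Local Notation V := (measurable_rV R m).
Local Notation vol := (@lebesgue_rV R m).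
Local Notation dS := (hausdorff_measure (m := m) m.-1).
Local Notation e := (delta_mx ord0 i : 'rV[R]_m).
Variables (Omega : set 'rV[R]_m) (Q : 'rV[R]_m -> R) (Lam : R).
Hypothesis oO : open Omega.
Hypothesis bO : bounded_set Omega.
Hypothesis cQ : {within closure Omega, continuous Q}.
Hypothesis Q0 : forall x, closure Omega x -> 0 <= Q x.
Hypothesis Lam0 : 0 <= Lam.
Hypothesis hQ : forall x t, Omega x -> (forall s, 0 <= s < 1 -> Omega (x + s *: (t *: e))) ->
  boundary Omega (x + t *: e) -> Q x <= 2 * Q (x + t *: e) + Lam * t ^+ 2.
Local Notation Ib := (\int[dS]_(x in boundary Omega) (Q x)%:E)%E.
Hypothesis Ioo : (Ib < +oo)%E.
Variables (g : 'rV[R]_m -> R) (L M : R).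
Hypothesis mg : measurable_fun (Omega : set V) g.
Hypothesis dg : forall x, Omega x -> derivable g x e.
Hypothesis gL : forall x, Omega x -> `|'D_e g x| <= L.
Hypothesis M0 : 0 <= M.
Hypothesis gQ : forall x, Omega x -> `|g x| <= M * Q x.

Let K := tube_const R m.
Let volO := fine (vol Omega).
Let I := fine Ib.
Let A (t : R) : set V := segment_in Omega (t *: e).
Let mO : measurable (Omega : set V). Proof. exact: open_measurable_rV. Qed.
Let Ooo : (vol Omega < +oo)%E. Proof. exact: lebesgue_rV_bounded_set. Qed.
Let OclO : Omega `<=` closure Omega. Proof. exact: subset_closure. Qed.
Let mA t : measurable (A t). Proof. exact/open_measurable_rV/open_segment_in. Qed.
Let AO t : A t `<=` Omega. Proof. exact: segment_in_sub. Qed.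

Let suboo (D : set V) : measurable D -> D `<=` Omega -> (vol D < +oo)%E.
Proof. by move=> mD DO; apply: le_lt_trans Ooo; apply: le_measure; rewrite ?inE. Qed.

Let bound_exit t := (2 + Lam) * t ^+ 2 * volO + 4 * K * `|t| * (I + t ^+ 2).

Let intg (D : set V) : measurable D -> D `<=` Omega -> vol.-integrable D (EFin \o g).
Proof.
move=> mD DO; have [B B0 QB] := within_continuous_bounded (compact_closure bO) cQ.
apply: (@bounded_integrable _ _ _ _ D g (M * B) mD (suboo mD DO)) => [|x Dx].
  exact: (measurable_funS mO DO mg).
apply: (le_trans (gQ (DO _ Dx))); apply: ler_wpM2l => //.
by apply: le_trans (QB _ (OclO (DO _ Dx))); exact: ler_norm.
Qed.

Let exit_le t : t != 0 -> `|\int[vol]_(x in exit_set i Omega t) g x| <= M * bound_exit t.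
Proof.
move=> t0; have mE := measurable_exit_set i oO t.
have EO : exit_set i Omega t `<=` Omega by move=> x [].
have [B B0 QB] := within_continuous_bounded (compact_closure bO) cQ.
have mQ : measurable_fun (exit_set i Omega t) Q.
  exact: (measurable_funS mO EO (measurable_Q oO cQ)).
have intQ : vol.-integrable (exit_set i Omega t) (EFin \o Q).
  apply: (bounded_integrable mE (suboo mE EO) mQ) => x /EO/OclO; exact: QB.
apply: (le_trans (le_normr_Rintegral mE (intg mE EO))).
apply: (@le_trans _ _ (\int[vol]_(x in exit_set i Omega t) (M * Q x))).
  apply: le_Rintegral => //.
  - exact: integrable_norm (intg mE EO).
  - exact: (integrableZl mE M intQ).
  - by move=> x /EO; exact: gQ.
rewrite RintegralZl//; apply: ler_wpM2l => //.
rewrite -lee_fin fineK ?integrable_fin_num//.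
exact: (integral_exit_set oO bO cQ Q0 Lam0 hQ Ioo t0).
Qed.

Let setUA t : A t `|` exit_set i Omega t = Omega.
Proof. by rewrite /exit_set setDUK//; exact: AO. Qed.

Let splitA t : \int[vol]_(x in A t) g x =
  \int[vol]_(x in Omega) g x - \int[vol]_(x in exit_set i Omega t) g x.
Proof.
have mE := measurable_exit_set i oO t.
have := @Rintegral_setU _ _ _ vol (A t) (exit_set i Omega t) g (mA t) mE.
rewrite setUA => -> //; first by rewrite addrK.
- exact: intg.
- by apply/disj_setPS => x [? []].
Qed.

Local Notation quot := (@diff_quot R m i g).

Let intgshift t : vol.-integrable (A t) (EFin \o (fun x => g (rV_shift (t *: e) x))).
Proof.
have [B B0 QB] := within_continuous_bounded (compact_closure bO) cQ.
apply: (@bounded_integrable _ _ _ _ _ _ (M * B) (mA t)).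
- exact: suboo.
- exact: measurable_shift_segment_in.
move=> x; rewrite /A -rV_shift_segment_in => /AO Ox.
apply: (le_trans (gQ Ox)); apply: ler_wpM2l => //.
by apply: le_trans (QB _ (OclO Ox)); exact: ler_norm.
Qed.

Let quot_le t : 0 < t ->
  `|\int[vol]_(x in A t) quot t x| <= 2 * M * ((2 + Lam) * t * volO + 4 * K * (I + t ^+ 2)).
Proof.
move=> t0; have tn0 : t != 0 by rewrite gt_eqF.
(* After the translation, the numerator is the integral of [g] over [A (- t)] minus that over [A t].
   Both sets are [Omega] without an exit set, so the integral over [Omega] cancels and only the exit
   sets remain. *)
have -> : \int[vol]_(x in A t) quot t x =
    (\int[vol]_(x in exit_set i Omega t) g x -
     \int[vol]_(x in exit_set i Omega (- t)) g x) / t.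
  rewrite /diff_quot RintegralZr//; last first.
    exact: (integrableB (mA t) (@intgshift t) (intg (mA t) (@AO t))).
  rewrite RintegralB; [|exact: mA|exact: (@intgshift t)|exact: intg].
  have -> : \int[vol]_(x in A t) g (x + t *: e : 'rV[R]_m) = \int[vol]_(x in A (- t)) g x.
    rewrite {1}/A -rV_shift_segment_in; congr fine.
    apply: (@integral_rV_shift R m (t *: e) (EFin \o g) (A (- t))) => //.
    by apply/measurable_EFinP; apply: measurable_funS mg.
  congr (_ / _); rewrite (splitA t) (splitA (- t)).
  by rewrite opprB [LHS]addrC addrA subrK.
rewrite normrM normfV (gtr0_norm t0) ler_pdivrMr//.
have h1 := exit_le tn0.
have h2 : `|\int[vol]_(x in exit_set i Omega (- t)) g x| <= M * bound_exit t.
  have -> : bound_exit t = bound_exit (- t) by rewrite /bound_exit sqrrN normrN.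
  by apply: exit_le; rewrite oppr_eq0.
apply: (le_trans (ler_normB _ _)); apply: (le_trans (lerD h1 h2)).
rewrite le_eqVlt; apply/orP; left; apply/eqP; rewrite /bound_exit gtr0_norm//; ring.
Qed.

Lemma gauss_inequality :
  `|\int[vol]_(x in Omega) 'D_e g x| <= 8 * K * M * I.
Proof.
pose t (k : nat) : R := k.+1%:R^-1.
have t0 k : 0 < t k by rewrite invr_gt0.
have tcvg : t @ \oo --> 0 by exact: cvg_harmonic.
pose F k := quot (t k) \_ (A (t k)).
have mF k : measurable_fun (Omega : set V) (EFin \o F k).
  by apply/measurable_EFinP; exact: measurable_diff_quot.
(* On [A (t k)] the whole segment lies in [Omega], so the mean value theorem bounds the quotient by
   [L]; elsewhere it is 0. This is the dominating function. *)
have FL k (x : V) : Omega x -> (`|(EFin \o F k) x| <= L%:E)%E.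
  move=> Ox; rewrite lee_fin /F patchE; case: ifPn => [|_]; last first.
    by rewrite normr0; exact: le_trans (gL Ox).
  rewrite inE => Ax; rewrite normrM normfV (gtr0_norm (t0 k)) ler_pdivrMr//.
  apply: mvt_line; first exact: ltW.
    by move=> s sk; apply: dg; exact: segment_in_line Ax sk.
  by move=> s sk; apply: gL; exact: segment_in_line Ax sk.
have Fcvg (x : V) : Omega x -> (EFin \o F k) x @[k --> \oo] --> ('D_e g x)%:E.
  move=> Ox; apply: cvg_EFin; first exact: nearW.
  exact: diff_quot_cvg.
have intL : vol.-integrable (Omega : set V) (EFin \o cst L).
  by apply: (bounded_integrable (B := `|L|)) => //.
have mD : measurable_fun (Omega : set V) (EFin \o 'D_e g).
  by apply/measurable_EFinP; exact: measurable_derive.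
have intF k : vol.-integrable (Omega : set V) (EFin \o F k).
  apply: (bounded_integrable (B := L)) => //; first exact/measurable_EFinP.
  by move=> x /(FL k); rewrite lee_fin.
have FLae : {ae vol, forall (x : V) k, Omega x -> (`|(EFin \o F k) x| <= (EFin \o cst L) x)%E}.
  by apply: aeW => x k; exact: FL.
have [intD _ Dcvg] := dominated_convergence mO mF mD (aeW _ Fcvg) intL FLae.
have Dcvg' : \int[vol]_(x in Omega) F k x @[k --> \oo] --> \int[vol]_(x in Omega) 'D_e g x.
  apply: fine_cvg; rewrite fineK; first exact: Dcvg.
  exact: integrable_fin_num.
(* In the limit only 2 M (4 K I) survives: the 2 counts the exit sets of the steps t and -t, the 4
   comes from [exit_set_cover]. *)
have bcvg : 2 * M * ((2 + Lam) * t k * volO + 4 * K * (I + t k ^+ 2)) @[k --> \oo] -->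
    2 * M * ((2 + Lam) * 0 * volO + 4 * K * (I + 0 ^+ 2)).
  apply: cvgMl_tmp; apply: cvgD.
    by apply: cvgMr_tmp; apply: cvgMl_tmp.
  apply: cvgMl_tmp; apply: cvgD; first exact: cvg_cst.
  by rewrite !expr2; apply: cvgM.
have E : 2 * M * ((2 + Lam) * 0 * volO + 4 * K * (I + 0 ^+ 2)) = 8 * K * M * I.
  by rewrite expr2 !mulr0 mul0r add0r addr0; move: K I => k j; ring.
rewrite E in bcvg; have := ler_cvg_to (cvg_norm Dcvg') bcvg.
apply; apply: nearW => k; apply: le_trans (quot_le (t0 k)).
by rewrite -Rintegral_mkcondr setIidr//; exact: AO.
Qed.

End gauss_inequality.

(** * The regularised Newton kernel *)

Section newton_kernel.
Context (R : realType) (n : nat).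
Local Notation m := (n + n)%N.
Local Notation V := 'rV[R]_m.
Implicit Types (x y v : V) (eps : R).

(* For n > 1, [newton_ker eps i] is, up to a constant, the i-th partial derivative of the
   regularisation [(|x|^2 + eps^2)^(1-n)] of the fundamental solution of the
   Laplacian, and [poisson_ker eps] is the divergence of this field. *)
Definition dotp x y : R := \sum_i x ord0 i * y ord0 i.
Definition rho eps x : R := dotp x x + eps ^+ 2.
Definition newton_ker eps (i : 'I_m) x : R := x ord0 i / rho eps x ^+ n.
Definition newton_dker eps (i : 'I_m) v x : R :=
  v ord0 i / rho eps x ^+ n - (2 * n)%:R * x ord0 i * dotp x v / rho eps x ^+ n.+1.
Definition poisson_ker eps x : R := (2 * n)%:R * eps ^+ 2 / rho eps x ^+ n.+1.

Lemma rho_gt0 eps x : 0 < eps -> 0 < rho eps x.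
Proof.
by move=> e0; rewrite ltr_wpDl ?exprn_gt0// sumr_ge0// => i _; rewrite -expr2 sqr_ge0.
Qed.

Lemma coord_is_derive (i : 'I_m) x v :
  is_derive x v (fun y : V => y ord0 i) (v ord0 i).
Proof.
have E : (fun h : R => h^-1 *: (((fun y : V => y ord0 i) \o shift x) (h *: v) - x ord0 i)) @ 0^' --> v ord0 i.
  apply: (@cvg_trans _ ((fun _ : R => v ord0 i) @ 0^')); last exact: cvg_cst.
  apply: near_eq_cvg; near=> h => /=.
  rewrite !mxE addrK scalerA mulVf ?scale1r//.
  by near: h; exact: nbhs_dnbhs_neq.
apply: DeriveDef; first by apply/cvg_ex; exists (v ord0 i).
exact/cvg_lim.
Unshelve. all: by end_near. Qed.

Lemma rho_is_derive eps x v : is_derive x v (rho eps) (2 * dotp x v).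
Proof.
have -> : rho eps = \sum_(i < m) ((fun y : V => y ord0 i) * (fun y : V => y ord0 i)) + cst (eps ^+ 2).
  apply/funext => y; rewrite /rho /dotp !fctE; congr (_ + _).
  by elim/big_ind2 : _ => // f1 g1 f2 g2 -> ->.
have dX i := coord_is_derive i x v.
apply: (is_derive_eq (is_deriveD (is_derive_sum (fun i => is_deriveM (dX i) (dX i))) (is_derive_cst _ _ _))).
by rewrite addr0 mulr_sumr; apply: eq_bigr => i _; rewrite /GRing.scale/=; ring.
Qed.

Lemma newton_ker_is_derive eps (i : 'I_m) x v : 0 < eps ->
  is_derive x v (newton_ker eps i) (newton_dker eps i v x).
Proof.
move=> e0; have r0 := rho_gt0 x e0.
have drho := rho_is_derive eps x v.
have rn0 : (rho eps ^+ n) x != 0 by rewrite fctE expf_neq0// gt_eqF.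
have drhoV : is_derive x v (fun y => ((rho eps ^+ n) y)^-1)
    (- ((rho eps ^+ n) x) ^- 2 *: ((n%:R * rho eps x ^+ n.-1) *: (2 * dotp x v))).
  have dr := is_deriveX n drho.
  apply: DeriveDef; first exact: derivableV.
  by rewrite deriveV// derive_val.
have -> : newton_ker eps i = (fun y : V => y ord0 i) * (fun y => ((rho eps ^+ n) y)^-1).
  by apply/funext => y; rewrite /newton_ker !fctE.
apply: (is_derive_eq (is_deriveM (coord_is_derive i x v) drhoV)).
rewrite /newton_dker !fctE /GRing.scale/=.
move: (rho eps x) (dotp x v) (v ord0 i) (x ord0 i) r0 => r d a b r0.
have {}rn0 : r != 0 by rewrite gt_eqF.
case: (n) => [|k]; first by rewrite /= muln0 !expr0 invr1; ring.
rewrite /= !exprS natrM; have : r ^+ k != 0 by rewrite expf_neq0.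
by move: (r ^+ k) (k.+1%:R : R) => q c q0; field; rewrite rn0 q0.
Qed.

Lemma dotp_delta x i : dotp x (delta_mx ord0 i) = x ord0 i.
Proof.
rewrite /dotp (bigD1 i)//= mxE !eqxx mulr1 big1 ?addr0// => j ji.
by rewrite mxE (negbTE ji) andbF mulr0.
Qed.

Lemma newton_dker_delta eps i j x :
  newton_dker eps i (delta_mx ord0 j) x =
  (i == j)%:R / rho eps x ^+ n - (2 * n)%:R * x ord0 i * x ord0 j / rho eps x ^+ n.+1.
Proof. by rewrite /newton_dker dotp_delta mxE eqxx. Qed.

(** The field is a gradient. This symmetry makes the mixed terms cancel in [smoothedE], so that the
    dbar-divergence of the complex field is a multiple of the real kernel [poisson_ker]. *)
Lemma newton_dkerC eps i j x :
  newton_dker eps i (delta_mx ord0 j) x = newton_dker eps j (delta_mx ord0 i) x.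
Proof. by rewrite !newton_dker_delta eq_sym -!mulrA (mulrCA (x ord0 i)). Qed.

(** The exponent [n] is half the dimension: with |x|^2 = rho - eps^2, the terms 2 n / rho^n cancel
    and only the one with eps^2 is left. *)
Lemma poisson_kerE eps x : 0 < eps ->
  \sum_i newton_dker eps i (delta_mx ord0 i) x = poisson_ker eps x.
Proof.
move=> e0; under eq_bigr do rewrite newton_dker_delta eqxx.
rewrite sumrB sumr_const card_ord -mulr_suml.
under eq_bigr do rewrite -mulrA.
rewrite -mulr_sumr -/(dotp x x) /poisson_ker -[dotp x x](addrK (eps ^+ 2)) -/(rho eps x).
have r0 : rho eps x != 0 by rewrite gt_eqF// rho_gt0.
rewrite addnn -mul2n -(mulr_natr (_ / _)) /= [_ ^+ n.+1]exprS.
have : rho eps x ^+ n != 0 by rewrite expf_neq0.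
move: (rho eps x) (rho eps x ^+ n) ((2 * n)%:R : R) r0 => r q c r0 q0.
by field; rewrite r0 q0.
Qed.

(* The max norm makes the sublevel sets of [rad] boxes, whose volume is known. *)
Definition rad eps x : R := Num.max `|x| eps.

Lemma rad_gt0 eps x : 0 < eps -> 0 < rad eps x.
Proof. by move=> e0; rewrite lt_max e0 orbT. Qed.

Lemma coord_le_rad eps x i : `|x ord0 i| <= rad eps x.
Proof. by rewrite le_max ler_coord_norm. Qed.

Lemma dotp_ge_norm x : `|x| ^+ 2 <= dotp x x.
Proof.
rewrite -[leRHS]sqr_sqrtr; last by rewrite sumr_ge0// => i _; rewrite -expr2 sqr_ge0.
rewrite ler_pXn2r ?nnegrE ?sqrtr_ge0//.
by have := norm_le_enorm x; rewrite /enorm /dotp; under eq_bigr do rewrite expr2.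
Qed.

Lemma rad_le_rho eps x : 0 < eps -> rad eps x ^+ 2 <= rho eps x.
Proof.
move=> e0; rewrite /rad maxEle; case: ifP => _.
  by rewrite lerDr (le_trans _ (dotp_ge_norm x))// sqr_ge0.
by rewrite (le_trans (dotp_ge_norm x))// lerDl sqr_ge0.
Qed.

Lemma rho_le eps x : `|x| <= eps -> rho eps x <= m.+1%:R * eps ^+ 2.
Proof.
move=> xe; rewrite -natr1 mulrDl mul1r lerD2r /dotp.
rewrite mulr_natl -[X in _ *+ X](card_ord m) -sumr_const ler_sum// => i _.
rewrite -expr2 -(real_normK (num_real _)) ler_pXn2r ?nnegrE//.
  exact: le_trans (ler_coord_norm x i) xe.
exact: le_trans xe.
Qed.

Lemma newton_ker_le eps i x : 0 < eps -> (0 < n)%N ->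
  `|newton_ker eps i x| <= rad eps x ^- m.-1.
Proof.
move=> e0 n0; have r0 := rad_gt0 x e0; have rh := rho_gt0 x e0.
rewrite /newton_ker normrM normfV (gtr0_norm (exprn_gt0 _ rh)).
rewrite ler_pdivrMr ?exprn_gt0// mulrC ler_pdivlMr ?exprn_gt0//.
apply: (@le_trans _ _ (rad eps x * rad eps x ^+ m.-1)).
  by apply: ler_wpM2r; [rewrite exprn_ge0// ltW|exact: coord_le_rad].
rewrite -exprS prednK ?addn_gt0 ?n0// addnn -mul2n exprM.
apply: lerXn2r; rewrite ?nnegrE ?sqr_ge0 ?(ltW rh)//; exact: rad_le_rho.
Qed.

Lemma poisson_ker_ge0 eps x : 0 < eps -> 0 <= poisson_ker eps x.
Proof. by move=> e0; rewrite divr_ge0 ?mulr_ge0 ?exprn_ge0// ltW// rho_gt0. Qed.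

Lemma poisson_ker_le eps x : 0 < eps ->
  poisson_ker eps x <= (2 * n)%:R * eps ^+ 2 * rad eps x ^- m.+2.
Proof.
move=> e0; have r0 := rad_gt0 x e0; have rh := rho_gt0 x e0.
apply: ler_wpM2l; first by rewrite mulr_ge0// sqr_ge0.
rewrite lef_pV2 ?posrE ?exprn_gt0// (_ : m.+2 = (2 * n.+1)%N); last by lia.
rewrite exprM; apply: lerXn2r; rewrite ?nnegrE ?sqr_ge0 ?(ltW rh)//; exact: rad_le_rho.
Qed.

Lemma poisson_ker_ge eps x : 0 < eps -> `|x| <= eps ->
  (2 * n)%:R / (m.+1%:R ^+ n.+1) / eps ^+ m <= poisson_ker eps x.
Proof.
move=> e0 xe; have rh := rho_gt0 x e0.
apply: (@le_trans _ _ ((2 * n)%:R * eps ^+ 2 / (m.+1%:R * eps ^+ 2) ^+ n.+1)).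
  rewrite exprMn -exprM (_ : (2 * n.+1)%N = m.+2); last by lia.
  rewrite le_eqVlt; apply/orP; left; apply/eqP.
  rewrite -[m.+2]addn2 [eps ^+ (m + 2)]exprD.
  have : m.+1%:R ^+ n.+1 != 0 :> R by rewrite expf_neq0// pnatr_eq0.
  have : eps ^+ m != 0 by rewrite expf_neq0// gt_eqF.
  have : eps != 0 by rewrite gt_eqF.
  move: (m.+1%:R ^+ n.+1) ((2 * n)%:R : R) (eps ^+ m) => a b c e1 c0 a0.
  by field; rewrite e1 c0 a0.
apply: ler_wpM2l; first by rewrite mulr_ge0// sqr_ge0.
rewrite lef_pV2 ?posrE ?exprn_gt0// ?mulr_gt0 ?exprn_gt0//.
apply: lerXn2r; rewrite ?nnegrE ?(ltW rh)//; [exact/mulr_ge0/sqr_ge0|exact: rho_le].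
Qed.

(** A crude bound that blows up with 1 / eps. It is meant for differentiation under the integral and
    for integrability at fixed [eps], and enters no constant of the final estimate. *)
Lemma newton_dker_le eps i v x : 0 < eps ->
  `|newton_dker eps i v x| <= (1 + (2 * n * m)%:R) / eps ^+ (2 * n) * `|v|.
Proof.
move=> e0; have rh := rho_gt0 x e0.
have re : eps ^+ 2 <= rho eps x by rewrite /rho lerDr (le_trans _ (dotp_ge_norm x))// sqr_ge0.
have xx : `|x| ^+ 2 <= rho eps x by rewrite (le_trans (dotp_ge_norm x))// lerDl sqr_ge0.
have rhoV : rho eps x ^- n <= eps ^- (2 * n).
  rewrite lef_pV2 ?posrE ?exprn_gt0// exprM.
  by apply: lerXn2r; rewrite ?nnegrE ?sqr_ge0 ?(ltW rh).
have rhoV0 : 0 <= rho eps x ^- n by rewrite invr_ge0 exprn_ge0// ltW.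
have xv : `|x ord0 i * dotp x v| <= m%:R * `|v| * rho eps x.
  rewrite normrM; apply: (@le_trans _ _ (`|x| * (m%:R * (`|x| * `|v|)))); last first.
    rewrite (_ : _ * _ = m%:R * `|v| * `|x| ^+ 2); last by ring.
    by apply: ler_wpM2l => //; rewrite mulr_ge0.
  apply: ler_pM => //; first exact: ler_coord_norm.
  apply: (le_trans (ler_norm_sum _ _ _)).
  rewrite mulr_natl -[X in _ *+ X](card_ord m) -sumr_const ler_sum// => j _.
  by rewrite normrM; apply: ler_pM => //; exact: ler_coord_norm.
rewrite /newton_dker; apply: (le_trans (ler_normB _ _)).
rewrite [(1 + _) / _]mulrDl mul1r mulrDl; apply: lerD.
  rewrite normrM normfV (gtr0_norm (exprn_gt0 _ rh)) mulrC.
  by apply: ler_pM => //; exact: ler_coord_norm.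
rewrite normrM normfV (gtr0_norm (exprn_gt0 _ rh)) exprS invfM -mulrA normrM normr_nat.
apply: (@le_trans _ _ ((2 * n)%:R * (m%:R * `|v| * rho eps x) * ((rho eps x)^-1 * rho eps x ^- n))).
  apply: ler_wpM2r; first by rewrite mulr_ge0// invr_ge0 ltW.
  exact: ler_wpM2l.
rewrite [(2 * n * m)%:R]natrM; move: rhoV rhoV0; have : rho eps x != 0 by rewrite gt_eqF.
move: (rho eps x ^- n) (eps ^- (2 * n)) ((2 * n)%:R : R) (ler0n R (2 * n)) => a b c c0 r0 ab a0.
rewrite (_ : c * _ * _ = a * (c * m%:R * `|v|)); last by field.
rewrite (_ : c * _ * _ * _ = b * (c * m%:R * `|v|)); last by ring.
by apply: ler_wpM2r => //; rewrite !mulr_ge0.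
Qed.

End newton_kernel.

Section kernel_continuity.
Context (R : realType) (n : nat).
Local Notation m := (n + n)%N.
Local Notation V := 'rV[R]_m.

Lemma dotp_continuous (f g : V -> V) : continuous f -> continuous g ->
  continuous (fun x => dotp (f x) (g x)).
Proof.
move=> cf cg; apply: (@continuous_big _ _ +%R 0 xpredT) => [|i _ x].
  exact: add_continuous.
have h (k : V -> V) : continuous k -> continuous (fun y => k y ord0 i).
  move=> ck y.
  exact: (@continuous_comp _ _ _ k (fun z : V => z ord0 i) y (ck y) (@coord_continuous _ _ _ _ _ (k y))).
exact: (continuousM (h f cf x) (h g cg x)).
Qed.

Lemma rho_continuous eps : continuous (@rho R n eps).
Proof.
move=> x; have ci : continuous (@id V) by move=> y; exact: cvg_id.
exact: (@continuousD _ _ _ (fun x => dotp x x) (fun=> eps ^+ 2) x (@dotp_continuous id id ci ci x) (@cst_continuous _ _ _ x)).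
Qed.

Lemma rhoXV_continuous eps k : 0 < eps -> continuous (fun x => @rho R n eps x ^- k).
Proof.
move=> e0 x.
have cr : {for x, continuous (fun x => @rho R n eps x ^+ k)}.
  exact: (@continuous_comp _ _ _ (@rho R n eps) (fun r => r ^+ k) x (@rho_continuous eps x) (@exprn_continuous _ _ _)).
by apply: (continuousV _ cr); rewrite expf_neq0// gt_eqF// rho_gt0.
Qed.

Lemma newton_ker_continuous eps i : 0 < eps -> continuous (@newton_ker R n eps i).
Proof.
move=> e0 x.
exact: (@continuousM _ _ (fun x : V => x ord0 i) (fun x => @rho R n eps x ^- n) x
  (@coord_continuous _ _ _ _ _ x) (@rhoXV_continuous eps n e0 x)).
Qed.

Lemma newton_dker_continuous eps i v : 0 < eps -> continuous (@newton_dker R n eps i v).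
Proof.
move=> e0 x.
have ci : continuous (@id V) by move=> y; exact: cvg_id.
have cv : continuous (fun _ : V => v) by exact: cst_continuous.
have c1 : {for x, continuous (fun x => v ord0 i / @rho R n eps x ^+ n)}.
  exact: (continuousM (@cst_continuous _ _ _ x) (@rhoXV_continuous eps n e0 x)).
have c2 : {for x, continuous (fun x : V => (2 * n)%:R * x ord0 i)}.
  exact: (continuousM (@cst_continuous _ _ _ x) (@coord_continuous _ _ _ _ _ x)).
have c3 := continuousM (continuousM c2 (@dotp_continuous id (fun=> v) ci cv x))
  (@rhoXV_continuous eps n.+1 e0 x).
exact: (continuousB c1 c3).
Qed.

Lemma poisson_ker_continuous eps : 0 < eps -> continuous (@poisson_ker R n eps).
Proof.
move=> e0 x; exact: (continuousM (@cst_continuous _ _ _ x) (@rhoXV_continuous eps n.+1 e0 x)).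
Qed.

Lemma radXV_continuous eps p : 0 < eps -> continuous (fun x => @rad R n eps x ^- p).
Proof.
move=> e0 x.
have cr : {for x, continuous (@rad R n eps)}.
  by apply: continuous_max; [exact: norm_continuous|exact: cst_continuous].
have crp : {for x, continuous (fun x => @rad R n eps x ^+ p)}.
  exact: (@continuous_comp _ _ _ (@rad R n eps) (fun r => r ^+ p) x cr (@exprn_continuous _ _ _)).
by apply: (continuousV _ crp); rewrite expf_neq0// gt_eqF// rad_gt0.
Qed.

Lemma continuous_measurable_rV (D : set (measurable_rV R m)) (f : V -> R) :
  continuous f -> measurable_fun D f.
Proof.
move=> cf; apply: (@measurable_funTS _ _ _ _ D f).
apply: (@within_continuous_measurable_rV R m setT f) => //.
exact: continuous_subspaceT.
Qed.

Lemma measurable_reflect (D : set (measurable_rV R m)) (z : V) (f : V -> R) :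
  continuous f -> measurable_fun D (fun x : measurable_rV R m => f (z - x : V)).
Proof.
move=> cf; apply: continuous_measurable_rV => x.
have c1 : {for x, continuous (fun x : V => z - x)}.
  exact: (continuousB (@cst_continuous _ _ _ x) (@cvg_id _ _)).
exact: (@continuous_comp _ _ _ (fun x : V => z - x) f x c1 (cf _)).
Qed.

End kernel_continuity.

(** * Dyadic bounds for the integrals of the kernels *)

Section dyadic.
Context (R : realType) (n : nat).
Local Notation m := (n + n)%N.
Local Notation V := 'rV[R]_m.
Local Notation vol := (@lebesgue_rV R m).

Definition dyadic_box (z : V) (k : nat) : set (measurable_rV R m) :=
  [set x : V | `|z - x| <= 2 ^- k].

Lemma dyadic_boxE z k :
  dyadic_box z k = box (fun i => z ord0 i - 2 ^- k) (fun i => z ord0 i + 2 ^- k).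
Proof.
have k0 : 0 < 2 ^- k :> R by rewrite invr_gt0 exprn_gt0.
apply/seteqP; split => x /=.
  rewrite /dyadic_box/= => zx i; rewrite in_itv/=.
  have := le_trans (ler_coord_norm (z - x) i) zx.
  by rewrite !mxE ler_norml => /andP[]; lra.
move=> bx; apply: norm_rV_le; first exact: ltW.
by move=> i; have := bx i; rewrite in_itv/= !mxE ler_norml; lra.
Qed.

Lemma measurable_dyadic_box z k : measurable (dyadic_box z k).
Proof. by rewrite dyadic_boxE; exact: measurable_box. Qed.

Lemma lebesgue_dyadic_box z k : vol (dyadic_box z k) = ((2 * 2 ^- k) ^+ m)%:E.
Proof.
have k0 : 0 < 2 ^- k :> R by rewrite invr_gt0 exprn_gt0.
rewrite dyadic_boxE lebesgue_rV_box => [|i]; last by lra.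
rewrite (eq_bigr (fun=> 2 * 2 ^- k)) => [|i _]; last by ring.
by rewrite prodr_const card_ord.
Qed.

(** Outside the unit box the left-hand side is at most 1. Otherwise let k < K be the last index
    whose box contains x: [rad] is then at least 2^-(k+1), by the next box or by the cutoff 2^-K,
    and the k-th term alone suffices. *)
Lemma rad_dyadic K p (z x : V) :
  rad (2 ^- K) (z - x) ^- p <=
  1 + \sum_(0 <= k < K) 2 ^+ (k.+1 * p) * \1_(dyadic_box z k) x :> R.
Proof.
elim: K => [|K ih].
  rewrite big_nil addr0 expr0 invr1 invf_le1 ?exprn_gt0 ?rad_gt0//.
  by rewrite exprn_ege1// /rad le_max lexx orbT.
rewrite big_nat_recr//= addrA.
have k0 j : 0 < 2 ^- j :> R by rewrite invr_gt0 exprn_gt0.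
have [zx|zx] := leP `|z - x| (2 ^- K).
  rewrite indicE mem_set// mulr1; apply: ler_wpDl.
    by rewrite addr_ge0// sumr_ge0// => k _; rewrite mulr_ge0// exprn_ge0.
  rewrite -[leRHS]invrK lef_pV2 ?posrE ?exprn_gt0 ?rad_gt0 ?invr_gt0 ?exprn_gt0//.
  rewrite exprM -[leLHS]exprVn; apply: lerXn2r; rewrite ?nnegrE ?(ltW (k0 _)) ?(ltW (rad_gt0 _ _))//.
  by rewrite le_max lexx orbT.
rewrite ler_wpDr ?mulr_ge0 ?exprn_ge0//; apply: le_trans ih.
have kK : 2 ^- K.+1 <= 2 ^- K :> R.
  by rewrite lef_pV2 ?posrE ?exprn_gt0// ler_eXn2l// ltr1n.
by rewrite /rad !max_l ?(ltW zx)// (le_trans kK)// ltW.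
Qed.

Lemma integral_rad_le (D : set (measurable_rV R m)) K p (z : V) :
  measurable D -> (vol D < +oo)%E ->
  (\int[vol]_(x in D) (rad (2 ^- K) (z - x : V) ^- p)%:E <=
   (fine (vol D) + \sum_(0 <= k < K) 2 ^+ (k.+1 * p) * (2 * 2 ^- k) ^+ m)%:E)%E.
Proof.
move=> mD Doo.
have mI j : measurable_fun D (fun x => (\1_(dyadic_box z j) x)%:E).
  by apply/measurable_EFinP; apply: measurable_indic; exact: measurable_dyadic_box.
apply: (@le_trans _ _ (\int[vol]_(x in D) (1%:E + \sum_(0 <= k < K)
    ((2 ^+ (k.+1 * p))%:E * (\1_(dyadic_box z k) x)%:E)))%E).
  apply: ge0_le_integral => //.
  - by move=> x _; rewrite lee_fin invr_ge0 exprn_ge0// ltW// rad_gt0// invr_gt0 exprn_gt0.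
  - apply/measurable_EFinP; apply: (@measurable_reflect R n D z (fun x : V => rad (2 ^- K) x ^- p)).
    by apply: radXV_continuous; rewrite invr_gt0 exprn_gt0.
  - apply: emeasurable_funD => //; apply: emeasurable_sum => j.
    by apply: measurable_funeM; exact: mI.
  - move=> x Dx; apply: le_trans (_ : ((1 + \sum_(0 <= k < K) 2 ^+ (k.+1 * p) * \1_(dyadic_box z k) x)%:E <= _)%E).
      by rewrite lee_fin; exact: rad_dyadic.
    by rewrite EFinD -sumEFin.
rewrite ge0_integralD//; last 2 first.
- by move=> x _; apply: sume_ge0 => j _; rewrite mule_ge0// lee_fin// exprn_ge0.
- apply: emeasurable_sum => j.
  by apply: measurable_funeM; exact: mI.
rewrite EFinD; apply: leeD.
  by rewrite integral_cst// mul1e fineK// ge0_fin_numE.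
rewrite ge0_integral_sum//; last first.
  by move=> j; apply: measurable_funeM; exact: mI.
rewrite -sumEFin; apply: lee_sum => j _; rewrite ge0_integralZl_EFin//.
rewrite EFinM; apply: lee_wpmul2l; first by rewrite lee_fin exprn_ge0.
rewrite integral_indic//; last exact: measurable_dyadic_box.
rewrite -(lebesgue_dyadic_box z); apply: le_measure; rewrite ?inE//.
- by apply: measurableI => //; exact: measurable_dyadic_box.
- exact: measurable_dyadic_box.
Qed.

(** The powers combine to 2^(m-1) 2^m 2^-k, a convergent geometric series: this is the local
    integrability of |x|^(1-m), uniformly in the cutoff. *)
Lemma newton_dyadic_sum K : (0 < n)%N ->
  \sum_(0 <= k < K) 2 ^+ (k.+1 * m.-1) * (2 * 2 ^- k) ^+ m <= 4 ^+ m :> R.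
Proof.
move=> n0; have m0 : (0 < m)%N by rewrite addn_gt0 n0.
have E k : 2 ^+ (k.+1 * m.-1) * (2 * 2 ^- k) ^+ m = 2 ^+ m.-1 * 2 ^+ m * 2 ^- k :> R.
  move: (prednK m0); move: (m.-1) => p <-.
  rewrite mulSn exprD exprM expr_div_n [(2 ^+ k) ^+ p.+1]exprS.
  have : (2 ^+ k) ^+ p != 0 :> R by rewrite !expf_neq0.
  have : 2 ^+ k != 0 :> R by rewrite expf_neq0.
  move: (2 ^+ k) ((2 ^+ k) ^+ p) (2 ^+ p) (2 ^+ p.+1) => x y u v x0 y0.
  by field; rewrite x0 y0.
under eq_bigr do rewrite E.
rewrite -mulr_sumr.
have S : \sum_(0 <= k < K) 2 ^- k <= 2 - 2 ^- K * 2 :> R.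
  elim: K => [|K ih]; first by rewrite big_nil expr0; lra.
  rewrite big_nat_recr//=; apply: le_trans (lerD ih (lexx _)) _.
  rewrite exprS invfM; lra.
have {}S : \sum_(0 <= k < K) 2 ^- k <= 2 :> R.
  apply: (le_trans S); rewrite lerBlDr lerDl mulr_ge0// invr_ge0 exprn_ge0//.
apply: (@le_trans _ _ (2 ^+ m.-1 * 2 ^+ m * 2)).
  by apply: ler_wpM2l => //; rewrite mulr_ge0// exprn_ge0.
rewrite mulrC mulrA -exprS prednK// -exprMn le_eqVlt; apply/orP; left; apply/eqP.
by congr (_ ^+ _); ring.
Qed.

(** The exponent m + 2 exceeds the dimension by 2, so the sum grows like 4^K; the factor eps^2 =
    4^-K of [poisson_ker] compensates exactly for this growth. *)
Lemma poisson_dyadic_sum K :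
  \sum_(0 <= k < K) 2 ^+ (k.+1 * m.+2) * (2 * 2 ^- k) ^+ m <= 4 ^+ m.+1 * 4 ^+ K :> R.
Proof.
have E k : 2 ^+ (k.+1 * m.+2) * (2 * 2 ^- k) ^+ m = 4 ^+ m.+1 * 4 ^+ k :> R.
  rewrite (_ : 4 = 2 * 2 :> R); last by ring.
  move: m => p; rewrite mulSn exprD exprM expr_div_n !exprMn.
  rewrite [(2 ^+ k) ^+ p.+2]exprS [(2 ^+ k) ^+ p.+1]exprS [2 ^+ p.+2]exprS [2 ^+ p.+1]exprS.
  have : (2 ^+ k) ^+ p != 0 :> R by rewrite !expf_neq0.
  by move: (2 ^+ k) ((2 ^+ k) ^+ p) (2 ^+ p) => x y u y0; field.
under eq_bigr do rewrite E.
rewrite -mulr_sumr; apply: ler_wpM2l; first by rewrite exprn_ge0.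
elim: K => [|K ih]; first by rewrite big_nil expr0.
rewrite big_nat_recr//=; apply: le_trans (lerD ih (lexx _)) _.
by rewrite exprS; have : 0 <= 4 ^+ K :> R by [rewrite exprn_ge0|]; lra.
Qed.

End dyadic.

Lemma radXV_le (R : realType) (n : nat) (eps : R) p (x : 'rV[R]_(n + n)) :
  0 < eps -> rad eps x ^- p <= eps ^- p.
Proof.
move=> e0; rewrite lef_pV2 ?posrE ?exprn_gt0 ?rad_gt0//.
by apply: lerXn2r; rewrite ?nnegrE ?(ltW e0) ?(ltW (rad_gt0 _ e0))// le_max lexx orbT.
Qed.

Lemma newton_ker_bounded (R : realType) (n : nat) (eps : R) i (x : 'rV[R]_(n + n)) :
  0 < eps -> (0 < n)%N -> `|newton_ker eps i x| <= eps ^- (n + n).-1.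
Proof. by move=> e0 n0; apply: le_trans (newton_ker_le _ _ e0 n0) (radXV_le _ _ e0). Qed.

Section Rintegral_sum.
Context d (T : measurableType d) (R : realType) (mu : {measure set T -> \bar R}).

Lemma integrable_Rsum (D : set T) (I : Type) (s : seq I) (f : I -> T -> R) :
  measurable D -> (forall i, mu.-integrable D (EFin \o f i)) ->
  mu.-integrable D (EFin \o (fun x => \sum_(i <- s) f i x)).
Proof.
move=> mD intf; rewrite (_ : _ \o _ = (fun x => \sum_(i <- s) (f i x)%:E)%E).
  by apply: integrable_sum => // i _; exact: intf.
by apply/funext => x /=; rewrite sumEFin.
Qed.

Lemma Rintegral_sum (D : set T) (I : Type) (s : seq I) (f : I -> T -> R) :
  measurable D -> (forall i, mu.-integrable D (EFin \o f i)) ->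
  \int[mu]_(x in D) (\sum_(i <- s) f i x) = \sum_(i <- s) \int[mu]_(x in D) f i x.
Proof.
move=> mD intf; elim: s => [|i s ih].
  by under eq_Rintegral do rewrite big_nil; rewrite big_nil Rintegral_cst// mul0r.
rewrite big_cons -ih -RintegralD//; last exact: integrable_Rsum.
by apply: eq_Rintegral => x _; rewrite big_cons.
Qed.

End Rintegral_sum.

(** * Convolutions with the Newton and Poisson kernels *)

Section convolution.
Context (R : realType) (n : nat).
Hypothesis n0 : (0 < n)%N.
Local Notation m := (n + n)%N.
Local Notation V := 'rV[R]_m.
Local Notation vol := (@lebesgue_rV R m).
Variables (D : set (measurable_rV R m)).
Hypothesis mD : measurable D.
Hypothesis Doo : (vol D < +oo)%E.
Let vD := fine (vol D).
Let vD0 : 0 <= vD. Proof. exact: fine_ge0. Qed.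

Definition conv_on (kappa : V -> R) (a : V -> R) (z : V) : R :=
  \int[vol]_(x in D) (a x * kappa (z - x : V)).

Section bounded_kernel.
Variables (kappa : V -> R) (B : R).
Hypothesis ck : continuous kappa.
Hypothesis kB : forall x, `|kappa x| <= B.

Lemma integrable_conv_on (a : V -> R) (A : R) (z : V) : measurable_fun D a -> (forall x, D x -> `|a x| <= A) ->
  vol.-integrable D (EFin \o (fun x => a x * kappa (z - x : V))).
Proof.
move=> ma aA; apply: (@bounded_integrable _ _ _ _ _ _ (A * B)) => //.
  by apply: measurable_funM => //; exact: measurable_reflect.
by move=> x Dx; rewrite normrM; apply: ler_pM => //; exact: aA.
Qed.

Lemma conv_on_le (a : V -> R) (A : R) (z : V) : measurable_fun D a -> (forall x, D x -> `|a x| <= A) ->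
  `|conv_on kappa a z| <= A * B * vD.
Proof.
move=> ma aA; apply: Rintegral_cst_le => //.
  by apply: measurable_funM => //; exact: measurable_reflect.
by move=> x Dx; rewrite normrM; apply: ler_pM => //; exact: aA.
Qed.

End bounded_kernel.

Lemma conv_on_rad_le (kappa : V -> R) (C : R) p K (a : V -> R) (z : V) : 0 <= C -> continuous kappa ->
  (forall x, `|kappa x| <= C * rad (2 ^- K) x ^- p) ->
  measurable_fun D a -> (forall x, D x -> `|a x| <= 1) ->
  `|conv_on kappa a z| <= C * (vD + \sum_(0 <= k < K) 2 ^+ (k.+1 * p) * (2 * 2 ^- k) ^+ m).
Proof.
move=> C0 ck kC ma a1.
have e0 : 0 < 2 ^- K :> R by rewrite invr_gt0 exprn_gt0.
have radB x : `|@rad R n (2 ^- K) x ^- p| <= (2 ^- K) ^- p.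
  by rewrite ger0_norm ?invr_ge0 ?exprn_ge0 ?(ltW (rad_gt0 _ e0))//; exact: radXV_le.
have intr : vol.-integrable D (EFin \o (fun x => rad (2 ^- K) (z - x : V) ^- p)).
  apply: (@bounded_integrable _ _ _ _ _ _ ((2 ^- K) ^- p)) => //.
  apply: (@measurable_reflect R n D z (fun x : V => rad (2 ^- K) x ^- p)).
  exact: radXV_continuous.
have kB x : `|kappa x| <= C * (2 ^- K) ^- p.
  apply: (le_trans (kC x)); apply: ler_wpM2l => //.
  exact: le_trans (ler_norm _) (radB x).
have intk := integrable_conv_on ck kB z ma a1.
apply: (le_trans (le_normr_Rintegral mD intk)).
apply: (@le_trans _ _ (\int[vol]_(x in D) (C * rad (2 ^- K) (z - x : V) ^- p))).
  apply: le_Rintegral => //.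
  - exact: integrable_norm intk.
  - exact: (integrableZl mD C intr).
  - move=> x Dx; rewrite normrM; apply: le_trans (kC _).
    by rewrite ler_piMl// a1.
rewrite RintegralZl//; apply: ler_wpM2l => //.
rewrite -lee_fin fineK ?integrable_fin_num//; exact: integral_rad_le.
Qed.

Variable K : nat.
Let eps : R := 2 ^- K.
Let eps0 : 0 < eps. Proof. by rewrite invr_gt0 exprn_gt0. Qed.

Definition newton_conv i a := conv_on (@newton_ker R n (2 ^- K) i) a.
Definition newton_dconv i v a := conv_on (@newton_dker R n (2 ^- K) i v) a.
Definition poisson_conv a := conv_on (@poisson_ker R n (2 ^- K)) a.

Variable a : V -> R.
Hypothesis ma : measurable_fun D a.
Hypothesis a1 : forall x, D x -> `|a x| <= 1.

(** Independent of [K], [z] and [a]. This is the source of the constant [A] and of the dependence of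
    the final constant on the volume of [Omega]. *)
Lemma newton_conv_le i z : `|newton_conv i a z| <= vD + 4 ^+ m.
Proof.
have kC x : `|@newton_ker R n eps i x| <= 1 * rad eps x ^- m.-1.
  by rewrite mul1r; exact: newton_ker_le.
apply: (le_trans (conv_on_rad_le z ler01 (newton_ker_continuous eps0) kC ma a1)).
by rewrite mul1r lerD2l; exact: newton_dyadic_sum.
Qed.

(** Uniformity in [K] is the point: it provides the dominating constant for the limit over [K]. *)
Lemma poisson_conv_le z : `|poisson_conv a z| <= (2 * n)%:R * (vD + 4 ^+ m.+1).
Proof.
have kC x : `|@poisson_ker R n eps x| <= (2 * n)%:R * eps ^+ 2 * rad eps x ^- m.+2.
  by rewrite ger0_norm ?poisson_ker_ge0//; exact: poisson_ker_le.
have C0 : 0 <= (2 * n)%:R * eps ^+ 2 by rewrite mulr_ge0// sqr_ge0.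
apply: (le_trans (conv_on_rad_le z C0 (poisson_ker_continuous eps0) kC ma a1)).
rewrite -mulrA; apply: ler_wpM2l => //; rewrite mulrDr.
have eK : eps ^+ 2 * 4 ^+ K = 1.
  rewrite /eps (_ : 4 = 2 ^+ 2); last by rewrite expr2; ring.
  by rewrite -exprM mulnC exprM -exprMn mulVf ?expr1n// expf_neq0.
have e1 : eps <= 1 by rewrite invf_le1 ?exprn_gt0// exprn_ege1// ler1n.
apply: lerD.
  by rewrite ler_piMl// exprn_ile1// ltW.
apply: (@le_trans _ _ (eps ^+ 2 * (4 ^+ m.+1 * 4 ^+ K))); last by rewrite mulrCA eK mulr1.
apply: ler_wpM2l; first exact: sqr_ge0.
exact: poisson_dyadic_sum.
Qed.

(** As [a] is only measurable, the derivative is passed to the kernel by differentiating under the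
    integral along the line z + s v at s = 0, dominated by [newton_dker_le]. *)
Lemma newton_conv_is_derive i v z :
  is_derive z v (newton_conv i a) (newton_dconv i v a z).
Proof.
pose f (s : R) (x : measurable_rV R m) : R := a x * newton_ker eps i (z + s *: v - x : V).
have zE (s : R) (x : V) : z + s *: v - x = (z - x) + s *: v by rewrite addrAC.
have df (s : R) (x : V) : is_derive s 1 (f ^~ x) (a x * newton_dker eps i v (z + s *: v - x : V)).
  have dk := newton_ker_is_derive i (z - x + s *: v) v eps0.
  have := is_derive_line (@ex_derive _ _ _ _ _ _ _ dk).
  rewrite derive_val => dl.
  have -> : f ^~ x = cst (a x) * (fun s => newton_ker eps i (z - x + s *: v)).
    by apply/funext => t; rewrite /f zE.
  apply: (is_derive_eq (is_deriveM (is_derive_cst (a x) s 1) dl)).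
  by rewrite scaler0 addr0 -zE.
have I0 : `]-1, 1[%classic (0 : R) by rewrite /= in_itv/=; apply/andP; split; lra.
have C0 : 0 <= (1 + (2 * n * m)%:R) / eps ^+ (2 * n) * `|v|.
  by rewrite mulr_ge0// divr_ge0// ?exprn_ge0 ?(ltW eps0)// addr_ge0.
have intf (s : R) : vol.-integrable D (EFin \o f s).
  apply: (integrable_conv_on (B := eps ^- m.-1) (newton_ker_continuous eps0) _ _ ma a1).
  by move=> x; exact: newton_ker_bounded.
have G_ub (s : R) (x : measurable_rV R m) : `](-1), 1[%classic s -> D x ->
    `|partial1of2 f s x| <= (1 + (2 * n * m)%:R) / eps ^+ (2 * n) * `|v|.
  move=> _ Dx; have dfs := df s x; rewrite partial1of2E derive_val normrM.
  apply: le_trans (newton_dker_le i v (z + s *: v - x) eps0).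
  by apply: ler_piMl => //; exact: a1.
have intC : vol.-integrable D (EFin \o cst ((1 + (2 * n * m)%:R) / eps ^+ (2 * n) * `|v|)).
  by apply: (bounded_integrable (B := `|(1 + (2 * n * m)%:R) / eps ^+ (2 * n) * `|v| |)).
have cvgF : (fun h : R => h^-1 *: (newton_conv i a (z + (h + 0) *: v) -
    newton_conv i a (z + 0 *: v))) @ 0^' --> \int[vol]_(y in D) partial1of2 f 0 y.
  exact: (@cvg_differentiation_under_integral R _ _ vol f D mD 0 (-1) 1 I0
  (fun s _ => intf s) (fun s x _ _ => @ex_derive _ _ _ _ _ _ _ (df s x))
  (cst ((1 + (2 * n * m)%:R) / eps ^+ (2 * n) * `|v|)) (fun=> C0) intC G_ub).
have E : \int[vol]_(y in D) partial1of2 f 0 y = newton_dconv i v a z.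
  apply: eq_Rintegral => x _; have dfs := df 0 x; rewrite partial1of2E derive_val.
  by rewrite scale0r addr0.
rewrite E in cvgF.
have cvgF' : (fun h : R => h^-1 *: ((newton_conv i a \o shift z) (h *: v) - newton_conv i a z)) @ 0^' -->
    newton_dconv i v a z.
  apply: cvg_trans cvgF; apply: near_eq_cvg; apply: nearW => h /=.
  rewrite addr0 scale0r [z + 0]addr0 [z + _]addrC; reflexivity.
apply: DeriveDef; first by apply/cvg_ex; exists (newton_dconv i v a z).
exact/cvg_lim.
Qed.

Lemma newton_dconv_le i v z :
  `|newton_dconv i v a z| <= (1 + (2 * n * m)%:R) / eps ^+ (2 * n) * `|v| * vD.
Proof.
rewrite -[X in X * vD]mul1r; apply: conv_on_le => //.
  exact: newton_dker_continuous.
by move=> x; exact: newton_dker_le.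
Qed.

Lemma newton_conv_continuous i : continuous (newton_conv i a).
Proof.
move=> z A /nbhs_ballP[e /= e0 eA].
suff : nbhs z (newton_conv i a @^-1` A) by [].
(* A Lipschitz constant from [newton_dconv_le] and the mean value theorem; the added 1 keeps it
   positive when [D] has volume 0. *)
pose C := (1 + (2 * n * m)%:R) / eps ^+ (2 * n) * vD + 1.
have C0 : 0 < C.
  by rewrite /C ltr_wpDl// mulr_ge0// divr_ge0// ?exprn_ge0 ?(ltW eps0)// addr_ge0.
have eC : 0 < e / C by rewrite divr_gt0.
apply/nbhs_ballP; exists (e / C) => //= y; rewrite -ball_normE /ball_/= => zy.
apply: eA; rewrite /ball/= distrC.
have := @mvt_line R _ (newton_conv i a) z (y - z) 1 (C * `|y - z|) ler01.
have zy1 : z + 1 *: (y - z) = y by rewrite scale1r addrC subrK.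
rewrite zy1 mulr1 => h; apply: le_lt_trans (h _ _) _.
- by move=> s _; have [] := newton_conv_is_derive i (y - z) (z + s *: (y - z)).
- move=> s _; have dc := newton_conv_is_derive i (y - z) (z + s *: (y - z)).
  rewrite derive_val; apply: (le_trans (newton_dconv_le _ _ _)).
  by rewrite mulrAC; apply: ler_wpM2r => //; rewrite /C lerDl.
by rewrite mulrC -ltr_pdivlMr// distrC.
Qed.

Lemma poisson_convE z :
  \sum_i newton_dconv i (delta_mx ord0 i) a z = poisson_conv a z.
Proof.
have intk i : vol.-integrable D (EFin \o (fun x => a x * newton_dker eps i (delta_mx ord0 i) (z - x : V))).
  apply: (integrable_conv_on (newton_dker_continuous eps0) _ _ ma a1).
  by move=> x; exact: newton_dker_le.
rewrite /poisson_conv /conv_on.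
under [RHS]eq_Rintegral do rewrite -poisson_kerE// mulr_sumr.
by rewrite Rintegral_sum.
Qed.

End convolution.

(** * Lower bound for convolution with the Poisson kernel *)

Section approximate_identity.
Context (R : realType) (n : nat).
Hypothesis n0 : (0 < n)%N.
Local Notation m := (n + n)%N.
Local Notation V := 'rV[R]_m.
Local Notation vol := (@lebesgue_rV R m).

(* The volume [(2 eps)^m] of the cube [|x| <= eps] times the minimum
   [2 n eps^2 / ((m + 1) eps^2)^(n+1)] of [poisson_ker eps] on it: a lower bound,
   free of [eps], for the mass of the kernel near the origin. *)
Definition poisson_const : R := 2 ^+ m * ((2 * n)%:R / m.+1%:R ^+ n.+1).

Lemma poisson_const_gt0 : 0 < poisson_const.
Proof. by rewrite /poisson_const mulr_gt0 ?divr_gt0 ?exprn_gt0// ltr0n muln_gt0. Qed.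

(** On the cube of radius eps both factors are bounded below, which gives the main term. On the rest
    of the ball of radius r the integrand is nonnegative and is dropped. Farther away |h| <= 2 q,
    while the kernel is at most 2 n eps^2 / r^(m+2). *)
Lemma conv_poisson_ge (D : set (measurable_rV R m)) K (h : V -> R) (z : V) (q r : R) :
  measurable D -> (vol D < +oo)%E -> measurable_fun D h ->
  0 <= q -> 0 < r -> 2 ^- K < r ->
  (forall x, `|z - x| < r -> D x) ->
  (forall x, D x -> `|h x| <= 2 * q) ->
  (forall x, `|z - x| < r -> q / 2 <= h x) ->
  q / 2 * poisson_const - 2 * q * (2 * n)%:R * r ^- m.+2 * fine (vol D) * (2 ^- K) ^+ 2 <=
  \int[vol]_(x in D) (h x * poisson_ker (2 ^- K) (z - x : V)).
Proof.
move=> mD Doo mh q0 r0 Kr zD hq hz.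
have e0 : 0 < 2 ^- K :> R by rewrite invr_gt0 exprn_gt0.
set eps : R := 2 ^- K in e0 Kr *.
have boxD : dyadic_box z K `<=` D by move=> x zx; apply: zD; exact: le_lt_trans Kr.
have mb := measurable_dyadic_box z K.
pose c := (2 * n)%:R / m.+1%:R ^+ n.+1 / eps ^+ m.
have c0 : 0 <= c by rewrite !divr_ge0// exprn_ge0// ltW.
pose M := (2 * n)%:R * eps ^+ 2 * r ^- m.+2.
have M0 : 0 <= M by rewrite mulr_ge0 ?invr_ge0 ?exprn_ge0 ?(ltW r0)// mulr_ge0// sqr_ge0.
have PM x : r <= `|z - x| -> poisson_ker eps (z - x) <= M.
  move=> rx; apply: (le_trans (poisson_ker_le _ e0)).
  apply: ler_wpM2l; first by rewrite mulr_ge0// sqr_ge0.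
  rewrite lef_pV2 ?posrE ?exprn_gt0 ?rad_gt0//.
  by apply: lerXn2r; rewrite ?nnegrE ?(ltW r0) ?(ltW (rad_gt0 _ e0))// le_max rx.
(* One minorant for the three regions: subtracting the far error everywhere is harmless near [z]. *)
pose F (x : measurable_rV R m) := q / 2 * c * \1_(dyadic_box z K) x - 2 * q * M.
have intF1 : vol.-integrable D (EFin \o (fun x => q / 2 * c * \1_(dyadic_box z K) x)).
  apply: (bounded_integrable (B := q / 2 * c)) => //.
    by apply: measurable_funM => //; exact: measurable_indic.
  have qc : 0 <= q / 2 * c by rewrite mulr_ge0// divr_ge0.
  move=> x _; rewrite indicE; case: (x \in _); rewrite ?mulr1 ?mulr0 ?normr0//.
  by rewrite ger0_norm.
have intF2 : vol.-integrable D (EFin \o cst (2 * q * M)).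
  by apply: (bounded_integrable (B := `|2 * q * M|)).
have radB x : `|@poisson_ker R n eps x| <= (2 * n)%:R * eps ^+ 2 * eps ^- m.+2.
  rewrite ger0_norm ?poisson_ker_ge0//; apply: (le_trans (poisson_ker_le _ e0)).
  by apply: ler_wpM2l; [rewrite mulr_ge0// sqr_ge0|exact: radXV_le].
have inth := integrable_conv_on mD Doo (poisson_ker_continuous e0) radB z mh hq.
apply: (@le_trans _ _ (\int[vol]_(x in D) F x)).
  rewrite /F RintegralB// Rintegral_cst//.
  rewrite RintegralZl//; last first.
    apply: (bounded_integrable (B := 1)) => // x _.
    by rewrite indicE; case: (x \in _); rewrite ?normr1 ?normr0.
  rewrite (_ : \int[vol]_(x in D) \1_(dyadic_box z K) x = (2 * eps) ^+ m); last first.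
    rewrite /Rintegral integral_indic// setIidl//.
    exact: (congr1 fine (lebesgue_dyadic_box z K)).
  rewrite le_eqVlt; apply/orP; left; apply/eqP; rewrite /M /c /poisson_const exprMn.
  have : eps ^+ m != 0 by rewrite expf_neq0// gt_eqF.
  have : m.+1%:R ^+ n.+1 != 0 :> R by rewrite expf_neq0// pnatr_eq0.
  move: (eps ^+ m) (m.+1%:R ^+ n.+1 : R) ((2 * n)%:R : R) (2 ^+ m : R) (r ^- m.+2) (fine _) => x y w u v d y0 x0.
  by field; rewrite x0 y0.
apply: le_Rintegral => //; first exact: (integrableB mD intF1 intF2).
move=> x Dx; rewrite /F.
have [zx|zx] := ltP `|z - x| r.
  have qh := hz _ zx.
  have P0 := @poisson_ker_ge0 R n eps (z - x) e0.
  apply: (@le_trans _ _ (q / 2 * poisson_ker eps (z - x))); last exact: ler_wpM2r.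
  apply: (@le_trans _ _ (q / 2 * c * \1_(dyadic_box z K) x)); first by rewrite gerBl mulr_ge0// mulr_ge0.
  rewrite -mulrA; apply: ler_wpM2l; first by rewrite divr_ge0.
  rewrite indicE; case: (boolP (x \in _)); rewrite ?mulr0// mulr1 inE => bx.
  exact: poisson_ker_ge.
rewrite indicE memNset ?mulr0 ?add0r; last by move=> /= bx; have := lt_le_trans Kr (le_trans zx bx); rewrite ltxx.
have := hq _ Dx; rewrite ler_norml => /andP[h1 _].
apply: (@le_trans _ _ (- (2 * q) * poisson_ker eps (z - x))); last first.
  by apply: ler_wpM2r => //; exact: poisson_ker_ge0.
rewrite mulNr lerN2; apply: ler_wpM2l; [by rewrite mulr_ge0|exact: PM].
Qed.

End approximate_identity.

(** * The boundary Poincare inequality *)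

Lemma big_bound (R : realType) (I : finType) (T : Type) (P : set T) (g : I -> T -> R) :
  (forall i, exists2 B, 0 < B & forall x, P x -> `|g i x| <= B) ->
  exists2 B, 0 < B & forall i x, P x -> `|g i x| <= B.
Proof.
move=> h; have /choice[B hB] : forall i, exists B, 0 < B /\ forall x, P x -> `|g i x| <= B.
  by move=> i; have [B ? ?] := h i; exists B.
exists (1 + \sum_i B i).
  by rewrite ltr_pwDl// sumr_ge0// => i _; have [/ltW] := hB i.
move=> i x Px; have [_ /(_ _ Px) /le_trans] := hB i; apply.
rewrite (bigD1 i)//= addrCA lerDl addr_ge0// sumr_ge0// => j _.
by have [/ltW] := hB j.
Qed.

Section squared_modulus.
Context (R : realType) (n : nat).
Local Notation m := (n + n)%N.
Local Notation V := 'rV[R]_m.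
Local Notation vol := (@lebesgue_rV R m).
Local Notation e i := (delta_mx ord0 i : 'rV[R]_m).
Variables (Omega U : set V) (a b : V -> R).
Hypothesis oO : open Omega.
Hypothesis bO : bounded_set Omega.
Hypothesis clU : closure Omega `<=` U.
Hypothesis Ca : Ck 1 U a.
Hypothesis Cb : Ck 1 U b.

(* With f = a + i b, [modulus2] is |f|^2 and [re2], [im2] are the real and
   imaginary parts of f^2. *)
Definition modulus2 (x : V) : R := a x ^+ 2 + b x ^+ 2.
Definition re2 (x : V) : R := a x ^+ 2 - b x ^+ 2.
Definition im2 (x : V) : R := 2 * (a x * b x).
Local Notation Q := modulus2.

Let mO : measurable (Omega : set (measurable_rV R m)). Proof. exact: open_measurable_rV. Qed.
Let Ooo : (vol Omega < +oo)%E. Proof. exact: lebesgue_rV_bounded_set. Qed.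
Let OclO : Omega `<=` closure Omega. Proof. exact: subset_closure. Qed.

Lemma Ck1_within (g : V -> R) : Ck 1 U g -> {within closure Omega, continuous g}.
Proof.
by move=> [cg _]; apply: continuous_in_subspaceT => x /set_mem/clU; exact: cg.
Qed.

Lemma Ck1_partial_within (g : V -> R) i : Ck 1 U g ->
  {within closure Omega, continuous (partial i g)}.
Proof.
move=> [_ /(_ i)[_ cg]]; apply: continuous_in_subspaceT => x /set_mem/clU; exact: cg.
Qed.

Lemma Ck1_bounds : exists2 B, 0 < B & forall x, closure Omega x ->
  [/\ `|a x| <= B, `|b x| <= B, forall i, `|partial i a x| <= B & forall i, `|partial i b x| <= B].
Proof.
have cK := compact_closure bO.
have [B1 B10 h1] := within_continuous_bounded cK (Ck1_within Ca).
have [B2 B20 h2] := within_continuous_bounded cK (Ck1_within Cb).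
have [B3 B30 h3] := big_bound (fun i => within_continuous_bounded cK (@Ck1_partial_within a i Ca)).
have [B4 B40 h4] := big_bound (fun i => within_continuous_bounded cK (@Ck1_partial_within b i Cb)).
exists (B1 + B2 + B3 + B4); first by rewrite !addr_gt0.
move=> x cx; split=> [||i|i].
- by have := h1 x cx; lra.
- by have := h2 x cx; lra.
- by have := h3 i x cx; lra.
- by have := h4 i x cx; lra.
Qed.

Lemma modulus2_within : {within closure Omega, continuous Q}.
Proof.
have [ca _] := Ca; have [cb _] := Cb.
apply: continuous_in_subspaceT => x /set_mem/clU Ux.
have cax := ca _ Ux; have cbx := cb _ Ux.
exact: (continuousD (continuousM cax cax) (continuousM cbx cbx)).
Qed.

Lemma modulus2_ge0 x : 0 <= Q x.
Proof. by rewrite addr_ge0 ?sqr_ge0. Qed.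

Lemma re2_le x : `|re2 x| <= Q x.
Proof.
rewrite ler_norml /re2 /modulus2; have := sqr_ge0 (a x); have := sqr_ge0 (b x); lra.
Qed.

Lemma im2_le x : `|im2 x| <= Q x.
Proof.
rewrite ler_norml /im2 /modulus2; have := sqr_ge0 (a x + b x); have := sqr_ge0 (a x - b x).
rewrite !expr2; nra.
Qed.

(** The derivative bound holds on the closure only and [Omega] need not be convex, so the increment
    is controlled just along segments that stay inside up to their endpoint. *)
Lemma Ck1_segment (g : V -> R) B i x t : Ck 1 U g ->
  (forall y, closure Omega y -> `|partial i g y| <= B) ->
  Omega x -> (forall s, 0 <= s < 1 -> Omega (x + s *: (t *: e i))) ->
  boundary Omega (x + t *: e i) -> `|g (x + t *: e i) - g x| <= B * `|t|.
Proof.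
move=> [_ /(_ i)[dg _]] gB Ox seg bp.
have seg' s : 0 <= s <= 1 -> closure Omega (x + (s * t) *: e i).
  move=> /andP[s0]; rewrite le_eqVlt => /predU1P[->|s1]; first by rewrite mul1r; case: bp.
  by apply: OclO; rewrite -scalerA; apply: seg; rewrite s0.
have [t0|t0|t0] := ltgtP t 0.
(* [mvt_line] asks for a nonnegative length, so for t < 0 the segment is run from the exit point
   back to [x]. *)
- set p := x + t *: e i.
  have xE : p + (- t) *: e i = x by rewrite scaleNr addrK.
  have pt s : 0 <= s <= - t -> closure Omega (p + s *: e i).
    move=> /andP[s0 st]; rewrite -addrA -scalerDl.
    have -> : t + s = (1 + s / t) * t by rewrite mulrDl mul1r divfK// lt_eqF.
    apply: seg'.
    have : s / t <= 0 by rewrite mulr_ge0_le0// invr_le0 ltW.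
    have : -1 <= s / t by rewrite ler_ndivlMr//; lra.
    by lra.
  have H := @mvt_line R _ g p (e i) (- t) B; rewrite xE in H.
  rewrite distrC (ltr0_norm t0); apply: H.
  - by rewrite oppr_ge0 ltW.
  - by move=> s /pt/clU; exact: dg.
  - by move=> s /pt; exact: gB.
- have pt s : 0 <= s <= t -> closure Omega (x + s *: e i).
    move=> /andP[s0 st]; have -> : s = s / t * t by rewrite divfK// gt_eqF.
    by apply: seg'; rewrite divr_ge0// ?(ltW t0)//= ler_pdivrMr// mul1r.
  rewrite (gtr0_norm t0); apply: mvt_line; first exact: ltW.
    by move=> s /pt/clU; exact: dg.
  by move=> s /pt; exact: gB.
- by rewrite t0 scale0r addr0 subrr !normr0 mulr0.
Qed.

Lemma modulus2_exit B i x t :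
  (forall y, closure Omega y -> `|partial i a y| <= B) ->
  (forall y, closure Omega y -> `|partial i b y| <= B) ->
  Omega x -> (forall s, 0 <= s < 1 -> Omega (x + s *: (t *: e i))) ->
  boundary Omega (x + t *: e i) -> Q x <= 2 * Q (x + t *: e i) + (4 * B ^+ 2) * t ^+ 2.
Proof.
move=> aB bB Ox seg bp.
have h (g : V -> R) : Ck 1 U g -> (forall y, closure Omega y -> `|partial i g y| <= B) ->
    g x ^+ 2 <= 2 * g (x + t *: e i) ^+ 2 + 2 * (B ^+ 2 * t ^+ 2).
  move=> Cg gB; have := Ck1_segment Cg gB Ox seg bp.
  move: (g x) (g _) => u v uv.
  have : (v - u) ^+ 2 <= B ^+ 2 * t ^+ 2.
    rewrite -(real_normK (num_real (v - u))) -(real_normK (num_real t)) -exprMn.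
    by apply: lerXn2r; rewrite ?nnegrE//; exact: le_trans uv.
  (* The square (2 v - u)^2 is exactly 2 v^2 + 2 (v - u)^2 - u^2. *)
  have := sqr_ge0 (2 * v - u); rewrite !expr2; nra.
have := h _ Ca aB; have := h _ Cb bB; rewrite /modulus2; lra.
Qed.

End squared_modulus.

(** * The conjugate phase of f^2 and its convolutions *)

Section phases.
Context (R : realType) (n : nat).
Local Notation m := (n + n)%N.
Local Notation V := 'rV[R]_m.
Local Notation vol := (@lebesgue_rV R m).
Local Notation dS := (hausdorff_measure (m := m) m.-1).
Local Notation e i := (delta_mx ord0 i : 'rV[R]_m).
Variables (Omega U : set V) (a b : V -> R).
Hypothesis oO : open Omega.
Hypothesis bO : bounded_set Omega.
Hypothesis clU : closure Omega `<=` U.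
Hypothesis Ca : Ck 1 U a.
Hypothesis Cb : Ck 1 U b.

Local Notation Q := (modulus2 a b).
Local Notation A1 := (re2 a b).
Local Notation A2 := (im2 a b).
Local Notation Ib := (\int[dS]_(x in boundary Omega) (Q x)%:E)%E.
Hypothesis Ioo : (Ib < +oo)%E.

Let mO : measurable (Omega : set (measurable_rV R m)). Proof. exact: open_measurable_rV. Qed.
Let Ooo : (vol Omega < +oo)%E. Proof. exact: lebesgue_rV_bounded_set. Qed.
Let OclO : Omega `<=` closure Omega. Proof. exact: subset_closure. Qed.
Let OU : Omega `<=` U. Proof. by move=> x /OclO/clU. Qed.

Lemma re2_is_derive x i : U x ->
  is_derive x (e i) A1 (2 * (a x * partial i a x - b x * partial i b x)).
Proof.
move=> Ux; have [_ /(_ i)[/(_ _ Ux)/derivableP da _]] := Ca.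
have [_ /(_ i)[/(_ _ Ux)/derivableP db _]] := Cb.
have -> : A1 = a ^+ 2 - b ^+ 2 by apply/funext => y; rewrite !fctE.
apply: (is_derive_eq (is_deriveB (is_deriveX 2 da) (is_deriveX 2 db))).
by rewrite /partial /GRing.scale/= !expr1; ring.
Qed.

Lemma im2_is_derive x i : U x ->
  is_derive x (e i) A2 (2 * (partial i a x * b x + a x * partial i b x)).
Proof.
move=> Ux; have [_ /(_ i)[/(_ _ Ux)/derivableP da _]] := Ca.
have [_ /(_ i)[/(_ _ Ux)/derivableP db _]] := Cb.
have -> : A2 = cst 2 * (a * b) by apply/funext => y; rewrite !fctE.
apply: (is_derive_eq (is_deriveM (is_derive_cst (2 : R) x (e i)) (is_deriveM da db))).
by rewrite /partial /GRing.scale/= ; ring.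
Qed.

Let Ck1_continuous (g : V -> R) x : Ck 1 U g -> U x -> {for x, continuous g}.
Proof. by move=> [cg _]; exact: cg. Qed.

Lemma re2_continuous x : U x -> {for x, continuous A1}.
Proof.
move=> Ux; have ca := Ck1_continuous Ca Ux; have cb := Ck1_continuous Cb Ux.
exact: (continuousB (continuousM ca ca) (continuousM cb cb)).
Qed.

Lemma im2_continuous x : U x -> {for x, continuous A2}.
Proof.
move=> Ux; have ca := Ck1_continuous Ca Ux; have cb := Ck1_continuous Cb Ux.
exact: (continuousM (@cst_continuous _ _ (2 : R) x) (continuousM ca cb)).
Qed.

Lemma modulus2_continuous x : U x -> {for x, continuous Q}.
Proof.
move=> Ux; have ca := Ck1_continuous Ca Ux; have cb := Ck1_continuous Cb Ux.
exact: (continuousD (continuousM ca ca) (continuousM cb cb)).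
Qed.

Lemma measurable_of_continuous (g : V -> R) : (forall x, U x -> {for x, continuous g}) ->
  measurable_fun (Omega : set (measurable_rV R m)) g.
Proof.
move=> cg; apply: within_continuous_measurable_rV => //.
by apply: continuous_in_subspaceT => x /set_mem/OU; exact: cg.
Qed.

(** Here g = Re (f^2 (P - i S)), so |g| <= 2 A |f|^2 and [gauss_inequality] applies with M = 2 A.
    The bound [C] only enters the constant [L] that dominates the derivative. *)
Lemma gauss_conv i (P S P' S' : V -> R) (A C : R) :
  0 <= A -> continuous P -> continuous S ->
  (forall x, is_derive x (e i) P (P' x)) -> (forall x, is_derive x (e i) S (S' x)) ->
  (forall x, `|P x| <= A) -> (forall x, `|S x| <= A) ->
  (forall x, `|P' x| <= C) -> (forall x, `|S' x| <= C) ->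
  let g x := A1 x * P x + A2 x * S x in
  let dg x := 2 * (a x * partial i a x - b x * partial i b x) * P x + A1 x * P' x +
   (2 * (partial i a x * b x + a x * partial i b x) * S x + A2 x * S' x) in
  vol.-integrable Omega (EFin \o dg) /\
  `|\int[vol]_(x in Omega) dg x| <= 8 * tube_const R m * (2 * A) * fine Ib.
Proof.
move=> A0 cP cS dP dS' PA SA PC SC g dg.
have [B B0 hB] := Ck1_bounds bO clU Ca Cb.
have dgE x : Omega x -> is_derive x (e i) g (dg x).
  move=> /OU Ux.
  have -> : g = A1 * P + A2 * S by apply/funext => y; rewrite !fctE.
  apply: (is_derive_eq (is_deriveD (is_deriveM (re2_is_derive i Ux) (dP x)) (is_deriveM (im2_is_derive i Ux) (dS' x)))).
  by rewrite /dg /GRing.scale/=; ring.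
have mg : measurable_fun (Omega : set (measurable_rV R m)) g.
  apply: measurable_of_continuous => x Ux.
  exact: (continuousD (continuousM (re2_continuous Ux) (cP x)) (continuousM (im2_continuous Ux) (cS x))).
pose L := 2 * (B * B + B * B) * A + (B * B + B * B) * C + (2 * (B * B + B * B) * A + 2 * (B * B) * C).
have dgL x : Omega x -> `|dg x| <= L.
  move=> /OclO cx; have [ha hb hda hdb] := hB _ cx.
  have hda' := hda i; have hdb' := hdb i.
  have mul (u v r s : R) : `|u| <= r -> `|v| <= s -> `|u * v| <= r * s.
    by move=> *; rewrite normrM; apply: ler_pM.
  have sub (u v r s : R) : `|u| <= r -> `|v| <= s -> `|u - v| <= r + s.
    by move=> *; apply: (le_trans (ler_normB _ _)); exact: lerD.
  have add (u v r s : R) : `|u| <= r -> `|v| <= s -> `|u + v| <= r + s.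
    by move=> *; apply: (le_trans (ler_normD _ _)); exact: lerD.
  have two : `|2 : R| <= 2 by rewrite ger0_norm.
  rewrite /dg /L; apply: (add); apply: (add); apply: (mul) => //.
  - by apply: (mul _ _ _ _ two); apply: sub; [apply: (mul _ _ _ _ ha hda')|apply: (mul _ _ _ _ hb hdb')].
  - by rewrite /re2 !expr2; apply: sub; [apply: (mul _ _ _ _ ha ha)|apply: (mul _ _ _ _ hb hb)].
  - by apply: (mul _ _ _ _ two); apply: add; [apply: (mul _ _ _ _ hda' hb)|apply: (mul _ _ _ _ ha hdb')].
  - by rewrite /im2; apply: (mul _ _ _ _ two); apply: (mul _ _ _ _ ha hb).
have DE x : Omega x -> 'D_(e i) g x = dg x by move=> /dgE h; rewrite derive_val.
have mD := measurable_derive oO mg (fun x Ox => @ex_derive _ _ _ _ _ _ _ (dgE x Ox)).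
have mdg : measurable_fun (Omega : set (measurable_rV R m)) dg.
  by apply: eq_measurable_fun mD => x /set_mem; exact: DE.
split; first exact: (bounded_integrable mO Ooo mdg dgL).
have -> : \int[vol]_(x in Omega) dg x = \int[vol]_(x in Omega) 'D_(e i) g x.
  by apply: eq_Rintegral => x /set_mem Ox; rewrite DE.
apply: (@gauss_inequality R m i Omega Q (4 * B ^+ 2) oO bO (modulus2_within clU Ca Cb) _ _ _ Ioo g L (2 * A)) => //.
- by move=> x _; exact: modulus2_ge0.
- by rewrite mulr_ge0// sqr_ge0.
- move=> x t; apply: (modulus2_exit clU Ca Cb) => y cy.
    by have [_ _ h _] := hB _ cy; exact: h.
  by have [_ _ _ h] := hB _ cy; exact: h.
- by move=> x Ox; have [] := dgE x Ox.
- by move=> x Ox; rewrite DE//; exact: dgL.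
- by rewrite mulr_ge0.
- move=> x Ox; apply: (le_trans (ler_normD _ _)).
  rewrite (normrM (A1 x)) (normrM (A2 x)) (_ : 2 * A * Q x = Q x * A + Q x * A); last by ring.
  have h1 : `|A1 x| * `|P x| <= Q x * A by apply: ler_pM => //; exact: re2_le.
  have h2 : `|A2 x| * `|S x| <= Q x * A by apply: ler_pM => //; exact: im2_le.
  exact: lerD.
Qed.

(* [phase1 + i phase2] is conj(f^2) / |f|^2, with value 0 where f vanishes. *)
Definition phase1 (x : V) : R := A1 x / Q x.
Definition phase2 (x : V) : R := - A2 x / Q x.

Lemma measurable_modulus2V : measurable_fun (Omega : set (measurable_rV R m)) (fun x => (Q x)^-1).
Proof.
(* Where f vanishes the inverse is not continuous. The real power of exponent -1 agrees with it
   there too, both being 0, and is Borel. *)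
rewrite (_ : (fun _ => _) = (fun x => Q x `^ (-1))); last first.
  by apply/funext => x; rewrite powR_inv1// modulus2_ge0.
have mQ := measurable_of_continuous modulus2_continuous.
exact: (measurableT_comp (@measurable_powR R (-1)) mQ).
Qed.

Lemma measurable_phase1 : measurable_fun (Omega : set (measurable_rV R m)) phase1.
Proof.
apply: measurable_funM; last exact: measurable_modulus2V.
exact: measurable_of_continuous re2_continuous.
Qed.

Lemma measurable_phase2 : measurable_fun (Omega : set (measurable_rV R m)) phase2.
Proof.
apply: measurable_funM; last exact: measurable_modulus2V.
by apply: measurableT_comp => //; exact: measurable_of_continuous im2_continuous.
Qed.

Lemma phase1_le x : `|phase1 x| <= 1.
Proof.
rewrite normrM normfV (ger0_norm (modulus2_ge0 a b x)).
have [->|q0] := eqVneq (Q x) 0; first by rewrite invr0 mulr0.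
by rewrite ler_pdivrMr ?mul1r ?re2_le// lt_neqAle eq_sym q0 modulus2_ge0.
Qed.

Lemma phase2_le x : `|phase2 x| <= 1.
Proof.
rewrite normrM normrN normfV (ger0_norm (modulus2_ge0 a b x)).
have [->|q0] := eqVneq (Q x) 0; first by rewrite invr0 mulr0.
by rewrite ler_pdivrMr ?mul1r ?im2_le// lt_neqAle eq_sym q0 modulus2_ge0.
Qed.

Lemma re2_im2 x : A1 x ^+ 2 + A2 x ^+ 2 = Q x ^+ 2.
Proof. by rewrite /re2 /im2 /modulus2; ring. Qed.

(* Re (f^2 * (conj(f^2)/|f|^2 convolved with the Poisson kernel)), whose
   liminf is at least [poisson_const / 2 * |f|^2]. *)
Definition smoothed K (x : V) : R :=
  A1 x * poisson_conv Omega K phase1 x - A2 x * poisson_conv Omega K phase2 x.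

(** The kernel estimate bounds [smoothed] from below only. Its minimum with the expected value is
    squeezed to a genuine limit, as dominated convergence requires. *)
Lemma smoothed_cvg x : Omega x ->
  Num.min (smoothed K x) (poisson_const R n / 2 * Q x) @[K --> \oo] -->
  poisson_const R n / 2 * Q x.
Proof.
move=> Ox; have q0 := modulus2_ge0 a b x; have := re2_im2 x.
have [qz|qn] := eqVneq (Q x) 0.
  have := re2_le a b x; have := im2_le a b x; rewrite qz !normr_le0 => /eqP z2 /eqP z1 _.
  rewrite /smoothed z1 z2 mulr0 (_ : (fun _ => _) = cst 0); first exact: cvg_cst.
  by apply/funext => K; rewrite !mul0r subr0 minxx.
have qpos : 0 < Q x by rewrite lt_neqAle eq_sym qn.
have Ux := OU Ox.
(* [h y] is the real part of f(x)^2 conj(f(y)^2) / |f(y)|^2, with [x] frozen. It is continuous at y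
   = x, where f does not vanish, and has the value |f(x)|^2 there; hence it is at least half of that
   nearby. *)
pose h (y : V) := A1 x * phase1 y - A2 x * phase2 y.
move=> q2.
have hx : h x = Q x.
  rewrite /h /phase1 /phase2; move: (A1 x) (A2 x) (Q x) q2 qn => u v w uvw w0.
  have -> : u * (u / w) - v * (- v / w) = (u ^+ 2 + v ^+ 2) / w by field.
  by rewrite uvw expr2 mulfK.
have hcont : {for x, continuous h}.
  have cQV : {for x, continuous (fun y => (Q y)^-1)} by apply: continuousV => //; exact: modulus2_continuous.
  have c1 : {for x, continuous phase1} by exact: (continuousM (re2_continuous Ux) cQV).
  have c2 : {for x, continuous phase2}.
    exact: (continuousM (continuousN (im2_continuous Ux)) cQV).
  exact: (continuousB (continuousM (@cst_continuous _ _ (A1 x) x) c1) (continuousM (@cst_continuous _ _ (A2 x) x) c2)).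
have q2pos : 0 < Q x / 2 by rewrite divr_gt0.
have [r [r0 rO rh]] : exists r : R, [/\ 0 < r, forall y, `|x - y| < r -> Omega y &
    forall y, `|x - y| < r -> Q x / 2 <= h y].
  have nO : nbhs x Omega by move: oO; rewrite openE; exact.
  have nh : nbhs x [set y | Q x / 2 < h y].
    have : nbhs (h x) [set s | Q x / 2 < s].
      apply: open_nbhs_nbhs; split; first exact: open_gt.
      by rewrite /= hx; lra.
    exact: hcont.
  have nn : nbhs x (Omega `&` [set y | Q x / 2 < h y]) by exact: filterI.
  move/nbhs_ballP : nn => [r /= r0]; rewrite -ball_normE => hr.
  exists r; split => // y xy; first by have [] := hr y xy.
  by have [_ /ltW] := hr y xy.
have mh : measurable_fun (Omega : set (measurable_rV R m)) h.
  apply: measurable_funB; apply: measurable_funM => //.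
    exact: measurable_phase1.
  exact: measurable_phase2.
have h2 y : Omega y -> `|h y| <= 2 * Q x.
  move=> _; apply: (le_trans (ler_normB _ _)); rewrite (normrM (A1 x)) (normrM (A2 x)).
  have := re2_le a b x; have := im2_le a b x; have := phase1_le y; have := phase2_le y.
  move: (normr_ge0 (A1 x)) (normr_ge0 (A2 x)) (normr_ge0 (phase1 y)) (normr_ge0 (phase2 y)).
  move: `|A1 x| `|A2 x| `|phase1 y| `|phase2 y| => u v w z u0 v0 w0 z0 z1 w1 vq uq.
  have : u * w <= u by rewrite ler_piMr.
  have : v * z <= v by rewrite ler_piMr.
  lra.
pose C := 2 * Q x * (2 * n)%:R * r ^- m.+2 * fine (vol Omega).
have smE K : smoothed K x = \int[vol]_(y in Omega) (h y * poisson_ker (2 ^- K) (x - y : V)).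
  have e0 : 0 < 2 ^- K :> R by rewrite invr_gt0 exprn_gt0.
  have radB y : `|@poisson_ker R n (2 ^- K) y| <= (2 * n)%:R * (2 ^- K) ^+ 2 * (2 ^- K) ^- m.+2.
    rewrite ger0_norm ?poisson_ker_ge0//; apply: (le_trans (poisson_ker_le _ e0)).
    by apply: ler_wpM2l; [rewrite mulr_ge0// sqr_ge0|exact: radXV_le].
  have i1 := integrable_conv_on mO Ooo (poisson_ker_continuous e0) radB x measurable_phase1 (fun y _ => phase1_le y).
  have i2 := integrable_conv_on mO Ooo (poisson_ker_continuous e0) radB x measurable_phase2 (fun y _ => phase2_le y).
  rewrite /smoothed /poisson_conv /conv_on -!RintegralZl// -RintegralB//; last 2 first.
  - exact: (integrableZl mO (A1 x) i1).
  - exact: (integrableZl mO (A2 x) i2).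
  by apply: eq_Rintegral => y _; rewrite /h; ring.
have tcvg : (fun K => 2 ^- K : R) @ \oo --> 0.
  rewrite (_ : (fun K => _) = (fun K => (2^-1 : R) ^+ K)); last by apply/funext => K; rewrite exprVn.
  apply: cvg_expr; rewrite ger0_norm ?invr_ge0//; lra.
apply: (@squeeze_cvgr _ _ _ _ (fun K => poisson_const R n / 2 * Q x - C * (2 ^- K) ^+ 2)
  (fun=> poisson_const R n / 2 * Q x)).
- have : \forall K \near \oo, 2 ^- K < r by exact: (cvgr_lt 0).
  apply: filterS => K Kr; rewrite ge_min lexx orbT andbT le_min.
  rewrite smE; apply/andP; split; last first.
    rewrite gerBl; apply: mulr_ge0; last exact: sqr_ge0.
    rewrite /C; apply: mulr_ge0; last exact: fine_ge0.
    apply: mulr_ge0; last by rewrite invr_ge0 exprn_ge0// ltW.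
    by rewrite mulr_ge0// mulr_ge0.
  have := conv_poisson_ge mO Ooo mh q0 r0 Kr rO h2 rh.
  by rewrite /C; apply: le_trans; rewrite le_eqVlt; apply/orP; left; apply/eqP; ring.
- rewrite -[X in _ --> X]subr0 -[X in _ - X](mulr0 C).
  apply: cvgB; first exact: cvg_cst.
  apply: cvgMl_tmp; rewrite -[X in _ --> X](mulr0 0); exact: (cvgM tcvg tcvg).
- exact: cvg_cst.
Qed.

End phases.

Lemma newton_dconvC (R : realType) (n K : nat) D (i j : 'I_(n + n)) (c : 'rV[R]_(n + n) -> R) z :
  newton_dconv D K i (delta_mx ord0 j) c z = newton_dconv D K j (delta_mx ord0 i) c z.
Proof. by apply: eq_Rintegral => x _; rewrite newton_dkerC. Qed.

(** * The inequality without weight *)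

Section poincare.
Context (R : realType) (n : nat).
Hypothesis n0 : (0 < n)%N.
Local Notation m := (n + n)%N.
Local Notation V := 'rV[R]_m.
Local Notation vol := (@lebesgue_rV R m).
Local Notation dS := (hausdorff_measure (m := m) m.-1).
Local Notation e i := (delta_mx ord0 i : 'rV[R]_m).
Variables (Omega U : set V) (a b : V -> R).
Hypothesis oO : open Omega.
Hypothesis bO : bounded_set Omega.
Hypothesis clU : closure Omega `<=` U.
Hypothesis Ca : Ck 1 U a.
Hypothesis Cb : Ck 1 U b.

Local Notation Q := (modulus2 a b).
Local Notation A1 := (re2 a b).
Local Notation A2 := (im2 a b).
Local Notation ph1 := (phase1 a b).
Local Notation ph2 := (phase2 a b).
Local Notation Ib := (\int[dS]_(x in boundary Omega) (Q x)%:E)%E.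
Hypothesis Ioo : (Ib < +oo)%E.

(* 2 df/dconj(z_j) = [cr_re j] + i [cr_im j]. *)
Definition cr_re (j : 'I_n) (x : V) : R := partial (lshift n j) a x - partial (rshift n j) b x.
Definition cr_im (j : 'I_n) (x : V) : R := partial (lshift n j) b x + partial (rshift n j) a x.
Definition cr2 (x : V) : R := \sum_(j < n) (cr_re j x ^+ 2 + cr_im j x ^+ 2) / 4.

Let mO : measurable (Omega : set (measurable_rV R m)). Proof. exact: open_measurable_rV. Qed.
Let Ooo : (vol Omega < +oo)%E. Proof. exact: lebesgue_rV_bounded_set. Qed.
Let OclO : Omega `<=` closure Omega. Proof. exact: subset_closure. Qed.
Let OU : Omega `<=` U. Proof. by move=> x /OclO/clU. Qed.
Let vD := fine (vol Omega).
Let A := vD + 4 ^+ m.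
Let c0 := poisson_const R n.
Let c0_gt0 : 0 < c0. Proof. exact: poisson_const_gt0. Qed.
Let A0 : 0 < A. Proof. by rewrite /A ltr_wpDl ?fine_ge0 ?exprn_gt0. Qed.

Let mph1 := measurable_phase1 oO clU Ca Cb.
Let mph2 := measurable_phase2 oO clU Ca Cb.

Lemma integrable_modulus2 : vol.-integrable Omega (EFin \o Q).
Proof.
have [B B0 hB] := within_continuous_bounded (compact_closure bO) (modulus2_within clU Ca Cb).
apply: (bounded_integrable (B := B) mO Ooo); last by move=> x /OclO; exact: hB.
exact: (measurable_of_continuous oO clU (modulus2_continuous Ca Cb)).
Qed.

Lemma integrable_cr2 : vol.-integrable Omega (EFin \o cr2).
Proof.
have [B B0 hB] := Ck1_bounds bO clU Ca Cb.
have mpart g i : Ck 1 U g -> measurable_fun (Omega : set (measurable_rV R m)) (partial i g).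
  by move=> [_ /(_ i)[_ cg]]; exact: (measurable_of_continuous oO clU cg).
apply: integrable_Rsum => // j.
apply: (bounded_integrable (B := ((B + B) ^+ 2 + (B + B) ^+ 2) / 4) mO Ooo).
  apply: measurable_funM => //; apply: measurable_funD; apply: measurable_funX.
    by apply: measurable_funB; exact: mpart.
  by apply: measurable_funD; exact: mpart.
move=> x /OclO cx; have [_ _ ha hb] := hB _ cx.
rewrite ger0_norm ?divr_ge0 ?addr_ge0 ?sqr_ge0// ler_pM2r ?invr_gt0//.
have sq (u : R) : `|u| <= B + B -> u ^+ 2 <= (B + B) ^+ 2.
  by move=> h; rewrite -(real_normK (num_real u)); apply: lerXn2r; rewrite ?nnegrE// addr_ge0// ltW.
apply: lerD; apply: sq.
  by apply: (le_trans (ler_normB _ _)); exact: lerD.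
by apply: (le_trans (ler_normD _ _)); exact: lerD.
Qed.

Section fixed_scale.
Variable K : nat.
Local Notation Phi := (newton_conv Omega K).
Local Notation dPhi i l := (newton_dconv Omega K i (e l)).

(* [fieldp j + i fieldq j] is W_j, the convolution of conj(f^2)/|f|^2 with
   conj(z_j) / (|z|^2 + eps^2)^n. *)
Definition fieldp (j : 'I_n) (x : V) : R := Phi (lshift n j) ph1 x + Phi (rshift n j) ph2 x.
Definition fieldq (j : 'I_n) (x : V) : R := Phi (lshift n j) ph2 x - Phi (rshift n j) ph1 x.
Definition dfieldp (j : 'I_n) l (x : V) : R :=
  dPhi (lshift n j) l ph1 x + dPhi (rshift n j) l ph2 x.
Definition dfieldq (j : 'I_n) l (x : V) : R :=
  dPhi (lshift n j) l ph2 x - dPhi (rshift n j) l ph1 x.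

Let dPhi1 i v x := newton_conv_is_derive n0 mO Ooo K mph1 (fun x _ => phase1_le a b x) i v x.
Let dPhi2 i v x := newton_conv_is_derive n0 mO Ooo K mph2 (fun x _ => phase2_le a b x) i v x.

Lemma fieldp_is_derive j l x : is_derive x (e l) (fieldp j) (dfieldp j l x).
Proof. exact: (is_deriveD (dPhi1 _ _ _) (dPhi2 _ _ _)). Qed.

Lemma fieldq_is_derive j l x : is_derive x (e l) (fieldq j) (dfieldq j l x).
Proof. exact: (is_deriveB (dPhi2 _ _ _) (dPhi1 _ _ _)). Qed.

Lemma fieldp_continuous j : continuous (fieldp j).
Proof.
move=> x; apply: continuousD; apply: newton_conv_continuous => //.
- by move=> y _; exact: phase1_le.
- by move=> y _; exact: phase2_le.
Qed.

Lemma fieldq_continuous j : continuous (fieldq j).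
Proof.
move=> x; apply: continuousB; apply: newton_conv_continuous => //.
- by move=> y _; exact: phase2_le.
- by move=> y _; exact: phase1_le.
Qed.

Lemma fieldp_le j x : `|fieldp j x| <= 2 * A.
Proof.
rewrite mulr_natl mulr2n; apply: (le_trans (ler_normD _ _)); apply: lerD; apply: newton_conv_le => //.
- by move=> y _; exact: phase1_le.
- by move=> y _; exact: phase2_le.
Qed.

Lemma fieldq_le j x : `|fieldq j x| <= 2 * A.
Proof.
rewrite mulr_natl mulr2n; apply: (le_trans (ler_normB _ _)); apply: lerD; apply: newton_conv_le => //.
- by move=> y _; exact: phase2_le.
- by move=> y _; exact: phase1_le.
Qed.

Let dB (l : 'I_m) := (1 + (2 * n * m)%:R) / (2 ^- K) ^+ (2 * n) * `|e l| * vD.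

Lemma dfieldp_le j l x : `|dfieldp j l x| <= 2 * dB l.
Proof.
rewrite mulr_natl mulr2n; apply: (le_trans (ler_normD _ _)); apply: lerD; apply: newton_dconv_le => //.
- by move=> y _; exact: phase1_le.
- by move=> y _; exact: phase2_le.
Qed.

Lemma dfieldq_le j l x : `|dfieldq j l x| <= 2 * dB l.
Proof.
rewrite mulr_natl mulr2n; apply: (le_trans (ler_normB _ _)); apply: lerD; apply: newton_dconv_le => //.
- by move=> y _; exact: phase2_le.
- by move=> y _; exact: phase1_le.
Qed.

(* [div1 j + div2 j] is 2 Re d(f^2 W_j)/dconj(z_j); each term is a partial
   derivative to which the Gauss inequality applies. *)
Definition div1 (j : 'I_n) (x : V) : R := let i := lshift n j in
  2 * (a x * partial i a x - b x * partial i b x) * fieldp j x + A1 x * dfieldp j i x +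
  (2 * (partial i a x * b x + a x * partial i b x) * (- fieldq j x) + A2 x * (- dfieldq j i x)).
Definition div2 (j : 'I_n) (x : V) : R := let i := rshift n j in
  2 * (a x * partial i a x - b x * partial i b x) * (- fieldq j x) + A1 x * (- dfieldq j i x) +
  (2 * (partial i a x * b x + a x * partial i b x) * (- fieldp j x) + A2 x * (- dfieldp j i x)).

Lemma div1_gauss j : vol.-integrable Omega (EFin \o div1 j) /\
  `|\int[vol]_(x in Omega) div1 j x| <= 8 * tube_const R m * (2 * (2 * A)) * fine Ib.
Proof.
apply: (@gauss_conv R n Omega U a b oO bO clU Ca Cb Ioo (lshift n j) (fieldp j) (fun x => - fieldq j x)
  (dfieldp j (lshift n j)) (fun x => - dfieldq j (lshift n j) x) (2 * A) (2 * dB (lshift n j))).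
- by rewrite mulr_ge0// ltW.
- exact: fieldp_continuous.
- by move=> x; apply: continuousN; exact: fieldq_continuous.
- by move=> x; exact: fieldp_is_derive.
- by move=> x; apply: is_deriveN; exact: fieldq_is_derive.
- exact: fieldp_le.
- by move=> x; rewrite normrN; exact: fieldq_le.
- by move=> x; exact: dfieldp_le.
- by move=> x; rewrite normrN; exact: dfieldq_le.
Qed.

Lemma div2_gauss j : vol.-integrable Omega (EFin \o div2 j) /\
  `|\int[vol]_(x in Omega) div2 j x| <= 8 * tube_const R m * (2 * (2 * A)) * fine Ib.
Proof.
apply: (@gauss_conv R n Omega U a b oO bO clU Ca Cb Ioo (rshift n j) (fun x => - fieldq j x) (fun x => - fieldp j x)
  (fun x => - dfieldq j (rshift n j) x) (fun x => - dfieldp j (rshift n j) x) (2 * A) (2 * dB (rshift n j))).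
- by rewrite mulr_ge0// ltW.
- by move=> x; apply: continuousN; exact: fieldq_continuous.
- by move=> x; apply: continuousN; exact: fieldp_continuous.
- by move=> x; apply: is_deriveN; exact: fieldq_is_derive.
- by move=> x; apply: is_deriveN; exact: fieldp_is_derive.
- by move=> x; rewrite normrN; exact: fieldq_le.
- by move=> x; rewrite normrN; exact: fieldp_le.
- by move=> x; rewrite normrN; exact: dfieldq_le.
- by move=> x; rewrite normrN; exact: dfieldp_le.
Qed.

(** The right-hand side is the sum over j of 2 Re (f^2 dW_j/dconj(z_j)). By symmetry of the
    derivatives of the kernel, each phase meets only the pure derivatives, whose sum is the Poisson
    kernel. *)
Lemma smoothedE x : smoothed Omega a b K x =
  \sum_(j < n) (A1 x * (dfieldp j (lshift n j) x - dfieldq j (rshift n j) x) -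
                A2 x * (dfieldq j (lshift n j) x + dfieldp j (rshift n j) x)).
Proof.
rewrite /smoothed -(poisson_convE mO Ooo K mph1 (fun x _ => phase1_le a b x)).
rewrite -(poisson_convE mO Ooo K mph2 (fun x _ => phase2_le a b x)).
rewrite !big_split_ord/= -!big_split/= !mulr_sumr -sumrB; apply: eq_bigr => j _.
rewrite /dfieldp /dfieldq (newton_dconvC _ _ (rshift n j) (lshift n j)).
rewrite [newton_dconv _ _ (rshift n j) (e (lshift n j)) ph1 x]newton_dconvC.
move: (A1 x) (A2 x) => s t.
move: (newton_dconv _ _ _ _ ph1 x) (newton_dconv _ _ _ _ ph1 x) => p q.
move: (newton_dconv _ _ _ _ ph2 x) (newton_dconv _ _ _ _ ph2 x) => p' q'.
move: (newton_dconv _ _ _ _ ph1 x) (newton_dconv _ _ _ _ ph2 x) => p'' q''; ring.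
Qed.

(** Chosen so that the n summands 2 mu Q of [div_ge] add up to c0 / 4 * Q, half of what [smoothed]
    yields in the limit. *)
Let mu := c0 / (8 * n%:R).
Let mu0 : 0 < mu. Proof. by rewrite divr_gt0// mulr_gt0// ltr0n. Qed.

(** Expands (mu |u| - 2 A |v|)^2 / mu >= 0. *)
Lemma young (u v w p : R) : `|p| <= 2 * A ->
  2 * `|u * v * p| <= mu * u ^+ 2 + 4 * A ^+ 2 / mu * v ^+ 2.
Proof.
move=> pA; rewrite !normrM.
apply: (@le_trans _ _ (4 * A * `|u| * `|v|)).
  have : `|u| * `|v| * `|p| <= `|u| * `|v| * (2 * A) by apply: ler_wpM2l => //; rewrite mulr_ge0.
  lra.
rewrite -(real_normK (num_real u)) -(real_normK (num_real v)).
move: `|u| `|v| => s t; have : 0 <= (mu * s - 2 * A * t) ^+ 2 / mu by rewrite divr_ge0 ?sqr_ge0// ltW.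
rewrite (_ : (_ ^+ 2) / mu = mu * s ^+ 2 + 4 * A ^+ 2 / mu * t ^+ 2 - 4 * A * s * t); first lra.
by field; rewrite gt_eqF.
Qed.

(** [young] is used four times for each j, and each of a^2, b^2, [cr_re]^2 and [cr_im]^2 occurs
    twice. This gives 2 mu Q and the coefficient 8 A^2 / mu = 64 n A^2 / c0; the division by 4 in
    [cr2] turns 64 into 256. *)
Lemma div_ge x :
  smoothed Omega a b K x - c0 / 4 * Q x - 256 * n%:R * A ^+ 2 / c0 * cr2 x <=
  \sum_(j < n) (div1 j x + div2 j x).
Proof.
rewrite smoothedE /cr2 mulr_sumr.
have -> : c0 / 4 * Q x = \sum_(j < n) 2 * mu * Q x.
  rewrite sumr_const card_ord -mulr_natr /mu; field.
  by rewrite pnatr_eq0 -lt0n.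
rewrite -!sumrB; apply: ler_sum => j _.
have -> : 256 * n%:R * A ^+ 2 / c0 * ((cr_re j x ^+ 2 + cr_im j x ^+ 2) / 4) =
    8 * A ^+ 2 / mu * (cr_re j x ^+ 2 + cr_im j x ^+ 2).
  rewrite /mu; field.
  by rewrite pnatr_eq0 -lt0n n0 gt_eqF.
have y1 := @young (a x) (cr_re j x) 0 (fieldp j x) (fieldp_le j x).
have y2 := @young (b x) (cr_im j x) 0 (fieldp j x) (fieldp_le j x).
have y3 := @young (b x) (cr_re j x) 0 (fieldq j x) (fieldq_le j x).
have y4 := @young (a x) (cr_im j x) 0 (fieldq j x) (fieldq_le j x).
(* Product rule: the derivatives of f^2 gather into the Cauchy-Riemann combinations, and the last
   line is 2 Re (f (cr_re + i cr_im) (fieldp + i fieldq)). *)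
have E : div1 j x + div2 j x =
  A1 x * (dfieldp j (lshift n j) x - dfieldq j (rshift n j) x) -
  A2 x * (dfieldq j (lshift n j) x + dfieldp j (rshift n j) x) +
  2 * (a x * cr_re j x * fieldp j x - b x * cr_im j x * fieldp j x -
       b x * cr_re j x * fieldq j x - a x * cr_im j x * fieldq j x).
  rewrite /div1 /div2 /cr_re /cr_im.
  move: (partial _ a x) (partial _ a x) (partial _ b x) (partial _ b x) => a1 a2 b1 b2.
  move: (fieldp j x) (fieldq j x) (dfieldp _ _ x) (dfieldp _ _ x) (dfieldq _ _ x) (dfieldq _ _ x).
  move: (A1 x) (A2 x) (a x) (b x) => s t u v p q p1 p2 q1 q2; ring.
rewrite E -!addrA lerD2l /modulus2.
have n1 := ler_norm (- (a x * cr_re j x * fieldp j x)).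
have n2 := ler_norm (b x * cr_im j x * fieldp j x).
have n3 := ler_norm (b x * cr_re j x * fieldq j x).
have n4 := ler_norm (a x * cr_im j x * fieldq j x).
rewrite normrN in n1.
rewrite (_ : 8 * A ^+ 2 / mu = 2 * (4 * A ^+ 2 / mu)); last by ring.
move: (4 * A ^+ 2 / mu) y1 y2 y3 y4 n1 n2 n3 n4 => k.
move: (a x * cr_re j x * fieldp j x) (b x * cr_im j x * fieldp j x) => u1 u2.
move: (b x * cr_re j x * fieldq j x) (a x * cr_im j x * fieldq j x) => u3 u4.
move: (A2 x * _) (a x ^+ 2) (b x ^+ 2) (cr_re j x ^+ 2) (cr_im j x ^+ 2) => s q1 q2 q3 q4.
move=> y1 y2 y3 y4 n1 n2 n3 n4; lra.
Qed.

(** Read as the derivative of the continuous function [newton_conv], a limit of difference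
    quotients; the measurability of [poisson_conv] in the variable outside the integral then follows
    from [poisson_convE]. *)
Lemma measurable_newton_dconv i l (c : V -> R) :
  measurable_fun (Omega : set (measurable_rV R m)) c -> (forall x, `|c x| <= 1) ->
  measurable_fun (Omega : set (measurable_rV R m)) (newton_dconv Omega K i (e l) c).
Proof.
move=> mc c1.
have dc x := newton_conv_is_derive n0 mO Ooo K mc (fun x _ => c1 x) i (e l) x.
have mPhi : measurable_fun (Omega : set (measurable_rV R m)) (Phi i c).
  by apply: continuous_measurable_rV; exact: newton_conv_continuous.
have := @measurable_derive R m l Omega (Phi i c) oO mPhi (fun x _ => @ex_derive _ _ _ _ _ _ _ (dc x)).
by apply: eq_measurable_fun => x _; have dcx := dc x; rewrite derive_val.
Qed.

Lemma measurable_smoothed :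
  measurable_fun (Omega : set (measurable_rV R m)) (smoothed Omega a b K).
Proof.
have m1 i l := measurable_newton_dconv i l mph1 (phase1_le a b).
have m2 i l := measurable_newton_dconv i l mph2 (phase2_le a b).
have mp (c : V -> R) : (forall i l, measurable_fun (Omega : set (measurable_rV R m)) (newton_dconv Omega K i (e l) c)) ->
    measurable_fun (Omega : set (measurable_rV R m)) c -> (forall x, `|c x| <= 1) ->
    measurable_fun (Omega : set (measurable_rV R m)) (poisson_conv Omega K c).
  move=> md mc c1.
  rewrite (_ : poisson_conv Omega K c = fun x => \sum_i newton_dconv Omega K i (e i) c x).
    by apply: measurable_sum => i; exact: md.
  by apply/funext => x; rewrite (poisson_convE mO Ooo K mc (fun x _ => c1 x)).
apply: measurable_funB; apply: measurable_funM.
- exact: (measurable_of_continuous oO clU (re2_continuous Ca Cb)).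
- by apply: mp => //; exact: phase1_le.
- exact: (measurable_of_continuous oO clU (im2_continuous Ca Cb)).
- by apply: mp => //; exact: phase2_le.
Qed.

Lemma integrable_smoothed : vol.-integrable Omega (EFin \o smoothed Omega a b K).
Proof.
have [B B0 hB] := within_continuous_bounded (compact_closure bO) (modulus2_within clU Ca Cb).
apply: (bounded_integrable (B := B * (2 * ((2 * n)%:R * (vD + 4 ^+ m.+1)))) mO Ooo).
  exact: measurable_smoothed.
move=> x /OclO cx; have QB : Q x <= B by apply: le_trans (hB _ cx); exact: ler_norm.
have p1 := poisson_conv_le mO Ooo K mph1 (fun x _ => phase1_le a b x) x.
have p2 := poisson_conv_le mO Ooo K mph2 (fun x _ => phase2_le a b x) x.
have a1 := le_trans (re2_le a b x) QB; have a2 := le_trans (im2_le a b x) QB.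
rewrite mulr_natl mulr2n mulrDr; apply: (le_trans (ler_normB _ _)).
by rewrite (normrM (A1 x)) (normrM (A2 x)); apply: lerD; apply: ler_pM.
Qed.

Lemma integral_smoothed_le :
  \int[vol]_(x in Omega) smoothed Omega a b K x <=
  64 * n%:R * tube_const R m * A * fine Ib + c0 / 4 * \int[vol]_(x in Omega) Q x +
  256 * n%:R * A ^+ 2 / c0 * \int[vol]_(x in Omega) cr2 x.
Proof.
have iQ := integrable_modulus2; have icr := integrable_cr2; have ism := integrable_smoothed.
have i1 j := (div1_gauss j).1; have i2 j := (div2_gauss j).1.
set c1 := c0 / 4; set c2 := 256 * n%:R * A ^+ 2 / c0.
have iQ' : vol.-integrable Omega (EFin \o (fun x => c1 * Q x)) by exact: (integrableZl mO c1 iQ).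
have icr' : vol.-integrable Omega (EFin \o (fun x => c2 * cr2 x)) by exact: (integrableZl mO c2 icr).
have i12 j : vol.-integrable Omega (EFin \o (fun x => div1 j x + div2 j x)).
  exact: (integrableD mO (i1 j) (i2 j)).
have isum := integrable_Rsum (index_enum 'I_n) mO i12.
have h : \int[vol]_(x in Omega) (smoothed Omega a b K x - c1 * Q x - c2 * cr2 x) <=
    \int[vol]_(x in Omega) \sum_(j < n) (div1 j x + div2 j x).
  apply: le_Rintegral => //.
    exact: (integrableB mO (integrableB mO ism iQ') icr').
  by move=> x _; exact: div_ge.
rewrite RintegralB// in h; last exact: (integrableB mO ism iQ').
rewrite RintegralB// in h.
rewrite !RintegralZl// in h.
have Esum := Rintegral_sum (index_enum 'I_n) mO i12.
rewrite Esum in h.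
(* Each of [div1] and [div2] costs 8 (2 (2 A)) = 32 A times the tube constant and the boundary
   integral. *)
have sumle : \sum_(j < n) \int[vol]_(x in Omega) (div1 j x + div2 j x) <=
    \sum_(j < n) 64 * tube_const R m * A * fine Ib.
  apply: ler_sum => j _; rewrite RintegralD//.
  have := le_trans (ler_norm _) (div1_gauss j).2.
  have := le_trans (ler_norm _) (div2_gauss j).2.
  have -> : 64 * tube_const R m * A * fine Ib =
    8 * tube_const R m * (2 * (2 * A)) * fine Ib + 8 * tube_const R m * (2 * (2 * A)) * fine Ib by ring.
  by move=> h1 h2; exact: lerD.
rewrite sumr_const card_ord -[_ *+ n]mulr_natl in sumle.
have := le_trans h sumle.
rewrite (_ : n%:R * (64 * tube_const R m * A * fine Ib) = 64 * n%:R * tube_const R m * A * fine Ib); last by ring.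
move: (_ * fine Ib) (c1 * _) (c2 * _) (Rintegral _ _ _) => u v w z; lra.
Qed.

End fixed_scale.

(** Letting [K] grow in [integral_smoothed_le] turns its left-hand side into at least c0 / 2 times
    the integral of [Q], half of which absorbs the c0 / 4 on the right. *)
Lemma boundary_poincare :
  c0 / 4 * \int[vol]_(x in Omega) Q x <=
  64 * n%:R * tube_const R m * A * fine Ib +
  256 * n%:R * A ^+ 2 / c0 * \int[vol]_(x in Omega) cr2 x.
Proof.
have iQ := integrable_modulus2.
have [B B0 hB] := within_continuous_bounded (compact_closure bO) (modulus2_within clU Ca Cb).
pose F K x := Num.min (smoothed Omega a b K x) (c0 / 2 * Q x).
pose L := B * (2 * ((2 * n)%:R * (vD + 4 ^+ m.+1))) + c0 / 2 * B.
have mQ : measurable_fun (Omega : set (measurable_rV R m)) Q.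
  exact: (measurable_of_continuous oO clU (modulus2_continuous Ca Cb)).
have mF K : measurable_fun (Omega : set (measurable_rV R m)) (F K).
  apply: measurable_minr; first exact: measurable_smoothed.
  exact: measurable_funM.
have FL K x : Omega x -> `|F K x| <= L.
  move=> Ox; have cx := OclO Ox.
  have QB : Q x <= B by apply: le_trans (hB _ cx); exact: ler_norm.
  have q0 := modulus2_ge0 a b x.
  have p1 := poisson_conv_le mO Ooo K mph1 (fun x _ => phase1_le a b x) x.
  have p2 := poisson_conv_le mO Ooo K mph2 (fun x _ => phase2_le a b x) x.
  have a1 := le_trans (re2_le a b x) QB; have a2 := le_trans (im2_le a b x) QB.
  have s1 : `|smoothed Omega a b K x| <= B * (2 * ((2 * n)%:R * (vD + 4 ^+ m.+1))).
    rewrite mulr_natl mulr2n mulrDr; apply: (le_trans (ler_normB _ _)).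
    by rewrite (normrM (A1 x)) (normrM (A2 x)); apply: lerD; apply: ler_pM.
  have s2 : `|c0 / 2 * Q x| <= c0 / 2 * B.
    by rewrite ger0_norm ?mulr_ge0 ?divr_ge0 ?(ltW c0_gt0)// ler_pM2l// divr_gt0.
  rewrite /F minEle /L; case: ifP => _.
    by rewrite (le_trans s1)// lerDl; apply: le_trans s2; exact: normr_ge0.
  by rewrite (le_trans s2)// lerDr; apply: le_trans s1; exact: normr_ge0.
have intF K := bounded_integrable mO Ooo (mF K) (FL K).
have intL : vol.-integrable Omega (EFin \o cst L).
  by apply: (bounded_integrable (B := `|L|)).
have mFE K : measurable_fun (Omega : set (measurable_rV R m)) (EFin \o F K).
  exact/measurable_EFinP.
have mQE : measurable_fun (Omega : set (measurable_rV R m)) (EFin \o (fun x => c0 / 2 * Q x)).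
  by apply/measurable_EFinP; exact: measurable_funM.
have Fcvg (x : measurable_rV R m) : Omega x -> (EFin \o F K) x @[K --> \oo] --> (EFin \o (fun x => c0 / 2 * Q x)) x.
  move=> Ox; apply: cvg_EFin; first exact: nearW.
  exact: (smoothed_cvg oO bO clU Ca Cb Ox).
have FLae : {ae vol, forall (x : measurable_rV R m) k, Omega x -> (`|(EFin \o F k) x| <= (EFin \o cst L) x)%E}.
  by apply: aeW => x k Ox; rewrite lee_fin; exact: FL.
have [_ _ Dcvg] := dominated_convergence mO mFE mQE (aeW _ Fcvg) intL FLae.
have iQ2 : vol.-integrable Omega (EFin \o (fun x => c0 / 2 * Q x)) by exact: (integrableZl mO (c0 / 2) iQ).
have Dcvg' : \int[vol]_(x in Omega) F K x @[K --> \oo] --> \int[vol]_(x in Omega) (c0 / 2 * Q x).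
  apply: fine_cvg; rewrite fineK; first exact: Dcvg.
  exact: integrable_fin_num.
have h : c0 / 2 * \int[vol]_(x in Omega) Q x <= 64 * n%:R * tube_const R m * A * fine Ib + c0 / 4 * \int[vol]_(x in Omega) Q x +
  256 * n%:R * A ^+ 2 / c0 * \int[vol]_(x in Omega) cr2 x.
  rewrite -(RintegralZl (c0 / 2) mO iQ) -(cvg_lim _ Dcvg')//.
  apply: limr_le; first by apply/cvg_ex; eexists; exact: Dcvg'.
  apply: nearW => K; apply: le_trans (integral_smoothed_le K).
  apply: le_Rintegral => //; first exact: integrable_smoothed.
  by move=> x _; rewrite /F ge_min lexx.
move: h; move: (_ * fine Ib) (_ * \int[vol]_(x in Omega) cr2 x) (\int[vol]_(x in Omega) Q x) => u v w; lra.
Qed.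

End poincare.

Lemma cnorm_sqr (R : realType) (z : R[i]) :
  cnorm z ^+ 2 = complex.Re z ^+ 2 + complex.Im z ^+ 2.
Proof. by case: z => x y; rewrite /= sqr_sqrtr// addr_ge0 ?sqr_ge0. Qed.

Lemma dbar_norm2E (R : realType) (n : nat) (f : 'rV[R]_(n + n) -> R[i]) z :
  dbar_norm2 f z = cr2 (fun x => complex.Re (f x)) (fun x => complex.Im (f x)) z.
Proof.
apply: eq_bigr => j _.
pose p := cr_re (fun x => complex.Re (f x)) (fun x => complex.Im (f x)) j z.
pose q := cr_im (fun x => complex.Re (f x)) (fun x => complex.Im (f x)) j z.
have -> : dbar j f z = Complex (p / 2) (q / 2).
  apply: (mulfI (x := 2 : R[i])); first by rewrite pnatr_eq0.
  rewrite /dbar mulrA mulfV ?pnatr_eq0// mul1r mulr_natl mulr2n /cpartial.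
  apply/eqP; rewrite eq_complex /= /p /q /cr_re /cr_im; move: (partial _ _ _) (partial _ _ _) (partial _ _ _) (partial _ _ _) => u1 u2 u3 u4.
  by apply/andP; split; apply/eqP; field.
by apply: (etrans (cnorm_sqr (Complex _ _))); rewrite /= -/p -/q; field.
Qed.

Definition trace_coef (R : realType) (n : nat) (v : R) : R :=
  64 * n%:R * tube_const R (n + n) * (v + 4 ^+ (n + n)).

Definition dbar_coef (R : realType) (n : nat) (v : R) : R :=
  256 * n%:R * (v + 4 ^+ (n + n)) ^+ 2 / poisson_const R n.

(** The coefficient c0 / 4 of [boundary_poincare], divided by a number that dominates both
    coefficients on its right-hand side. The 1 makes the denominator positive from their
    nonnegativity alone. *)
Definition poincare_ratio (R : realType) (n : nat) (v : R) : R :=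
  poisson_const R n / (4 * (trace_coef n v + dbar_coef n v + 1)).

Lemma trace_coef_ge0 (R : realType) (n : nat) (v : R) : 0 <= v -> 0 <= trace_coef n v.
Proof.
move=> v0; apply: mulr_ge0; last by apply: addr_ge0 => //; exact: exprn_ge0.
by apply: mulr_ge0; [rewrite -natrM; exact: ler0n|exact/ltW/tube_const_gt0].
Qed.

Lemma dbar_coef_ge0 (R : realType) (n : nat) (v : R) : (0 < n)%N -> 0 <= dbar_coef n v.
Proof.
move=> n0; apply: divr_ge0; last exact/ltW/poisson_const_gt0.
by apply: mulr_ge0; [rewrite -natrM; exact: ler0n|exact: sqr_ge0].
Qed.

Lemma poincare_ratio_gt0 (R : realType) (n : nat) (v : R) :
  (0 < n)%N -> 0 <= v -> 0 < poincare_ratio n v.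
Proof.
move=> n0 v0; apply: divr_gt0; first exact: poisson_const_gt0.
have := trace_coef_ge0 n v0; have := dbar_coef_ge0 v n0.
rewrite /trace_coef /dbar_coef; move: (_ / _) (_ * (v + _)) => C2 C1; lra.
Qed.

(** * Insertion of the weight *)

Section weighted.
Context (R : realType) (n : nat).
Hypothesis n0 : (0 < n)%N.
Local Notation m := (n + n)%N.
Local Notation V := 'rV[R]_m.
Local Notation vol := (@lebesgue_rV R m).
Local Notation dS := (hausdorff_measure (m := m) m.-1).
Local Notation S := (caratheodory_type (@hausdorff_outer R m m.-1)).
Variables (Omega U : set V) (a b w : V -> R).
Hypothesis oO : open Omega.
Hypothesis bO : bounded_set Omega.
Hypothesis clU : closure Omega `<=` U.
Hypothesis Ca : Ck 1 U a.
Hypothesis Cb : Ck 1 U b.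
Hypothesis cw : {within closure Omega, continuous w}.
Variables m1 m2 : R.
Hypothesis m1_gt0 : 0 < m1.
Hypothesis m1_le : forall x, closure Omega x -> m1 <= w x.
Hypothesis m2_ge : forall x, Omega x -> w x <= m2.
Hypothesis m2_gt0 : 0 < m2.

Local Notation Q := (modulus2 a b).
Local Notation Ib := (\int[dS]_(x in boundary Omega) (Q x)%:E)%E.
Local Notation ratio := (poincare_ratio n (fine (vol Omega))).

Let mO : measurable (Omega : set (measurable_rV R m)). Proof. exact: open_measurable_rV. Qed.
Let OclO : Omega `<=` closure Omega. Proof. exact: subset_closure. Qed.
Let bcl : boundary Omega `<=` closure Omega. Proof. by move=> x []. Qed.
Let w_ge0 x : closure Omega x -> 0 <= w x.
Proof. by move=> /m1_le; apply: le_trans; exact: ltW. Qed.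

Lemma cr2_ge0 x : 0 <= cr2 a b x.
Proof. by apply: sumr_ge0 => j _; rewrite divr_ge0// addr_ge0 ?sqr_ge0. Qed.

Let Qw_within : {within closure Omega, continuous (fun x => Q x * w x)}.
Proof.
move=> x; apply: (@continuousM _ (subspace (closure Omega)) Q w x).
  exact: (modulus2_within clU Ca Cb).
exact: cw.
Qed.

Let mw : measurable_fun (Omega : set (measurable_rV R m)) w.
Proof.
by apply: within_continuous_measurable_rV => //; exact: continuous_subspaceW cw.
Qed.

Lemma boundary_weighted_ge :
  (m1%:E * Ib <= \int[dS]_(x in boundary Omega) (Q x * w x)%:E)%E.
Proof.
have mb : measurable (boundary Omega : set S) := boundary_measurable Omega.
have mQ := within_continuous_boundary_measurable (modulus2_within clU Ca Cb).
have mQw := within_continuous_boundary_measurable Qw_within.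
have mQE : measurable_fun (boundary Omega : set S) (EFin \o Q) by apply/measurable_EFinP; exact: mQ.
have mQwE : measurable_fun (boundary Omega : set S) (EFin \o (fun x => Q x * w x)).
  by apply/measurable_EFinP; exact: mQw.
have Q0 (x : S) : boundary Omega x -> (0 <= (EFin \o Q) x)%E.
  by move=> _; rewrite lee_fin; exact: modulus2_ge0.
rewrite -(ge0_integralZl_EFin dS mb Q0 mQE (ltW m1_gt0)).
apply: ge0_le_integral.
- exact: mb.
- by move=> x bx; rewrite lee_fin; apply: mulr_ge0; [exact: ltW|exact: modulus2_ge0].
- exact: (measurable_funeM _ mQE).
- exact: mQwE.
- move=> x /bcl cx; rewrite lee_fin mulrC; apply: ler_wpM2l; first exact: modulus2_ge0.
  exact: m1_le.
Qed.

Lemma interior_weighted_le :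
  (\int[vol]_(x in Omega) (Q x * w x)%:E <= (m2 * \int[vol]_(x in Omega) Q x)%:E)%E.
Proof.
have iQ := integrable_modulus2 oO bO clU Ca Cb.
have mQ := measurable_of_continuous oO clU (modulus2_continuous Ca Cb).
rewrite EFinM [X in (_ * X)%E]fineK; last exact: integrable_fin_num.
rewrite -ge0_integralZl_EFin//; [|by move=> x _; rewrite lee_fin modulus2_ge0|exact/measurable_EFinP|exact: ltW].
apply: ge0_le_integral => //.
- by move=> x /OclO cx; rewrite lee_fin mulr_ge0 ?modulus2_ge0 ?w_ge0.
- by apply/measurable_EFinP; exact: measurable_funM.
- by apply: measurable_funeM; exact/measurable_EFinP.
- by move=> x Ox; rewrite lee_fin mulrC ler_wpM2r ?modulus2_ge0 ?m2_ge.
Qed.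

Lemma interior_weighted_ge :
  ((m1 * \int[vol]_(x in Omega) cr2 a b x)%:E <= \int[vol]_(x in Omega) (cr2 a b x * w x)%:E)%E.
Proof.
have icr := integrable_cr2 oO bO clU Ca Cb.
have mcr : measurable_fun (Omega : set (measurable_rV R m)) (EFin \o cr2 a b) := measurable_int _ icr.
rewrite EFinM [X in (_ * X)%E]fineK; last exact: integrable_fin_num.
rewrite -ge0_integralZl_EFin//; [|by move=> x _; rewrite lee_fin cr2_ge0|exact: ltW].
apply: ge0_le_integral => //.
- by move=> x _; rewrite mule_ge0 ?lee_fin ?cr2_ge0// ltW.
- exact: measurable_funeM.
- by apply/measurable_EFinP; apply: measurable_funM => //; exact/measurable_EFinP.
- by move=> x Ox; rewrite lee_fin mulrC ler_wpM2l ?cr2_ge0 ?m1_le//; exact: OclO.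
Qed.

Lemma weighted_poincare :
  ((m1 / m2 * ratio)%:E * \int[vol]_(x in Omega) (Q x * w x)%:E <=
   \int[vol]_(x in Omega) (cr2 a b x * w x)%:E +
   \int[dS]_(x in boundary Omega) (Q x * w x)%:E)%E.
Proof.
have v0 : 0 <= fine (vol Omega) by exact/fine_ge0/measure_ge0.
have Ib0 : (0 <= Ib)%E by apply: integral_ge0 => x _; rewrite lee_fin modulus2_ge0.
have p0 : (0 <= (m1 * \int[vol]_(x in Omega) cr2 a b x)%:E)%E.
  by rewrite lee_fin mulr_ge0 ?(ltW m1_gt0)//; apply: Rintegral_ge0 => x _; exact: cr2_ge0.
(* If the boundary integral is infinite, so is the weighted one, because the weight is at least m1 >
   0. The interior term is bounded below by 0, so the right-hand side is indeed +oo. *)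
have [Iboo|Iboo] := eqVneq Ib +oo%E.
  have := boundary_weighted_ge; rewrite Iboo gt0_muley ?lte_fin// leye_eq => /eqP ->.
  rewrite addey ?leey// gt_eqF//; apply: lt_le_trans interior_weighted_ge.
  by apply: lt_le_trans p0; exact: ltNyr.
have fIb : Ib \is a fin_num by rewrite ge0_fin_numE// ltey.
(* The weight is replaced by its upper bound m2 on the left and by its lower bound m1 on the right,
   which explains the factor m1 / m2. *)
apply: (@le_trans _ _ ((m1 / m2 * ratio)%:E * (m2 * \int[vol]_(x in Omega) Q x)%:E)%E).
  rewrite lee_wpmul2l ?interior_weighted_le// lee_fin mulr_ge0 ?(ltW (poincare_ratio_gt0 n0 v0))//.
  by rewrite divr_ge0 ?ltW.
apply: le_trans (leeD interior_weighted_ge boundary_weighted_ge).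
rewrite -[Ib]fineK// -!EFinM -EFinD lee_fin.
have Ilt : (Ib < +oo)%E by rewrite ltey.
have := boundary_poincare n0 oO bO clU Ca Cb Ilt.
rewrite -/(trace_coef n (fine (vol Omega))) -/(dbar_coef n (fine (vol Omega))).
have i0 : 0 <= fine Ib := fine_ge0 Ib0.
move: p0; rewrite lee_fin pmulr_rge0// /poincare_ratio.
move: (trace_coef_ge0 n v0) (dbar_coef_ge0 (fine (vol Omega)) n0).
move: (trace_coef _ _) (dbar_coef _ _) (fine Ib) (poisson_const R n) i0 => C1 C2 i c i0 C10 C20.
move: (\int[vol]_(x in Omega) cr2 a b x) (\int[vol]_(x in Omega) Q x) => p q p0 h.
have D0 : 0 < C1 + C2 + 1 by lra.
rewrite (_ : m1 / m2 * _ * _ = m1 * ((c / 4 * q) / (C1 + C2 + 1))); last first.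
  by field; rewrite !gt_eqF.
rewrite -mulrDr ler_pM2l// ler_pdivrMr//; apply: (le_trans h).
have e1 : 0 <= C1 * p by exact: mulr_ge0.
have e2 : 0 <= C2 * i by exact: mulr_ge0.
rewrite (_ : (p + i) * _ = C1 * i + C2 * p + (C1 * p + C2 * i + p + i)); last by ring.
by rewrite lerDl !addr_ge0.
Qed.

End weighted.

Section weight_bounds.
Context (R : realType) (m : nat) (Omega : set 'rV[R]_m) (phi : 'rV[R]_m -> R).
Hypothesis bO : bounded_set Omega.
Hypothesis O0 : Omega !=set0.
Hypothesis cphi : {within closure Omega, continuous phi}.
Local Notation w := (fun z => expR (- phi z)).

Lemma within_continuous_weight : {within closure Omega, continuous w}.
Proof.
move=> x; apply: (@continuous_comp (subspace (closure Omega)) R R phi (fun t => expR (- t)) x).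
  exact: cphi.
apply: (@continuous_comp R R R -%R expR (phi x)); first exact: opp_continuous.
exact: continuous_expR.
Qed.

Let B : exists2 B, 0 < B & forall x, closure Omega x -> `|phi x| <= B.
Proof. exact: within_continuous_bounded (compact_closure bO) cphi. Qed.

Lemma inf_weight_gt0 : 0 < inf [set w z | z in Omega].
Proof.
have [b b0 hb] := B; apply: (@lt_le_trans _ _ (expR (- b))); first exact: expR_gt0.
apply: lb_le_inf; first by have [x Ox] := O0; exists (w x), x.
move=> _ [x Ox <-]; rewrite ler_expR lerN2.
by apply: le_trans (hb x (subset_closure Ox)); exact: ler_norm.
Qed.

(** The infimum runs over [Omega], but the boundary integral needs the bound on the closure. The set
    where it holds is closed in the closure and contains [Omega]. *)
Lemma inf_weight_le x : closure Omega x -> inf [set w z | z in Omega] <= w x.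
Proof.
move=> cx; have hl : has_lbound [set w z | z in Omega].
  by exists 0 => _ [y _ <-]; exact: expR_ge0.
have : closed ((w : subspace (closure Omega) -> R) @^-1` [set t | inf [set w z | z in Omega] <= t]).
  by have := within_continuous_weight; rewrite continuous_closedP; apply; exact: closed_ge.
move=> /closed_subspaceP[W cW WD].
have OW : closure Omega `<=` W.
  rewrite (closure_id W).1//; apply: closureS => y Oy.
  have : ((w : subspace (closure Omega) -> R) @^-1`
    [set t | inf [set w z | z in Omega] <= t] `&` closure Omega) y.
    by split; [apply: ge_inf => //; exists y|exact: subset_closure].
  by rewrite -WD => -[].
have : (W `&` closure Omega) x by split => //; exact: OW.
by rewrite WD => -[].
Qed.

Lemma sup_weight_ge x : Omega x -> w x <= sup [set w z | z in Omega].
Proof.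
move=> Ox; have [b b0 hb] := B; apply: ub_le_sup; last by exists x.
exists (expR b) => _ [y Oy <-]; rewrite ler_expR.
by apply: le_trans (hb y (subset_closure Oy)); rewrite -normrN; exact: ler_norm.
Qed.

End weight_bounds.

Theorem theorem1p6 (R : realType) :
  exists delta : \bar R -> \bar R -> R -> R -> R -> nat -> R,
  forall (n : nat) (Omega : set 'rV[R]_(n + n)) (rho phi : 'rV[R]_(n + n) -> R),
  (0 < n)%N ->
  open Omega -> connected Omega -> bounded_set Omega ->
  defining_function 2 Omega rho ->
  {within closure Omega, continuous phi} ->
  let bOmega := boundary Omega in
  let vol := lebesgue_rV (m := n + n) in
  let dS := hausdorff_measure (m := n + n) (n + n).-1 in
  let K := (sup [set enorm (gradient rho z) | z in Omega] +
            sup [set `|laplacian rho z| | z in Omega]) /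
           inf [set enorm (gradient rho z) | z in bOmega] in
  let m1 := inf [set expR (- phi z) | z in Omega] in
  let m2 := sup [set expR (- phi z) | z in Omega] in
  let c := delta (vol Omega) (dS bOmega) K m1 m2 n in
  0 < c /\
  forall f : 'rV[R]_(n + n) -> R[i], C1_closure Omega f ->
  (c%:E * \int[vol]_(z in Omega) (cnorm (f z) ^+ 2 * expR (- phi z))%:E <=
   \int[vol]_(z in Omega) (dbar_norm2 f z * expR (- phi z))%:E +
   \int[dS]_(z in bOmega) (cnorm (f z) ^+ 2 * expR (- phi z))%:E)%E.
Proof.
(* The default value 1 serves empty [Omega] only, where [m1] and [m2] are the
   junk value 0. *)
exists (fun vO _ _ m1 m2 n => let c := m1 / m2 * poincare_ratio n (fine vO) in
  if 0 < c then c else 1).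
move=> n Omega rho phi n0 oO _ bO _ cphi bOmega vol dS K m1 m2 c.
split => [|f [U [oU clU Ca Cb]]]; first by rewrite /c; case: ifPn.
have [->|/set0P O0] := eqVneq Omega set0.
  rewrite integral_set0 mule0; apply: adde_ge0; apply: integral_ge0 => x _.
    by rewrite lee_fin dbar_norm2E mulr_ge0 ?cr2_ge0 ?expR_ge0.
  by rewrite lee_fin mulr_ge0 ?sqr_ge0 ?expR_ge0.
have m1_gt0 : 0 < m1 by exact: inf_weight_gt0.
have m2_gt0 : 0 < m2.
  by have [x Ox] := O0; apply: lt_le_trans (sup_weight_ge bO cphi Ox); exact: expR_gt0.
have cE : c = m1 / m2 * poincare_ratio n (fine (vol Omega)).
  rewrite /c ifT//; apply: mulr_gt0; first exact: divr_gt0.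
  by apply: poincare_ratio_gt0 => //; apply: fine_ge0; exact: measure_ge0.
have modulus2E : modulus2 (fun x => complex.Re (f x)) (fun x => complex.Im (f x)) =
    fun x => cnorm (f x) ^+ 2.
  by apply/funext => x; exact/esym/cnorm_sqr.
have cr2E : cr2 (fun x => complex.Re (f x)) (fun x => complex.Im (f x)) = dbar_norm2 f.
  by apply/funext => x; exact/esym/dbar_norm2E.
have := weighted_poincare n0 oO bO clU Ca Cb (within_continuous_weight cphi)
  m1_gt0 (inf_weight_le cphi) (sup_weight_ge bO cphi) m2_gt0.
by rewrite modulus2E cr2E cE.
Qed.
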